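(* Let $\mu>0$, $a,b\in\mathbb{R}$, $\alpha\in(\tfrac52,\infty)$ and let $B_0\in L^2(\mathbb{S}^1)$ be real-valued with zero mean. There exists a time $T>0$, depending on $\|B_0\|_{L^2(\mathbb S^1)}$, such that there exists a unique solution $B(t,x)$ on $[0,T)$ to $$B_t+aBJ_x+bJB_x+\mu\Lambda^\alpha B=0,\qquad B_x=\mathcal{H}J,\qquad x\in\mathbb{S}^1,$$ with initial data $B(0,x)=B_0(x)$, satisfying $$B\in C\left([0,T);L^2(\mathbb{S}^1)\right)\cap L^2\left([0,T);H^{\frac{\alpha}{2}}(\mathbb{S}^1)\right)$$ together with $$\sup_{0<t<T}t^{\frac{\beta}{\alpha}}\|B(t)\|_{H^{\beta}(\mathbb{S}^1)}<\infty\quad\text{for all }\beta\ge 0,$$ $$\lim_{t\to0}t^{\frac{\beta}{\alpha}}\|B(t)\|_{H^{\beta}(\mathbb{S}^1)}=0\quad\text{for all }\beta>0.$$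
   Context: $\mathbb{S}^1=[-\pi,\pi]$ is the periodic interval. $\mathcal{H}$ is the periodic Hilbert transform $\mathcal{H}f(x)=\frac{1}{2\pi}\,\mathrm{P.V.}\int_{-\pi}^{\pi}f(y)\cot\left(\frac{x-y}{2}\right)dy$, and $\Lambda=(-\partial_{xx})^{1/2}=\mathcal{H}\partial_x$, i.e. $\Lambda^\alpha$ is the Fourier multiplier with symbol $|k|^\alpha$. The unknown is the real-valued function $B$. The relation $B_x=\mathcal{H}J$ is understood with $J=-\Lambda B$ (so $J$ has zero mean), and $B$ is normalized by $\int_{\mathbb{S}^1}B(t,x)\,dx=0$, a condition formally preserved by the equation. $H^s(\mathbb{S}^1)$ denotes the (inhomogeneous) $L^2$-based Sobolev space. *)

(* Defs.v *)
From HB Require Import structures.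
From mathcomp Require Import all_boot all_order all_algebra.
From mathcomp Require Import all_classical all_reals all_analysis.

Set Implicit Arguments.
Unset Strict Implicit.
Unset Printing Implicit Defensive.

Import Order.TTheory GRing.Theory Num.Theory.
Import numFieldNormedType.Exports.

Local Open Scope classical_set_scope.
Local Open Scope ring_scope.

(* A function on the circle is a 2 pi-periodic function on the line; norms,
   means and almost-everywhere statements refer to one period. *)
Definition S1 (R : realType) : set R := `[- pi, pi].
Arguments S1 R : clear implicits.

Definition zero_mean (R : realType) (f : R -> R) : Prop :=
  \int[lebesgue_measure]_(x in S1 R) f x = 0.

Definition normL2 (R : realType) (f : R -> R) : \bar R :=
  Lnorm lebesgue_measure 2%:E (EFin \o (f \_ (S1 R))).

Definition memL2 (R : realType) (f : R -> R) : Prop :=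
  periodic f (pi *+ 2) /\ f \_ (S1 R) \in Lfun lebesgue_measure 2%:E.

(* Real form of the Fourier series of a real-valued function: the complex
   coefficients (2 pi)^-1 * int f(x) e^(-ikx) dx are
   (fcos f k - i fsin f k) / 2 at k >= 0 and the conjugate at - k. *)
Definition fcos (R : realType) (f : R -> R) (k : nat) : R :=
  pi^-1 * \int[lebesgue_measure]_(x in S1 R) (f x * cos (k%:R * x)).

Definition fsin (R : realType) (f : R -> R) (k : nat) : R :=
  pi^-1 * \int[lebesgue_measure]_(x in S1 R) (f x * sin (k%:R * x)).

(* The square root of the sum over all integers k of
   (1 + k^2)^s |f^(k)|^2, where the terms k and - k are grouped. *)
Definition normH (R : realType) (s : R) (f : R -> R) : \bar R :=
  sqrte ((fcos f 0 ^+ 2 / 4)%:E +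
    \sum_(1 <= k <oo)
      ((1 + k%:R ^+ 2) `^ s * ((fcos f k ^+ 2 + fsin f k ^+ 2) / 2))%:E)%E.

(* The Fourier multiplier with symbol |k|^s for s > 0 (so that the mode k = 0
   is killed), as the limit of the symmetric partial sums. *)
Definition Lambda (R : realType) (s : R) (f : R -> R) (x : R) : R :=
  limn (fun n : nat => \sum_(1 <= k < n)
    k%:R `^ s * (fcos f k * cos (k%:R * x) + fsin f k * sin (k%:R * x))).

(* For a periodic f the period [-pi, pi] of the variable y may be replaced by
   [x - pi, x + pi], in which y = x is the only singular point. *)
Definition hilbert (R : realType) (f : R -> R) (x : R) : R :=
  (pi *+ 2)^-1 *
  lim ((\int[lebesgue_measure]_(y in [set y : R | eps <= `|x - y| <= pi])
          (f y * (cos ((x - y) / 2) / sin ((x - y) / 2)))) @[eps --> 0^'+]).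

(* B t x is the unknown at time t and position x. *)
Definition current (R : realType) (B : R -> R -> R) (t x : R) : R :=
  - Lambda 1 (B t) x.

(* The class of solutions below is smooth in x at positive times, so the
   system is required pointwise there; J is [current B]. *)
Definition solves (R : realType) (mu a b alpha T : R) (B : R -> R -> R) : Prop :=
  forall t x : R, 0 < t < T ->
  [/\ derivable (fun s => B s x) t 1,
      derivable (B t) x 1,
      derivable (current B t) x 1,
      derive1 (fun s => B s x) t + a * B t x * derive1 (current B t) x
        + b * current B t x * derive1 (B t) x + mu * Lambda alpha (B t) x = 0
    & derive1 (B t) x = hilbert (current B t) x].

Definition contL2 (R : realType) (T : R) (B : R -> R -> R) : Prop :=
  (forall t, t \in `[0, T[ -> memL2 (B t)) /\
  (forall t0, t0 \in `[0, T[ ->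
     normL2 (fun x => B t x - B t0 x) @[t --> within `[0, T[ (nbhs t0)]
       --> 0%E).

(* Strong measurability in H^s is automatic for curves in [contL2 T]. *)
Definition sqintH (R : realType) (T s : R) (B : R -> R -> R) : Prop :=
  lebesgue_measure.-integrable `[0, T[ (fun t => normH s (B t) ^+ 2)%E.

Definition solution (R : realType) (mu a b alpha T : R) (B0 : R -> R)
    (B : R -> R -> R) : Prop :=
  [/\ contL2 T B /\ sqintH T (alpha / 2) B,
      (forall t, t \in `[0, T[ -> zero_mean (B t)),
      B 0 = B0 %[ae lebesgue_measure in S1 R],
      solves mu a b alpha T B
    & (forall beta : R, 0 <= beta ->
        (ereal_sup [set (t `^ (beta / alpha))%:E * normH beta (B t)
                   | t in [set t : R | 0 < t < T]%R ] < +oo)%E) /\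
      (forall beta : R, 0 < beta ->
        ((t `^ (beta / alpha))%:E * normH beta (B t))%E @[t --> 0^'+]
          --> 0%E)].

(* Main.v *)
(* Write B = sum_k (u_k cos kx + u'_k sin kx). The coefficients satisfy
   u' + mu k^alpha u = N(u), where N(u) collects the coefficients of
   a B (Lambda B)_x + b (Lambda B) B_x. Put s = t^(1/alpha). If
   exp(la s k) (1 + s k)^2 u_k is square summable with norm at most A, then so
   are B, s B_x, s Lambda B and s^2 (Lambda B)_x with the weight exp(la s k), and
   since a coefficient of a product only involves frequencies with k <= m + l,
   |N(u)_k| <= C A^2 t^(-2/alpha) exp(- la s k). The exponent 2/alpha is below 1,
   and comparison of the scalar equations with an explicit supersolution returns
   the weighted norm with the gain t^theta, theta > 0; here alpha > 5/2 leaves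
   room for a decay k^(-kp) with 1/2 < kp <= alpha - 2, so that the estimate is
   square summable in k. Hence the Duhamel iteration contracts on a short time
   interval depending on the L2 norm of the data only, and the same estimate
   with la = 0, started at an arbitrary time, gives uniqueness. Everything asked
   of the solution then follows by dominated convergence in k from the bound
   exp(la s k) |u_k(t)| <= C (|u_k(0)| + k^(-(alpha - 2))). Square integrable
   data need Parseval's inequality for arbitrary L2 functions, proved by Fatou's
   lemma from difference quotients of the primitive, whose Fourier series is
   absolutely convergent. *)
From HB Require Import structures.
Require Import Defs.
From mathcomp Require Import all_boot all_order all_algebra.
From mathcomp Require Import all_classical all_reals all_analysis.
From mathcomp Require Import measurable_realfun ring lra.
Set Implicit Arguments.
Unset Strict Implicit.
Unset Printing Implicit Defensive.
Import Order.TTheory GRing.Theory Num.Theory.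
Import numFieldNormedType.Exports.
Local Open Scope classical_set_scope.
Local Open Scope ring_scope.

(** * Absolutely convergent series indexed from 1: dominated convergence and termwise
    differentiation *)

Section series_from_one.
Context {R : realType}.
Implicit Types (f g : nat -> R) (K : R).

(** With [s = t^(1/alpha)] the heat factor depends on [s k] only, because [k^alpha t = (s k)^alpha];
    hence a weight in [s k]. Both products carry two derivatives in total, split as 0 + 2 or 1 + 1:
    this fixes the power 2 of [1 + s k] and the loss [s^(-2)]. Dissipation gains [(s k)^alpha]; two
    powers pay for the weight and at most [alpha - 2] are left to be traded for decay in [k]. The
    Duhamel integral is not estimated as a convolution: each mode solves a scalar linear equation
    with a source [t^(-r) exp(- la s k)], [r = 2 / alpha], whose supersolution is in closed form, so
    that only a differential inequality is checked. A competing solution is not known to decay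
    exponentially in [k], which is why uniqueness uses [la = 0]; the bounds for [beta = 0] and
    [beta = 2] control that weight, and counting time from a later origin only lowers it, so the
    step length is the same at every restart. Since the system is required pointwise, with a
    principal value, Fourier inversion and an explicit evaluation of the cotangent integral are also
    part of the argument. *)

Definition psum f (n : nat) : R := \sum_(1 <= k < n) f k.
Definition tsum f : R := limn (psum f).

(** Absolute summability with an explicit bound: bounds combine by addition and scaling, and
    uniformity in a parameter is expressed by a common [K]. *)
Definition asum_le f K : Prop := forall n, psum (fun k => `|f k|) n <= K.

Lemma eq_psum f g n : (forall k, (0 < k)%N -> f k = g k) -> psum f n = psum g n.
Proof. by move=> fg; apply: eq_big_nat => k /andP[k1 _]; rewrite fg. Qed.

Lemma eq_tsum f g : (forall k, (0 < k)%N -> f k = g k) -> tsum f = tsum g.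
Proof.
by move=> fg; rewrite /tsum; congr (lim (_ @ \oo)); apply/funext => n; exact: eq_psum.
Qed.

Lemma le_psum f g n : (forall k, (0 < k)%N -> f k <= g k) -> psum f n <= psum g n.
Proof. by move=> fg; apply: ler_sum_nat => k /andP[k1 _]; exact: fg. Qed.

Lemma ler_norm_psum f n : `|psum f n| <= psum (fun k => `|f k|) n.
Proof. exact: ler_norm_sum. Qed.

Lemma psumD f g n : psum (fun k => f k + g k) n = psum f n + psum g n.
Proof. exact: big_split. Qed.

Lemma psumB f g n : psum (fun k => f k - g k) n = psum f n - psum g n.
Proof. by rewrite /psum sumrB. Qed.

Lemma psumZ c f n : psum (fun k => c * f k) n = c * psum f n.
Proof. by rewrite /psum mulr_sumr. Qed.

Lemma psum_ge0 f n : (forall k, (0 < k)%N -> 0 <= f k) -> 0 <= psum f n.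
Proof. by move=> f0; rewrite /psum big_nat sumr_ge0// => k /andP[k1 _]; exact: f0. Qed.

Lemma psum_split f m n : (0 < m)%N -> (m <= n)%N ->
  psum f n = psum f m + \sum_(m <= k < n) f k.
Proof. by move=> m0 mn; rewrite /psum (big_cat_nat m0 mn). Qed.

Lemma psum_nd f m n : (forall k, (0 < k)%N -> 0 <= f k) -> (m <= n)%N ->
  psum f m <= psum f n.
Proof.
move=> f0 mn; case: m mn => [|m] mn; first by rewrite {1}/psum big_geq// psum_ge0.
rewrite (psum_split _ _ mn)// lerDl big_nat sumr_ge0// => k /andP[km _].
by apply: f0; exact: leq_trans km.
Qed.

Lemma psum_term f k n : (forall k, (0 < k)%N -> 0 <= f k) -> (0 < k)%N ->
  (k < n)%N -> f k <= psum f n.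
Proof.
move=> f0 k0 kn; apply: le_trans (psum_nd f0 kn).
by rewrite (psum_split _ k0 (leqnSn k)) big_nat1 lerDr psum_ge0.
Qed.

Lemma asum_le_ge0 f K : asum_le f K -> 0 <= K.
Proof. by move=> /(_ 0%N); rewrite /psum big_geq. Qed.

Lemma asum_leW f g K : (forall k, (0 < k)%N -> `|f k| <= `|g k|) ->
  asum_le g K -> asum_le f K.
Proof. by move=> fg gK n; apply: le_trans (gK n); exact: le_psum. Qed.

Lemma asum_leD f g K L : asum_le f K -> asum_le g L ->
  asum_le (fun k => f k + g k) (K + L).
Proof.
move=> fK gL n; apply: le_trans (lerD (fK n) (gL n)).
by rewrite -psumD; apply: le_psum => k _; exact: ler_normD.
Qed.

Lemma asum_leZ c f K : asum_le f K -> asum_le (fun k => c * f k) (`|c| * K).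
Proof.
move=> fK n; rewrite (@eq_psum _ (fun k => `|c| * `|f k|)); last first.
  by move=> k _; rewrite normrM.
by rewrite psumZ ler_wpM2l.
Qed.

Lemma asum_leN f K : asum_le f K -> asum_le (fun k => - f k) K.
Proof. by move=> fK; apply: asum_leW fK => k _; rewrite normrN. Qed.

Lemma nonneg_psum_cvg f K : (forall k, (0 < k)%N -> 0 <= f k) ->
  (forall n, psum f n <= K) -> cvgn (psum f).
Proof.
move=> f0 fK; apply: nondecreasing_is_cvgn.
  by move=> m n mn; exact: psum_nd.
by exists K => _ [n _ <-].
Qed.

Lemma asum_tail f K e : asum_le f K -> 0 < e ->
  exists N, (0 < N)%N /\ forall n, \sum_(N <= k < n) `|f k| <= e.
Proof.
move=> fK e0.
have f0 k : (0 < k)%N -> 0 <= `|f k| by [].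
have /cvg_ex[l fl] := nonneg_psum_cvg f0 fK.
have /cvgrPdist_lt/(_ _ e0)[N _ NP] := fl.
have nl n : psum (fun k => `|f k|) n <= l.
  have := nondecreasing_cvgn_le (fun m n mn => psum_nd f0 mn) (cvgP _ fl) n.
  by rewrite (cvg_lim _ fl).
exists N.+1; split => // n.
have [nN|Nn] := leqP n N.+1; first by rewrite big_geq// ltW.
have := NP N.+1 (leqnSn N); rewrite /= ger0_norm ?subr_ge0//.
rewrite ltrBlDr => h.
have := nl n; rewrite (psum_split _ _ (ltnW Nn))// => h2.
by lra.
Qed.

(** [f = (f + |f|) - |f|] is a difference of two nonnegative series with bounded partial sums. *)
Lemma asum_cvg f K : asum_le f K -> psum f n @[n --> \oo] --> tsum f.
Proof.
move=> fK.
suff : cvgn (psum f) by [].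
have -> : psum f = (fun n => psum (fun k => f k + `|f k|) n - psum (fun k => `|f k|) n).
  by apply/funext => n; rewrite psumD addrK.
apply: is_cvgB; last exact: nonneg_psum_cvg fK.
apply: (@nonneg_psum_cvg _ (K + K)).
  by move=> k _; rewrite -lerBlDr sub0r lerNl ler_normr lexx orbT.
move=> n; rewrite psumD lerD//.
by apply: le_trans (fK n); apply: le_psum => k _; rewrite ler_norm.
Qed.

Lemma tsum_le f K : asum_le f K -> `|tsum f| <= K.
Proof.
move=> fK; have h : `|psum f n| @[n --> \oo] --> `|tsum f| by apply: cvg_norm; exact: asum_cvg fK.
refine (cvgr_to_le h _); near=> n.
by apply: le_trans (fK n); exact: ler_norm_psum.
Unshelve. all: by end_near. Qed.

Lemma tsumD f g K L : asum_le f K -> asum_le g L ->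
  tsum (fun k => f k + g k) = tsum f + tsum g.
Proof.
move=> fK gL; apply/cvg_lim => //.
have -> : psum (fun k => f k + g k) = (fun n => psum f n + psum g n).
  by apply/funext => n; exact: psumD.
by apply: cvgD; exact: asum_cvg.
Qed.

Lemma tsumZ c f K : asum_le f K -> tsum (fun k => c * f k) = c * tsum f.
Proof.
move=> fK; apply/cvg_lim => //.
have -> : psum (fun k => c * f k) = (fun n => c * psum f n).
  by apply/funext => n; exact: psumZ.
by apply: cvgMr; exact: asum_cvg.
Qed.

Lemma tsumB f g K L : asum_le f K -> asum_le g L ->
  tsum (fun k => f k - g k) = tsum f - tsum g.
Proof.
move=> fK gL; apply/cvg_lim => //.
have -> : psum (fun k => f k - g k) = (fun n => psum f n - psum g n).
  by apply/funext => n; exact: psumB.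
by apply: cvgB; exact: asum_cvg.
Qed.

Lemma tsum0 : tsum (fun=> 0) = 0.
Proof.
apply/cvg_lim => //; have -> : psum (fun=> 0) = cst 0.
  by apply/funext => n; rewrite /psum big1.
exact: cvg_cst.
Qed.

Lemma cvg_psum (T : Type) (F : set_system T) {FF : Filter F} (f : T -> nat -> R)
    (l : nat -> R) n :
  (forall k, (0 < k)%N -> f x k @[x --> F] --> l k) ->
  psum (f x) n @[x --> F] --> psum l n.
Proof.
move=> fl; rewrite /psum; elim: n => [|n IH].
  by under eq_fun do rewrite big_geq//; rewrite big_geq//; exact: cvg_cst.
case: n IH => [|n] IH.
  by under eq_fun do rewrite big_geq//; rewrite big_geq//; exact: cvg_cst.
under eq_fun do rewrite big_nat_recr//=; rewrite big_nat_recr//=.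
by apply: cvgD => //; exact: fl.
Qed.

Lemma tsum_split f K m : asum_le f K -> (0 < m)%N ->
  forall e, (forall n, \sum_(m <= k < n) `|f k| <= e) -> `|tsum f - psum f m| <= e.
Proof.
move=> fK m0 e fe.
have h : `|psum f n - psum f m| @[n --> \oo] --> `|tsum f - psum f m|.
  by apply: cvg_norm; apply: cvgB; [exact: asum_cvg fK|exact: cvg_cst].
refine (cvgr_to_le h _); near=> n.
have mn : (m <= n)%N by near: n; exact: nbhs_infty_ge.
rewrite (psum_split _ m0 mn) addrAC subrr add0r.
by apply: le_trans (fe n); exact: ler_norm_sum.
Unshelve. all: by end_near. Qed.

(** Dominated convergence for series along an arbitrary filter: beyond some [N] both tails are at
    most [e / 4] by the majorant, and the head is a finite sum. *)
Lemma tannery (T : Type) (F : set_system T) {FF : Filter F} (f : T -> nat -> R)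
    (l g : nat -> R) K :
  asum_le g K ->
  (forall k, (0 < k)%N -> `|l k| <= g k) ->
  (\forall x \near F, forall k, (0 < k)%N -> `|f x k| <= g k) ->
  (forall k, (0 < k)%N -> f x k @[x --> F] --> l k) ->
  tsum (f x) @[x --> F] --> tsum l.
Proof.
move=> gK lg fg fl; apply/cvgrPdist_le => e e0.
have e4 : 0 < e / 4 by rewrite divr_gt0.
have [N [N0 NP]] := asum_tail gK e4.
have tail h : (forall k, (0 < k)%N -> `|h k| <= g k) ->
    `|tsum h - psum h N| <= e / 4.
  move=> hg; apply: (@tsum_split _ K) => //.
    by apply: asum_leW gK => k k0; rewrite (le_trans (hg _ k0))// ler_norm.
  move=> n; apply: le_trans (NP n); apply: ler_sum_nat => k /andP[Nk _].
  by apply: le_trans (ler_norm _); apply: hg; exact: leq_trans Nk.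
have /cvgrPdist_le/(_ _ e4) psN : psum (f x) N @[x --> F] --> psum l N.
  exact: cvg_psum.
near=> x.
have -> : tsum l - tsum (f x) = (tsum l - psum l N) + (psum l N - psum (f x) N)
    - (tsum (f x) - psum (f x) N) by ring.
have hx : forall k, (0 < k)%N -> `|f x k| <= g k by near: x.
have hl := tail _ lg; have hf := tail _ hx.
have hp : `|psum l N - psum (f x) N| <= e / 4 by near: x.
rewrite (le_trans (ler_normB _ _))//.
have := ler_normD (tsum l - psum l N) (psum l N - psum (f x) N).
move: hl hf hp; lra.
Unshelve. all: by end_near. Qed.

(** [tannery] applied to the difference quotients, which the mean value theorem dominates by the
    majorant [g] of the derivatives. *)
Lemma tsum_derive (f df : R -> nat -> R) (g : nat -> R) (t u v K : R) L :
  u < t < v ->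
  asum_le g K ->
  (forall s, u < s < v -> asum_le (f s) L) ->
  (forall s k, u < s < v -> (0 < k)%N -> is_derive s 1 (fun s => f s k) (df s k)) ->
  (forall s k, u < s < v -> (0 < k)%N -> `|df s k| <= g k) ->
  is_derive t 1 (fun s => tsum (f s)) (tsum (df t)).
Proof.
move=> /andP[ut tv] gK fL fd dg.
have tuv : u < t < v by rewrite ut.
pose q (h : R) k := h^-1 * (f (h + t) k - f t k).
have near0 : \forall h \near 0^', u < h + t < v.
  have : \forall s \near t, s \in `]u, v[.
    by apply: near_in_itvoo; rewrite in_itv/= ut.
  move=> /nbhs_ballP[e /= e0 he].
  exists e => //= h; rewrite /ball_/= sub0r normrN => he2 _.
  by have := he (h + t); rewrite /ball/= opprD addrCA subrr addr0 normrN in_itv/=; exact.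
have cv : tsum (q h) @[h --> 0^'] --> tsum (df t).
  apply: (tannery (g := g) gK).
  - by move=> k k0; exact: dg.
  - near=> h => k k0.
    have huv : u < h + t < v by near: h.
    have h0 : h != 0 by near: h; exact: nbhs_dnbhs_neq.
    rewrite /q normrM normfV ler_pdivrMl ?normr_gt0// mulrC.
    have sub x y z : u < x < v -> u < y < v -> x <= z <= y -> u < z < v by lra.
    have der z : u < z < v -> is_derive z 1 (fun s => f s k) (df z k).
      by move=> ?; exact: fd.
    have cts x y : u < x < v -> u < y < v -> {within `[x, y], continuous (fun s => f s k)}.
      move=> hx hy; apply: derivable_within_continuous => z; rewrite in_itv/= => hz.
      by have [] := der z (sub _ _ _ hx hy hz).
    have [ht|ht|/eqP] := ltgtP t (h + t).
    + have [] := @MVT _ (fun s => f s k) (df ^~ k) _ _ ht.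
      * move=> z; rewrite in_itv/= => hz; apply: der; apply: (sub t (h + t)) => //; lra.
      * exact: cts.
      move=> z; rewrite in_itv/= => hz ->; rewrite addrK normrM ler_wpM2r//.
      by apply: dg => //; apply: (sub t (h + t)) => //; lra.
    + have [] := @MVT _ (fun s => f s k) (df ^~ k) _ _ ht.
      * move=> z; rewrite in_itv/= => hz; apply: der; apply: (sub (h + t) t) => //; lra.
      * exact: cts.
      move=> z; rewrite in_itv/= => hz; rewrite distrC => ->.
      rewrite [t - _](_ : _ = - h); last by ring.
      rewrite normrM normrN ler_wpM2r//.
      by apply: dg => //; apply: (sub (h + t) t) => //; lra.
    + by rewrite -subr_eq0 opprD addrCA subrr addr0 oppr_eq0 (negbTE h0).
  - move=> k k0; have [/cvg_ex[l hl] <-] := fd t k tuv k0.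
    rewrite /derive (cvg_lim _ hl)//.
    apply: cvg_trans hl; apply: near_eq_cvg; near=> h.
    by rewrite /q /= scaler1.
have quot : (fun h => h^-1 *: (((fun s => tsum (f s)) \o shift t) (h *: 1) - tsum (f t)))
    @ 0^' --> tsum (df t).
  apply: cvg_trans cv; apply: near_eq_cvg; near=> h.
  have huv : u < h + t < v by near: h.
  by rewrite /= scaler1 /q (tsumZ _ (asum_leD (fL _ huv) (asum_leN (fL t tuv))))
    (tsumB (fL _ huv) (fL t tuv)).
by apply: DeriveDef; [apply/cvg_ex; exists (tsum (df t))|exact/cvg_lim].
Unshelve. all: by end_near. Qed.

(** Comparison with an integral: by the mean value theorem [k^(-s)] is at most the increment over
    [[k - 1, k]] of a primitive of [x^(-s)], so the induction carries the closed form of 1 plus the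
    integral of [x^(-s)] over [[1, n + 1]]. *)
Lemma asum_powR s : 1 < s -> exists K, asum_le (fun k => k%:R `^ (- s)) K.
Proof.
move=> s1; have s10 : 0 < s - 1 by lra.
exists (1 + (s - 1)^-1).
suff H n : psum (fun k => `|k%:R `^ (- s)|) n.+2 <=
    1 + (s - 1)^-1 * (1 - n.+1%:R `^ (1 - s)).
  move=> n; apply: (@le_trans _ _ (psum (fun k => `|k%:R `^ (- s)|) n.+2)).
    by apply: psum_nd => //; rewrite -addn2 leq_addr.
  apply: le_trans (H n) _; rewrite lerD2l.
  have p0 := powR_ge0 (n.+1%:R : R) (1 - s).
  by apply: ler_piMr; [rewrite invr_ge0 ltW|lra].
elim: n => [|n IH].
  rewrite /psum big_nat1 !powR1 subrr mulr0 addr0 normr1//.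
rewrite (psum_split _ _ (leqnSn n.+2))// big_nat1.
have n1 : 0 < n.+1%:R :> R by rewrite ltr0n.
have lt12 : n.+1%:R < n.+2%:R :> R by rewrite ltr_nat.
have der (x : R) : 0 < x -> is_derive x 1 (fun y => y `^ (1 - s)) ((1 - s) * x `^ (1 - s - 1)).
  by move=> x0; apply: is_derive1_powR.
have [] := @MVT _ (fun x => x `^ (1 - s)) (fun x => (1 - s) * x `^ (1 - s - 1)) _ _ lt12.
- by move=> x; rewrite in_itv/= => /andP[nx _]; apply: der; lra.
- apply: derivable_within_continuous => x; rewrite in_itv/= => /andP[nx _].
  by have [] := der x ltac:(lra).
move=> x; rewrite in_itv/= => /andP[nx xn].
rewrite -natrB// subSnn mulr1 => hE.
have -> : (1 - n.+2%:R `^ (1 - s)) =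
  (1 - n.+1%:R `^ (1 - s)) - (n.+2%:R `^ (1 - s) - n.+1%:R `^ (1 - s)) by ring.
rewrite hE mulrBr addrA lerD//.
rewrite (_ : 1 - s - 1 = - s); last by ring.
rewrite -[1 - s]opprB mulNr mulrN opprK mulKf ?gt_eqF//.
rewrite ger0_norm ?powR_ge0// !powRN lef_pV2 ?posrE ?powR_gt0//; try lra.
by apply: ge0_ler_powR; rewrite ?nnegrE; try lra.
Qed.

Lemma asum_pow2 : exists K, asum_le (fun k => k%:R ^- 2) K.
Proof.
have [K hK] := asum_powR (ltr1n R 2); exists K.
by apply: asum_leW hK => k k0; rewrite powR_invn.
Qed.

End series_from_one.

(** * Integrals over one period and orthogonality of the trigonometric system *)

Section circle_integral.
Context {R : realType}.
Notation leb := (@lebesgue_measure R).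
Implicit Types (f g : R -> R).

Definition Iper f : R := \int[leb]_(x in S1 R) f x.

Lemma measurable_S1 : measurable (S1 R : set (measurableTypeR R)).
Proof. exact: measurable_itv. Qed.

Lemma contD f g : continuous f -> continuous g -> continuous (fun x => f x + g x).
Proof. by move=> cf cg x; apply: cvgD; [exact: cf|exact: cg]. Qed.

Lemma contB f g : continuous f -> continuous g -> continuous (fun x => f x - g x).
Proof. by move=> cf cg x; apply: cvgB; [exact: cf|exact: cg]. Qed.

Lemma contM f g : continuous f -> continuous g -> continuous (fun x => f x * g x).
Proof. by move=> cf cg x; apply: cvgM; [exact: cf|exact: cg]. Qed.

Lemma contZ c f : continuous f -> continuous (fun x => c * f x).
Proof. by move=> cf; apply: contM => // x; exact: cst_continuous. Qed.

Lemma continuous_integrable f a b : continuous f -> leb.-integrable `[a, b] (EFin \o f).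
Proof.
move=> cf; apply: continuous_compact_integrable; first exact: segment_compact.
exact: continuous_subspaceT.
Qed.

Lemma S1_integrable f : continuous f -> leb.-integrable (S1 R) (EFin \o f).
Proof. exact: continuous_integrable. Qed.

Lemma pi2_gt0 : 0 < (pi : R) *+ 2.
Proof. by have := pi_gt0 R; rewrite mulr2n; lra. Qed.

Lemma pi2_ge0 : 0 <= (pi : R) *+ 2.
Proof. exact: ltW pi2_gt0. Qed.

Lemma mu_S1 : fine (leb (S1 R)) = pi *+ 2 :> R.
Proof.
rewrite /S1 lebesgue_measure_itv/= lte_fin.
have p0 := pi_gt0 R.
rewrite ifT; last by lra.
rewrite opprK mulr2n //.
Qed.

Lemma Iper_cst c : Iper (fun=> c) = c * (pi *+ 2).
Proof. by rewrite /Iper Rintegral_cst ?mu_S1//; exact: measurable_S1. Qed.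

Lemma IperD f g : continuous f -> continuous g ->
  Iper (fun x => f x + g x) = Iper f + Iper g.
Proof. by move=> cf cg; apply: RintegralD => //; [exact: measurable_S1|exact: S1_integrable..]. Qed.

Lemma IperB f g : continuous f -> continuous g ->
  Iper (fun x => f x - g x) = Iper f - Iper g.
Proof. by move=> cf cg; apply: RintegralB => //; [exact: measurable_S1|exact: S1_integrable..]. Qed.

Lemma IperZ c f : continuous f -> Iper (fun x => c * f x) = c * Iper f.
Proof. by move=> cf; apply: RintegralZl => //; [exact: measurable_S1|exact: S1_integrable]. Qed.

Lemma eq_Iper f g : (forall x, f x = g x) -> Iper f = Iper g.
Proof. by move=> fg; apply: eq_Rintegral => x _. Qed.

Lemma le_Iper f g : continuous f -> continuous g -> (forall x, f x <= g x) ->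
  Iper f <= Iper g.
Proof.
by move=> cf cg fg; apply: le_Rintegral => //; [exact: measurable_S1|exact: S1_integrable..].
Qed.

Lemma Iper_bound f c : continuous f -> (forall x, `|f x| <= c) ->
  `|Iper f| <= c * (pi *+ 2).
Proof.
move=> cf fc; apply: le_trans (le_normr_Rintegral measurable_S1 (S1_integrable cf)) _.
rewrite -Iper_cst; apply: le_Iper => //; last by move=> x; exact: cst_continuous.
by move=> x; apply: cvg_norm; exact: cf.
Qed.

Lemma Iper_psum (f : nat -> R -> R) n : (forall k, (0 < k)%N -> continuous (f k)) ->
  Iper (fun x => psum (f ^~ x) n) = psum (fun k => Iper (f k)) n /\
  continuous (fun x => psum (f ^~ x) n).
Proof.
move=> cf.
suff H m : Iper (fun x => psum (f ^~ x) m.+1) = psum (fun k => Iper (f k)) m.+1 /\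
  continuous (fun x => psum (f ^~ x) m.+1).
  case: n => [|n]; last exact: H.
  have -> : (fun x => psum (f^~ x) 0) = (fun=> 0).
    by apply/funext => x; rewrite /psum big_geq.
  by rewrite Iper_cst mul0r /psum big_geq//; split => // x; exact: cst_continuous.
elim: m => [|m [IH1 IH2]].
  have -> : (fun x => psum (f^~ x) 1) = (fun=> 0).
    by apply/funext => x; rewrite /psum big_geq.
  by rewrite Iper_cst mul0r /psum big_geq//; split => // x; exact: cst_continuous.
have -> : (fun x => psum (f^~ x) m.+2) = (fun x => psum (f^~ x) m.+1 + f m.+1 x).
  by apply/funext => x; rewrite /psum big_nat_recr.
have cfm := cf m.+1 isT.
rewrite IperD// IH1; split; first by rewrite [RHS]/psum big_nat_recr.
by move=> x; apply: cvgD; [exact: IH2|exact: cfm].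
Qed.

Lemma Iper_uniform (T : Type) (F : set_system T) {FF : Filter F} (f : T -> R -> R) g :
  (\forall t \near F, continuous (f t)) -> continuous g ->
  (forall e, 0 < e -> \forall t \near F, forall x, `|f t x - g x| <= e) ->
  Iper (f t) @[t --> F] --> Iper g.
Proof.
move=> cf cg fg; apply/cvgrPdist_le => e e0.
have p2 := pi2_gt0.
have d0 : 0 < e / (pi *+ 2) by rewrite divr_gt0.
near=> t.
have ft : forall x, `|f t x - g x| <= e / (pi *+ 2) by near: t; exact: fg.
have cft : continuous (f t) by near: t.
rewrite distrC -IperB//.
apply: le_trans (Iper_bound _ ft) _; first exact: contB.
by rewrite divfK ?gt_eqF.
Unshelve. all: by end_near. Qed.

Lemma sin_nat_pi n : sin (n%:R * pi) = 0 :> R.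
Proof.
elim: n => [|n IH]; first by rewrite mul0r sin0.
by rewrite -natr1 mulrDl mul1r sinDpi IH oppr0.
Qed.

Lemma cos_affine_continuous (w phi : R) : continuous (fun x => cos (w * x + phi)).
Proof.
move=> x; apply: continuous_comp; last exact: continuous_cos.
by apply: cvgD; [apply: cvgMr; exact: cvg_id|exact: cvg_cst].
Qed.

(** The frequency is kept as a difference of naturals so that one statement serves both the sum
    frequencies ([l = 0]) and the difference frequencies of product formulas. The boundary terms of
    the primitive cancel because [sin (w pi) = 0] for integer [w]. *)
Lemma Iper_cos_phase (m l : nat) phi :
  Iper (fun x => cos ((m%:R - l%:R) * x + phi)) =
  if m == l then pi *+ 2 * cos phi else 0.
Proof.
have [->|ml] := eqVneq m l.
  by under eq_Iper do rewrite subrr mul0r add0r; rewrite Iper_cst mulrC.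
pose w : R := m%:R - l%:R.
have w0 : w != 0 by rewrite subr_eq0 eqr_nat.
have p0 := pi_gt0 R.
have der (x : R) : is_derive x (1 : R) (fun x => w^-1 * sin (w * x + phi)) (cos (w * x + phi)).
  have d1 : is_derive x (1 : R) (fun x => w * x + phi) w.
    by apply: is_derive_eq; rewrite addr0 -[RHS]mulr1.
  have d2 : is_derive x (1 : R) (fun x => sin (w * x + phi)) (cos (w * x + phi) * w).
    exact: is_derive1_comp.
  by apply: is_derive_eq; rewrite /GRing.scale/= mulrCA mulVf// mulr1.
rewrite /Iper /Rintegral (@continuous_FTC2 _ _ (fun x => w^-1 * sin (w * x + phi))).
- rewrite /= !mulrN !sinD !cosN sinN.
  have sw : sin (w * pi) = 0.
    by rewrite /w mulrBl sinB !sin_nat_pi mul0r mulr0 subrr.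
  by rewrite sw oppr0 mul0r subrr.
- by lra.
- exact/continuous_subspaceT/cos_affine_continuous.
- have cx (x : R) : (fun x => w^-1 * sin (w * x + phi)) @ x --> w^-1 * sin (w * x + phi).
    by have [+ _] := der x; move=> /derivable1_diffP/differentiable_continuous.
  split; first by move=> x _; have [] := der x.
    exact/cvg_at_right_filter/cx.
  exact/cvg_at_left_filter/cx.
- by move=> x _; rewrite derive1E; have [_ ->] := der x.
Qed.

Definition ebas (b : bool) (k : nat) (x : R) : R :=
  if b then sin (k%:R * x) else cos (k%:R * x).

(* A sine is a shifted cosine, which makes the product formulas uniform in b. *)
Definition phase (b : bool) : R := if b then - (pi / 2) else 0.

Lemma ebasE b k x : ebas b k x = cos (k%:R * x + phase b).
Proof. by case: b; rewrite /ebas /phase ?cosBpihalf ?addr0. Qed.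

Lemma ebas_continuous b k : continuous (ebas b k).
Proof. by rewrite (_ : ebas b k = fun x => cos (k%:R * x + phase b)); [exact: cos_affine_continuous|apply/funext => x; rewrite ebasE]. Qed.

Lemma ebas_le1 b k x : `|ebas b k x| <= 1.
Proof. by rewrite ebasE cos_max. Qed.

Lemma cos_mul (A B : R) : cos A * cos B = 2^-1 * (cos (A - B) + cos (A + B)).
Proof. by rewrite cosB cosD; field. Qed.

(** Of the two cosines in the product formula, the one of frequency [m + l] integrates to 0 because
    [m > 0], even when [l = 0]; only the difference frequency can survive. *)
Lemma Iper_ebas2 b1 m b2 l : (0 < m)%N ->
  Iper (fun x => ebas b1 m x * ebas b2 l x) = if (b1 == b2) && (m == l) then pi else 0.
Proof.
move=> m0.
under eq_Iper => x.
  rewrite !ebasE cos_mul.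
  rewrite (_ : m%:R * x + phase b1 - (l%:R * x + phase b2) = (m%:R - l%:R) * x + (phase b1 - phase b2)); last by ring.
  rewrite (_ : m%:R * x + phase b1 + (l%:R * x + phase b2) = ((m + l)%:R - 0%:R) * x + (phase b1 + phase b2)); last by rewrite natrD; ring.
  over.
rewrite IperZ; last first.
  by move=> x; apply: cvgD; exact: cos_affine_continuous.
rewrite IperD; [|exact: cos_affine_continuous..].
rewrite !Iper_cos_phase addn_eq0 (gtn_eqF m0)/= addr0.
have [_|ml] := eqVneq m l; last by rewrite andbF mulr0.
rewrite andbT; have -> (c : R) : 2^-1 * (pi *+ 2 * c) = pi * c by field.
case: b1; case: b2; rewrite /phase/= ?subrr ?cos0 ?mulr1//.
  by rewrite subr0 cosN cos_pihalf mulr0.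
by rewrite sub0r opprK cos_pihalf mulr0.
Qed.

(** A product of three modes is a quarter of a sum of four cosines. The frequency [m + l + k] cannot
    vanish, and the three others vanish exactly at the three resonances, each contributing at most
    [2 pi / 4]. *)
Lemma Iper_ebas3 b1 m b2 l b3 k : (0 < m)%N ->
  `|Iper (fun x => ebas b1 m x * ebas b2 l x * ebas b3 k x)| <=
  pi / 2 * ((m == l + k)%N%:R + (l == m + k)%N%:R + (k == m + l)%N%:R).
Proof.
move=> m0; set p1 := phase b1; set p2 := phase b2; set p3 := phase b3.
have c (w p : R) : continuous (fun x => cos (w * x + p)) by exact: cos_affine_continuous.
have -> : Iper (fun x => ebas b1 m x * ebas b2 l x * ebas b3 k x) =
  4^-1 * (Iper (fun x => cos ((m%:R - (l + k)%:R) * x + (p1 - p2 - p3))) +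
  (Iper (fun x => cos (((m + k)%:R - l%:R) * x + (p1 - p2 + p3))) +
  (Iper (fun x => cos (((m + l)%:R - k%:R) * x + (p1 + p2 - p3))) +
   Iper (fun x => cos (((m + l + k)%:R - 0%:R) * x + (p1 + p2 + p3)))))).
  rewrite -(IperD (c _ _) (c _ _)) -(IperD (c _ _) (contD (c _ _) (c _ _))).
  rewrite -(IperD (c _ _) (contD (c _ _) (contD (c _ _) (c _ _)))).
  rewrite -(IperZ _ (contD (c _ _) (contD (c _ _) (contD (c _ _) (c _ _))))).
  apply: eq_Iper => x; rewrite !ebasE -/p1 -/p2 -/p3.
  rewrite cos_mul -mulrA mulrDl !cos_mul !natrD.
  set a1 := cos _; set a2 := cos _; set a3 := cos _; set a4 := cos _.
  rewrite [X in _ = _ * (cos X + _)](_ : _ = m%:R * x + p1 - (l%:R * x + p2) - (k%:R * x + p3)); last by ring.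
  rewrite [X in _ = _ * (_ + (cos X + _))](_ : _ = m%:R * x + p1 - (l%:R * x + p2) + (k%:R * x + p3)); last by ring.
  rewrite [X in _ = _ * (_ + (_ + (cos X + _)))](_ : _ = m%:R * x + p1 + (l%:R * x + p2) - (k%:R * x + p3)); last by ring.
  rewrite [X in _ = _ * (_ + (_ + (_ + cos X)))](_ : _ = m%:R * x + p1 + (l%:R * x + p2) + (k%:R * x + p3)); last by ring.
  by rewrite -/a1 -/a2 -/a3 -/a4; field.
have bd (i j : nat) p : `|Iper (fun x => cos ((i%:R - j%:R) * x + p))| <= pi *+ 2 * (i == j)%:R.
  rewrite Iper_cos_phase; case: eqVneq => _; last by rewrite normr0 mulr0.
  rewrite mulr1 normrM ger0_norm ?pi2_ge0//.
  by apply: ler_piMr; [exact: pi2_ge0|exact: cos_max].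
have h1 := bd m (l + k)%N (p1 - p2 - p3); have h2 := bd (m + k)%N l (p1 - p2 + p3).
have h3 := bd (m + l)%N k (p1 + p2 - p3); have h4 := bd (m + l + k)%N 0%N (p1 + p2 + p3).
move: h2 h3 h4; rewrite (eq_sym (m + k)%N) (eq_sym (m + l)%N) addn_eq0 addn_eq0 (gtn_eqF m0)/= mulr0.
move: h1; set I1 := Iper _; set I2 := Iper _; set I3 := Iper _; set I4 := Iper _.
move=> h1 h2 h3 h4.
rewrite normrM ger0_norm//.
have := ler_normD I1 (I2 + (I3 + I4)); have := ler_normD I2 (I3 + I4); have := ler_normD I3 I4.
move: h1 h2 h3 h4; move: (pi : R) (_ == _)%:R (_ == _)%:R (_ == _)%:R => P d1 d2 d3; lra.
Qed.

End circle_integral.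

(** * Trigonometric series given by their coefficients *)

Section trigonometric_series.
Context {R : realType}.
Implicit Types (f g : R -> R) (u v : bool -> nat -> R) (K : R) (b : bool).

(** Index [false] carries the cosines and [true] the sines. The series built on it start at [k = 1],
    which fits functions of zero mean. *)
Definition trig_term u (x : R) (k : nat) : R :=
  u false k * cos (k%:R * x) + u true k * sin (k%:R * x).

Definition trig u (x : R) : R := tsum (trig_term u x).

Definition coef f b k : R := if b then fsin f k else fcos f k.

Definition sumu u K : Prop := forall b, asum_le (u b) K.

(** The norm of the Wiener algebra: it dominates the sup norm, and thereby turns dominated
    convergence of coefficients into uniform convergence. *)
Definition norm1 u : R := tsum (fun k => `|u false k|) + tsum (fun k => `|u true k|).

Lemma coefI f b k : coef f b k = pi^-1 * Iper (fun x => f x * ebas b k x).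
Proof. by case: b. Qed.

Lemma trig_termE u x k : trig_term u x k = u false k * ebas false k x + u true k * ebas true k x.
Proof. by []. Qed.

Lemma sumu_leW u v K : (forall b k, (0 < k)%N -> `|u b k| <= `|v b k|) -> sumu v K -> sumu u K.
Proof. by move=> uv vK b; apply: asum_leW (vK b) => k; exact: uv. Qed.

Lemma sumuB u v K L : sumu u K -> sumu v L -> sumu (fun b k => u b k - v b k) (K + L).
Proof. by move=> uK vL b; apply: asum_leD => //; exact: asum_leN. Qed.

Lemma sumuZ c u K : sumu u K -> sumu (fun b k => c * u b k) (`|c| * K).
Proof. by move=> uK b; exact: asum_leZ. Qed.

Lemma trig_term_le u x k : `|trig_term u x k| <= `|u false k| + `|u true k|.
Proof.
rewrite trig_termE; apply: le_trans (ler_normD _ _) _.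
by rewrite !normrM lerD// ler_piMr// ebas_le1.
Qed.

Lemma trig_asum u K x : sumu u K -> asum_le (trig_term u x) (K + K).
Proof.
move=> uK; apply: (@asum_leW _ _ (fun k => `|u false k| + `|u true k|)).
  by move=> k _; rewrite (le_trans (trig_term_le _ _ _))// ler_norm.
apply: asum_leD; (apply: asum_leW (uK _)) => k _; by rewrite normr_id.
Qed.

Lemma tsum_norm (h g : nat -> R) K : asum_le g K -> (forall k, (0 < k)%N -> `|h k| <= g k) ->
  `|tsum h| <= tsum g.
Proof.
move=> gK hg; have hK : asum_le h K.
  by apply: asum_leW gK => k k0; apply: le_trans (hg k k0) (ler_norm _).
have hc : `|psum h n| @[n --> \oo] --> `|tsum h| by apply: cvg_norm; exact: asum_cvg hK.
apply: (ler_cvg_to hc (asum_cvg gK)); near=> n.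
by apply: le_trans (ler_norm_psum _ _) (le_psum _ _).
Unshelve. all: by end_near. Qed.

Lemma tsum_ge0 (h : nat -> R) K : asum_le h K -> (forall k, (0 < k)%N -> 0 <= h k) -> 0 <= tsum h.
Proof.
move=> hK h0; apply: le_trans (normr_ge0 (tsum h)) _; apply: (tsum_norm hK) => k k0.
by rewrite ger0_norm ?h0.
Qed.

Lemma asum_norm (h : nat -> R) K : asum_le h K -> asum_le (fun k => `|h k|) K.
Proof. by apply: asum_leW => k _; rewrite normr_id. Qed.

Lemma trig_norm1 u K x : sumu u K -> `|trig u x| <= norm1 u.
Proof.
move=> uK; rewrite /norm1 -(tsumD (asum_norm (uK _)) (asum_norm (uK _))).
apply: (tsum_norm (asum_leD (asum_norm (uK _)) (asum_norm (uK _)))).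
by move=> k _; exact: trig_term_le.
Qed.

Lemma norm1_le u K : sumu u K -> norm1 u <= K + K.
Proof.
move=> uK; rewrite /norm1 lerD//.
- by apply: le_trans (ler_norm _) (tsum_le (asum_norm (uK _))).
- by apply: le_trans (ler_norm _) (tsum_le (asum_norm (uK _))).
Qed.

Lemma trig_bound u K x : sumu u K -> `|trig u x| <= K + K.
Proof. by move=> uK; exact: le_trans (trig_norm1 _ uK) (norm1_le uK). Qed.

Lemma norm1_cvg0 (T : Type) (F : set_system T) {FF : Filter F}
    (u : T -> bool -> nat -> R) v (g : nat -> R) K :
  asum_le g K ->
  (forall b k, (0 < k)%N -> `|v b k| <= g k) ->
  (\forall t \near F, forall b k, (0 < k)%N -> `|u t b k| <= g k) ->
  (forall b k, (0 < k)%N -> u t b k @[t --> F] --> v b k) ->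
  norm1 (fun b k => u t b k - v b k) @[t --> F] --> (0 : R).
Proof.
move=> gK vg ug uv.
have H b : tsum (fun k => `|u t b k - v b k|) @[t --> F] --> (0 : R).
  rewrite -[X in _ --> X]tsum0.
  apply: (@tannery _ _ _ _ _ (fun=> 0) (fun k => 2 * g k) (`|2| * K)).
  - exact: asum_leZ.
  - by move=> k k0; rewrite normr0 mulr_ge0// (le_trans _ (vg false k k0)).
  - near=> t => k k0; rewrite normr_id (le_trans (ler_normB _ _))//.
    have h1 := vg b k k0.
    have h2 : `|u t b k| <= g k by move: (b) (k) (k0); near: t.
    by lra.
  - move=> k k0; rewrite -[X in _ --> X](@normr0 _ R) -(subrr (v b k)).
    by apply: cvg_norm; apply: cvgB; [exact: uv|exact: cvg_cst].
rewrite -[X in _ --> X](addr0 0); apply: cvgD; exact: H.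
Unshelve. all: by end_near. Qed.

Lemma trigB u v K L x : sumu u K -> sumu v L ->
  trig (fun b k => u b k - v b k) x = trig u x - trig v x.
Proof.
move=> uK vL; rewrite /trig -(tsumB (trig_asum _ uK) (trig_asum _ vL)).
by apply: eq_tsum => k _; rewrite /trig_term; ring.
Qed.

Lemma trigZ c u K x : sumu u K -> trig (fun b k => c * u b k) x = c * trig u x.
Proof.
move=> uK; rewrite /trig -(tsumZ _ (trig_asum _ uK)).
by apply: eq_tsum => k _; rewrite /trig_term; ring.
Qed.

Lemma eq_trig u v x : (forall b k, (0 < k)%N -> u b k = v b k) -> trig u x = trig v x.
Proof. by move=> uv; apply: eq_tsum => k k0; rewrite /trig_term !uv. Qed.

Lemma trig_term_continuous u k : continuous (fun x => trig_term u x k).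
Proof. by apply: contD; apply: contZ; [exact: (@ebas_continuous _ false k)|exact: (@ebas_continuous _ true k)]. Qed.

Lemma trig_continuous u K : sumu u K -> continuous (trig u).
Proof.
move=> uK x; apply: (@tannery _ _ _ _ _ _ (fun k => `|u false k| + `|u true k|) (K + K)).
- exact: asum_leD (asum_norm (uK _)) (asum_norm (uK _)).
- by move=> k _; exact: trig_term_le.
- by near=> y => k _; exact: trig_term_le.
- by move=> k _; exact: trig_term_continuous.
Unshelve. all: by end_near. Qed.

Lemma trigp_unif u K : sumu u K -> forall e, 0 < e ->
  \forall n \near \oo, forall x, `|psum (trig_term u x) n - trig u x| <= e.
Proof.
move=> uK e e0.
pose g k := `|u false k| + `|u true k|.
have gK : asum_le g (K + K) by exact: asum_leD (asum_norm (uK _)) (asum_norm (uK _)).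
have [N [N0 NP]] := asum_tail gK e0.
near=> n => x.
have Nn : (N <= n)%N by near: n; exact: nbhs_infty_ge.
rewrite distrC; apply: (tsum_split (trig_asum x uK)).
  exact: leq_trans Nn.
move=> m; apply: le_trans (NP m).
have [mn|nm] := leqP m n; first by rewrite [X in X <= _]big_geq// sumr_ge0.
rewrite (big_cat_nat Nn (ltnW nm))/=.
apply: ler_wpDl; first by rewrite sumr_ge0.
apply: ler_sum => k _; apply: le_trans (trig_term_le _ _ _) _.
by rewrite [X in _ <= X]ger0_norm ?addr_ge0.
Unshelve. all: by end_near. Qed.

Lemma ebasD2pi b k (x : R) : ebas b k (x + pi *+ 2) = ebas b k x :> R.
Proof.
have E : k%:R * (pi *+ 2) = (pi *+ 2) *+ k :> R by rewrite mulr_natl.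
by rewrite !ebasE mulrDr addrAC E; exact: (periodicn (@cosD2pi R)).
Qed.

Lemma trig_periodic u : periodic (trig u) (pi *+ 2).
Proof.
by move=> x; apply: eq_tsum => k _; rewrite !trig_termE !ebasD2pi.
Qed.

Lemma coef_uniform (T : Type) (F : set_system T) {FF : Filter F} (f : T -> R -> R) g b k :
  (\forall t \near F, continuous (f t)) -> continuous g ->
  (forall e, 0 < e -> \forall t \near F, forall x, `|f t x - g x| <= e) ->
  coef (f t) b k @[t --> F] --> coef g b k.
Proof.
move=> cf cg fg; under eq_fun do rewrite coefI; rewrite coefI.
apply: cvgMr; apply: Iper_uniform.
- by near=> t; apply: contM; [near: t|exact: ebas_continuous].
- by apply: contM => //; exact: ebas_continuous.
- move=> e e0; near=> t => x; rewrite -mulrBl normrM.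
  apply: le_trans (_ : `|f t x - g x| <= e).
    by rewrite ler_piMr// ebas_le1.
  by move: (x); near: t; exact: fg.
Unshelve. all: by end_near. Qed.

Lemma coefD f g b k : continuous f -> continuous g ->
  coef (fun x => f x + g x) b k = coef f b k + coef g b k.
Proof.
have ce := @ebas_continuous R b k.
move=> cf cg; rewrite !coefI -mulrDr -(IperD (contM cf ce) (contM cg ce)).
by congr (_ * _); apply: eq_Iper => x; rewrite mulrDl.
Qed.

Lemma coefZ f c b k : continuous f -> coef (fun x => c * f x) b k = c * coef f b k.
Proof.
have ce := @ebas_continuous R b k.
move=> cf; rewrite !coefI mulrCA -(IperZ _ (contM cf ce)).
by congr (_ * _); apply: eq_Iper => x; rewrite mulrA.
Qed.

Lemma coefB f g b k : continuous f -> continuous g ->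
  coef (fun x => f x - g x) b k = coef f b k - coef g b k.
Proof.
have ce := @ebas_continuous R b k.
move=> cf cg; rewrite !coefI -mulrBr -(IperB (contM cf ce) (contM cg ce)).
by congr (_ * _); apply: eq_Iper => x; rewrite mulrBl.
Qed.

Lemma eq_coef f g b k : f =1 g -> coef f b k = coef g b k.
Proof. by move=> fg; rewrite !coefI; congr (_ * _); apply: eq_Iper => x; rewrite fg. Qed.

Lemma coef_ebas c l b k : (0 < l)%N -> coef (ebas c l) b k = ((c == b) && (l == k))%:R.
Proof.
move=> l0; rewrite coefI Iper_ebas2//; case: ifPn => _; last by rewrite mulr0.
by rewrite mulVf// gt_eqF// pi_gt0.
Qed.

Lemma coef_trig_term u l b k : (0 < l)%N ->
  coef (fun x => trig_term u x l) b k = if l == k then u b l else 0.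
Proof.
move=> l0; have c b' := @ebas_continuous R b' l.
rewrite coefD; [|exact: contZ (c false)|exact: contZ (c true)].
rewrite (coefZ _ _ _ (c false)) (coefZ _ _ _ (c true)) !coef_ebas//.
by case: b; case: (l == k) => /=; rewrite ?mulr1 ?mulr0 ?addr0 ?add0r.
Qed.

Lemma trigp_continuous u n : continuous (fun x => psum (trig_term u x) n).
Proof.
by have [|//] := @Iper_psum R (fun k x => trig_term u x k) n; move=> k _; exact: trig_term_continuous.
Qed.

Lemma coef_psum (f : nat -> R -> R) n b k : (forall l, (0 < l)%N -> continuous (f l)) ->
  coef (fun x => psum (f ^~ x) n) b k = psum (fun l => coef (f l) b k) n.
Proof.
move=> cf; have ce := @ebas_continuous R b k.
rewrite coefI (eq_Iper (g := fun x => psum (fun l => f l x * ebas b k x) n)); last first.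
  by move=> x; rewrite /psum mulr_suml.
have [|-> _] := @Iper_psum R (fun l x => f l x * ebas b k x) n.
  by move=> l l0; apply: contM => //; exact: cf.
by rewrite -psumZ; apply: eq_psum => l _; rewrite coefI.
Qed.

Lemma coef_trigp u n b k :
  coef (fun x => psum (trig_term u x) n) b k = if (0 < k < n)%N then u b k else 0.
Proof.
rewrite (@coef_psum (fun l x => trig_term u x l)); last first.
  by move=> l _; exact: trig_term_continuous.
rewrite (@eq_psum _ _ (fun l => if l == k then u b l else 0)); last first.
  by move=> l l0; rewrite coef_trig_term.
rewrite /psum; case: ifPn => [/andP[k0 kn]|kn].
  rewrite (bigD1_seq k) ?mem_index_iota ?k0 ?iota_uniq//= eqxx big1 ?addr0//.
  by move=> i /negbTE ->.
rewrite big_nat big1// => i /andP[i0 iN]; case: eqVneq => // ik.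
by move: kn; rewrite -ik i0 iN.
Qed.

(** Coefficients pass to uniform limits, and the [k]-th coefficient of the partial sums is constant
    as soon as [n > k]. *)
Lemma coef_trig u K b k : sumu u K -> (0 < k)%N -> coef (trig u) b k = u b k.
Proof.
move=> uK k0.
have h : coef (fun x => psum (trig_term u x) n) b k @[n --> \oo] --> coef (trig u) b k.
  apply: coef_uniform; [by apply: nearW => n; exact: trigp_continuous|exact: trig_continuous uK|].
  exact: trigp_unif uK.
have h2 : coef (fun x => psum (trig_term u x) n) b k @[n --> \oo] --> u b k.
  apply: cvg_near_cst; near=> n; rewrite coef_trigp k0.
  by rewrite ifT//; near: n; exact: nbhs_infty_gt.
by rewrite -(cvg_lim (@Rhausdorff R) h) (cvg_lim (@Rhausdorff R) h2).
Unshelve. all: by end_near. Qed.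

Lemma coef_trig0 u K b : sumu u K -> coef (trig u) b 0 = 0.
Proof.
move=> uK.
have h : coef (fun x => psum (trig_term u x) n) b 0 @[n --> \oo] --> coef (trig u) b 0.
  apply: coef_uniform; [by apply: nearW => n; exact: trigp_continuous|exact: trig_continuous uK|].
  exact: trigp_unif uK.
have h2 : coef (fun x => psum (trig_term u x) n) b 0 @[n --> \oo] --> (0 : R).
  by apply: cvg_near_cst; near=> n; rewrite coef_trigp ltnn.
by rewrite -(cvg_lim (@Rhausdorff R) h) (cvg_lim (@Rhausdorff R) h2).
Unshelve. all: by end_near. Qed.

Definition dxu u b k : R := if b then - (k%:R * u false k) else k%:R * u true k.

Definition Lau (s : R) u b k : R := k%:R `^ s * u b k.

Lemma ebas_derive b k (x : R) :
  is_derive x (1 : R) (ebas b k) (if b then k%:R * ebas false k x else - (k%:R * ebas true k x)).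
Proof.
have d1 : is_derive x (1 : R) (fun x => k%:R * x) k%:R.
  by apply: is_derive_eq; rewrite -[RHS]mulr1.
case: b.
  rewrite mulrC; exact: (@is_derive1_comp _ sin).
rewrite mulrC -mulNr; exact: (@is_derive1_comp _ cos).
Qed.

Lemma trig_derive u K L x : sumu u K -> sumu (dxu u) L ->
  is_derive x (1 : R) (trig u) (trig (dxu u) x).
Proof.
move=> uK dL; apply: (@tsum_derive _ (trig_term u) (trig_term (dxu u))
   (fun k => `|dxu u false k| + `|dxu u true k|) x (x - 1) (x + 1) (L + L) (K + K)).
- by lra.
- exact: asum_leD (asum_norm (dL _)) (asum_norm (dL _)).
- by move=> s _; exact: trig_asum.
- move=> s k _ _; rewrite trig_termE.
  have h1 := ebas_derive false k s; have h2 := ebas_derive true k s.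
  apply: is_derive_eq; rewrite /GRing.scale/= /dxu.
  by ring.
- by move=> s k _ _; exact: trig_term_le.
Qed.

Lemma coef_false0 f : coef f false 0 = pi^-1 * Iper f.
Proof.
rewrite coefI; congr (_ * _); apply: eq_Iper => x.
by rewrite /ebas mul0r cos0 mulr1.
Qed.

Lemma zero_mean_coef f : zero_mean f -> forall b, coef f b 0 = 0.
Proof.
move=> f0 [|]; last by rewrite coef_false0 [Iper f]f0 mulr0.
rewrite coefI (eq_Iper (g := fun=> 0)) ?Iper_cst ?mul0r ?mulr0// => x.
by rewrite /ebas mul0r sin0 mulr0.
Qed.

Lemma coef0_zero_mean f : coef f false 0 = 0 -> zero_mean f.
Proof.
rewrite coef_false0 => /eqP; rewrite mulf_eq0 invr_eq0 gt_eqF ?pi_gt0//= => /eqP.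
by [].
Qed.

End trigonometric_series.

(** * A continuous function is determined by its Fourier coefficients *)

Section completeness.
Context {R : realType}.
Notation leb := (@lebesgue_measure R).
Implicit Types (f : R -> R) (x y c d : R).

Lemma periodic_rep f x : periodic f (pi *+ 2) ->
  exists2 y, - pi <= y < pi & f x = f y.
Proof.
move=> fp.
have p2 := @pi2_gt0 R.
pose q := Num.floor ((x + pi) / (pi *+ 2)).
have [q1 q2] : q%:~R * (pi *+ 2) <= x + pi /\ x + pi < (q%:~R + 1) * (pi *+ 2).
  rewrite -ler_pdivlMr// -ltr_pdivrMr//; split; first exact: floor_le_tmp.
  by rewrite -intrD1 floorD1_gt.
exists (x - q%:~R * (pi *+ 2)).
  rewrite mulrDl mul1r in q2; rewrite [(pi : R) *+ 2]mulr2n in q1 q2 *.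
  by apply/andP; split; lra.
have [[n qn]|[n qn]] : (exists n : nat, q = n%:Z) \/ (exists n : nat, q = - n%:Z).
  by case: q {q1 q2} => n; [left; exists n|right; exists n.+1; rewrite NegzE].
- have E : q%:~R * (pi *+ 2) = (pi *+ 2) *+ n :> R by rewrite qn mulr_natl.
  by rewrite E -[in LHS](subrK ((pi *+ 2) *+ n) x) periodicn.
- have E : q%:~R * (pi *+ 2) = - ((pi *+ 2) *+ n) :> R by rewrite qn mulrNz mulNr mulr_natl.
  by rewrite E opprK periodicn.
Qed.

Lemma bernoulli (eta : R) n : 0 <= eta -> 1 + n%:R * eta <= (1 + eta) ^+ n.
Proof.
move=> e0; elim: n => [|n IH]; first by rewrite mul0r addr0 expr0.
rewrite exprS; apply: le_trans (_ : (1 + eta) * (1 + n%:R * eta) <= _).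
  rewrite -natr1; have : 0 <= n%:R * eta * eta by rewrite !mulr_ge0.
  by lra.
by rewrite ler_wpM2l// addr_ge0.
Qed.

Lemma le_cos : {in `[0, pi : R] &, forall x y, x <= y -> cos y <= cos x}.
Proof.
move=> x y hx hy; rewrite le_eqVlt => /predU1P[->//|xy].
by rewrite ltW// ltr_cos.
Qed.

Lemma cos_ge_near x d : 0 <= d <= pi -> `|x| <= d -> cos d <= cos x.
Proof.
move=> /andP[d0 dp] xd; rewrite -(cos_norm x).
by apply: le_cos => //; rewrite in_itv/= ?normr_ge0 ?d0 ?(le_trans xd).
Qed.

Lemma cos_le_far x d : 0 <= d -> d <= `|x| <= pi *+ 2 - d -> cos x <= cos d.
Proof.
move=> d0 /andP[dx]; rewrite [(pi : R) *+ 2]mulr2n => xd.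
have p0 := pi_gt0 R.
have dp : d <= pi by lra.
rewrite -(cos_norm x); have [xp|px] := leP `|x| pi.
  by apply: le_cos => //; rewrite in_itv/= ?normr_ge0 ?d0.
have -> : cos `|x| = cos (pi + pi - `|x|).
  have -> : (pi : R) + pi = pi *+ 2 by rewrite -mulr2n.
  by rewrite cosB cos2pi sin2pi mul1r mul0r addr0.
by apply: le_cos; rewrite ?in_itv/=; lra.
Qed.

(** Multiplication by [cos (x - x0)] moves the frequency [k] to its two neighbours and changes the
    phases, so the induction on [n] is run for all [k] and [phi] at once. *)
Lemma coef0_kernel f x0 c : continuous f -> (forall b k, coef f b k = 0) ->
  forall n k phi, Iper (fun x => f x * cos (k%:R * x + phi) * (c + cos (x - x0)) ^+ n) = 0.
Proof.
move=> cf f0 n.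
have cc w phi : continuous (fun x => cos (w * x + phi)) by exact: cos_affine_continuous.
have cQ m : continuous (fun x => (c + cos (x - x0)) ^+ m).
  have c1 : continuous (fun x => c + cos (x - x0)).
    apply: contD; first by move=> ?; exact: cst_continuous.
    by under eq_fun => x do rewrite -[x in X in cos X]mul1r; exact: cc.
  elim: m => [|m IH]; first by under eq_fun do rewrite expr0; move=> ?; exact: cst_continuous.
  by under eq_fun do rewrite exprS; exact: contM.
have cG m w phi : continuous (fun x => f x * cos (w * x + phi) * (c + cos (x - x0)) ^+ m).
  by apply: contM => //; apply: contM.
elim: n => [|n IH] k phi.
  have I0 b : Iper (fun x => f x * ebas b k x) = 0.
    have := f0 b k; rewrite coefI => /eqP; rewrite mulf_eq0 invr_eq0 gt_eqF ?pi_gt0//=.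
    by move/eqP.
  have ce b := @ebas_continuous R b k.
  rewrite (eq_Iper (g := fun x => cos phi * (f x * ebas false k x) - sin phi * (f x * ebas true k x))).
    by rewrite (IperB (contZ (contM cf (ce false))) (contZ (contM cf (ce true))))
      (IperZ _ (contM cf (ce false))) (IperZ _ (contM cf (ce true))) !I0 !mulr0 subrr.
  by move=> x; rewrite expr0 mulr1 cosD /ebas; ring.
have [k' [psi hk]] : exists k' psi, forall x,
    cos (k%:R * x + phi) * cos (x - x0) =
      2^-1 * cos (k'%:R * x + psi) + 2^-1 * cos (k.+1%:R * x + (phi - x0)).
  (* At [k = 0] the lower frequency would be -1; swapping the two factors makes it 1. *)
  case: k => [|k].
    exists 1%N, (- x0 - phi) => x; rewrite mulrC cos_mul mulrDr.
    by congr (_ * cos _ + _ * cos _); ring.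
  exists k, (phi + x0) => x; rewrite cos_mul mulrDr -!natr1.
  by congr (_ * cos _ + _ * cos _); ring.
rewrite (eq_Iper (g := fun x => c * (f x * cos (k%:R * x + phi) * (c + cos (x - x0)) ^+ n) +
  (2^-1 * (f x * cos (k'%:R * x + psi) * (c + cos (x - x0)) ^+ n) +
   2^-1 * (f x * cos (k.+1%:R * x + (phi - x0)) * (c + cos (x - x0)) ^+ n)))).
  rewrite (IperD (contZ (cG n _ _)) (contD (contZ (cG n _ _)) (contZ (cG n _ _)))).
  rewrite (IperD (contZ (cG n _ _)) (contZ (cG n _ _))).
  by rewrite !(IperZ _ (cG n _ _)) !IH !mulr0 !addr0.
move=> x; rewrite exprS.
set q := (c + _) ^+ n.
rewrite [LHS](_ : _ = c * (f x * cos (k%:R * x + phi) * q) +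
  (f x * (cos (k%:R * x + phi) * cos (x - x0)) * q)); last by ring.
by rewrite hk; ring.
Qed.

Lemma Iper_ge_sub (g : R -> R) (m a b : R) : continuous g ->
  - pi <= a -> a <= b -> b <= pi -> (forall x, - pi <= x <= pi -> 0 <= g x) ->
  (forall x, a <= x <= b -> m <= g x) -> m * (b - a) <= Iper g.
Proof.
move=> cg pa ab bp g0 gm.
have sub : `[a, b] `<=` S1 R.
  by move=> x /=; rewrite /S1 /= !in_itv/=; lra.
have mS := @measurable_S1 R.
have mab : measurable (`[a, b]%classic : set (measurableTypeR R)) by exact: measurable_itv.
have ig := S1_integrable cg.
rewrite -lee_fin /Iper /Rintegral fineK; last exact: integrable_fin_num.
apply: le_trans (_ : (\int[leb]_(x in `[a, b]) (g x)%:E <= _)%E); last first.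
  apply: ge0_subset_integral => //.
  - by case/integrableP : ig.
apply: le_trans (_ : (\int[leb]_(x in `[a, b]) m%:E <= _)%E).
  rewrite integral_cst//= lebesgue_measure_itv/= lte_fin.
  have [_|ba] := ltP a b; first by rewrite -EFinB -EFinM.
  by rewrite (_ : b - a = 0) ?mulr0 ?mule0//; lra.
apply: le_integral => //.
- by apply: continuous_integrable => ?; exact: cst_continuous.
- exact: continuous_integrable.
- by move=> x; rewrite inE/= in_itv/= lee_fin; exact: gm.
Qed.

(** If [f x0 > 0], take [Q = 1 - cos d + cos (x - x0)]: it is at least 1 within [d] of [x0], of
    modulus at most 1 elsewhere in the period, and at least [1 + eta] within [d / 2]. The integral
    of [f Q^n], which is 0, would then grow linearly in [n]. The argument is local to the open
    period and thus also serves for primitives that are not periodic. *)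
Lemma coef0_eq0_pos f x0 : continuous f -> (forall b k, coef f b k = 0) ->
  - pi < x0 < pi -> f x0 <= 0.
Proof.
move=> cf f0 /andP[x0l x0r]; rewrite leNgt; apply/negP => fx0.
have p0 := pi_gt0 R; have p2 := pi_ge2 R.
have c0 : 0 < f x0 / 2 by lra.
have [d [d0 d1 dl dr df]] : exists d, [/\ 0 < d, d <= 1, - pi <= x0 - d, x0 + d <= pi &
    forall x, `|x - x0| <= d -> f x0 / 2 <= f x].
  have /cvgrPdist_lt/(_ _ c0)/nbhs_ballP[e /= e0 he] := cf x0.
  exists (Num.min (e / 2) (Num.min 1 (Num.min (pi + x0) (pi - x0)))).
  set m := Num.min _ _.
  have me : m <= e / 2 by rewrite ge_min lexx.
  have m1 : m <= 1 by rewrite !ge_min lexx orbT.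
  have ml : m <= pi + x0 by rewrite !ge_min lexx !orbT.
  have mr : m <= pi - x0 by rewrite !ge_min lexx !orbT.
  split; [|lra..|].
    by rewrite !lt_min ltr01 divr_gt0//=; apply/andP; split; lra.
  move=> x xm; have := he x; rewrite /ball/= distrC => /(_ ltac:(lra)).
  by rewrite ltr_norml; lra.
have [M M0 HM] : exists2 M, 0 <= M & forall x, - pi <= x <= pi -> `|f x| <= M.
  have [||c _ hc] := @EVT_max R (fun x => `|f x|) (- pi) pi; first by lra.
    apply: continuous_subspaceT => x; apply: cvg_norm; exact: cf.
  by exists `|f c| => // x hx; apply: hc; rewrite in_itv.
pose Q x := (1 - cos d) + cos (x - x0).
pose eta := cos (d / 2) - cos d.
have eta0 : 0 < eta.
  by rewrite subr_gt0 ltr_cos ?in_itv/=; lra.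
have cQ n : continuous (fun x => Q x ^+ n).
  have c1 : continuous Q.
    apply: contD; first by move=> ?; exact: cst_continuous.
    under eq_fun => x do rewrite -[x in X in cos X]mul1r.
    exact: cos_affine_continuous.
  elim: n => [|m IH]; first by under eq_fun do rewrite expr0; move=> ?; exact: cst_continuous.
  by under eq_fun do rewrite exprS; exact: contM.
have I0 n : Iper (fun x => f x * Q x ^+ n) = 0.
  rewrite -[RHS](@coef0_kernel f x0 (1 - cos d) cf f0 n 0%N 0); apply: eq_Iper => x.
  by rewrite mul0r addr0 cos0 mulr1.
have inner x : `|x - x0| <= d -> 1 <= Q x.
  move=> xd; have := @cos_ge_near (x - x0) d ltac:(lra) xd; rewrite /Q; lra.
(* Adding [M] makes the integrand nonnegative on the whole period, so that its integral can be
   restricted to the interval of radius [d / 2], where Bernoulli's inequality applies. *)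
have key n : f x0 / 2 * (1 + n%:R * eta) * d <= M * (pi *+ 2).
  have cg : continuous (fun x => f x * Q x ^+ n + M).
    by apply: contD; [exact: contM|move=> ?; exact: cst_continuous].
  have Ig : Iper (fun x => f x * Q x ^+ n + M) = M * (pi *+ 2).
    rewrite IperD ?I0 ?add0r ?Iper_cst//; first exact: contM.
    by move=> ?; exact: cst_continuous.
  rewrite -Ig [X in _ * X <= _](_ : d = (x0 + d / 2) - (x0 - d / 2)); last by field.
  apply: Iper_ge_sub => //; [lra|lra|lra| |].
  - move=> x hx; have [xd|xd] := leP `|x - x0| d.
      rewrite addr_ge0// mulr_ge0 ?exprn_ge0//; first by have := df x xd; lra.
      by have := inner x xd; lra.
    suff : `|f x * Q x ^+ n| <= M by rewrite ler_norml; lra.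
    rewrite normrM normrX; apply: le_trans (_ : M * 1 <= _); last by rewrite mulr1.
    apply: ler_pM => //; first exact: HM.
    rewrite exprn_ile1//.
    have := @cos_le_far (x - x0) d (ltW d0).
    have xx : d <= `|x - x0| <= pi *+ 2 - d.
      by rewrite (ltW xd)/= ler_norml [(pi : R) *+ 2]mulr2n; lra.
    move=> /(_ xx) h; have h1 := cos_geN1 (x - x0); have h2 := cos_le1 d.
    by rewrite /Q ler_norml; lra.
  - move=> x hx.
    have xd2 : `|x - x0| <= d / 2 by rewrite ler_norml; lra.
    have fx := df x ltac:(lra).
    have Qe : 1 + eta <= Q x.
      by have := @cos_ge_near (x - x0) (d / 2) ltac:(lra) xd2; rewrite /Q /eta; lra.
    have Qn : 1 + n%:R * eta <= Q x ^+ n.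
      apply: le_trans (bernoulli n (ltW eta0)) _.
      by apply: lerXn2r; rewrite ?nnegrE//; lra.
    rewrite -[leLHS]addr0; apply: lerD => //.
    apply: ler_pM => //; first by lra.
    by rewrite addr_ge0// mulr_ge0// ltW.
pose A := f x0 / 2 * eta * d.
have A0 : 0 < A by rewrite !mulr_gt0.
have := key (Num.truncn (M * (pi *+ 2) / A)).+1.
have := truncnS_gt (M * (pi *+ 2) / A).
set n := (Num.truncn _).+1; rewrite ltr_pdivrMr//.
have : 0 < f x0 / 2 * d by rewrite mulr_gt0.
rewrite [X in _ -> _ -> X <= _ -> _](_ : _ = f x0 / 2 * d + n%:R * A); last by rewrite /A; ring.
by lra.
Qed.

(** The sign argument is applied to [f] and [- f] at interior points; the endpoint [- pi] follows
    from a one-sided limit and all other points from periodicity. *)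
Lemma continuous_coef0_eq0 f : continuous f -> periodic f (pi *+ 2) ->
  (forall b k, coef f b k = 0) -> f =1 (fun=> 0).
Proof.
move=> cf fp f0.
have p0 := pi_gt0 R.
have inside x : - pi < x < pi -> f x = 0.
  move=> hx; apply/eqP; rewrite eq_le (coef0_eq0_pos cf f0 hx)/=.
  rewrite -oppr_le0; apply: (@coef0_eq0_pos (fun x => - f x)) => //.
    by move=> y; apply: cvgN; exact: cf.
  move=> b k; rewrite (eq_coef (g := fun x => -1 * f x)); last by move=> y; rewrite mulN1r.
  by rewrite coefZ// f0 mulr0.
have left : f (- pi) = 0.
  have h : f x @[x --> (- pi)^'+] --> f (- pi) by apply: cvg_at_right_filter; exact: cf.
  have h2 : f x @[x --> (- pi)^'+] --> (0 : R).
    apply: cvg_near_cst; near=> x; apply: inside; apply/andP; split.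
      by near: x; exact: nbhs_right_gt.
    by near: x; apply: nbhs_right_lt; lra.
  by rewrite -(cvg_lim (@Rhausdorff R) h) (cvg_lim (@Rhausdorff R) h2).
move=> x; have [y /andP[y1 y2] ->] := periodic_rep x fp.
by move: y1; rewrite le_eqVlt => /predU1P[<-//|y1]; apply: inside; rewrite y1.
Unshelve. all: by end_near. Qed.

Lemma fourier_inversion f K : continuous f -> periodic f (pi *+ 2) ->
  coef f false 0 = 0 -> sumu (coef f) K -> f =1 trig (coef f).
Proof.
move=> cf fp f0 fK x.
have ct := trig_continuous fK.
have s0 : coef f true 0 = 0.
  rewrite coefI (eq_Iper (g := fun=> 0)) ?Iper_cst ?mul0r ?mulr0// => y.
  by rewrite /ebas mul0r sin0 mulr0.
apply/eqP; rewrite -subr_eq0; apply/eqP.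
apply: (@continuous_coef0_eq0 (fun x => f x - trig (coef f) x)).
- exact: contB.
- by move=> y; rewrite fp trig_periodic.
- move=> b [|k]; rewrite coefB//; last by rewrite (coef_trig _ fK)// subrr.
  by rewrite (coef_trig0 _ fK) subr0; case: b.
Qed.

End completeness.

(** * Fourier coefficients of products, with exponential weights *)

Section product_coefficients.
Context {R : realType}.
Implicit Types (u v : bool -> nat -> R) (b : bool).

Lemma psum_le1 (P : nat -> bool) n :
  (forall l l', P l -> P l' -> l = l') -> psum (fun l => (P l)%:R : R) n <= 1.
Proof.
move=> P1; case: n => [|n]; first by rewrite /psum big_geq.
elim: n => [|n IH]; first by rewrite /psum big_geq.
rewrite /psum big_nat_recr//=; case: (boolP (P n.+1)) => Pn; last by rewrite addr0.
rewrite big_nat big1 ?add0r// => l /andP[_ ln].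
by case: (boolP (P l)) => // Pl; move: ln; rewrite (P1 _ _ Pl Pn) ltnn.
Qed.

Lemma psum_exchange (f : nat -> nat -> R) n :
  psum (fun m => psum (f m) n) n = psum (fun l => psum (f ^~ l) n) n.
Proof. exact: exchange_big_nat. Qed.

(** Schur test for a relation that is a partial injection: after a weighted arithmetic-geometric
    inequality, each half collapses to a single sum because rows and columns of [D] have at most one
    entry. *)
Lemma schur (D : nat -> nat -> bool) (U V : nat -> R) A B n :
  (forall m l l', D m l -> D m l' -> l = l') ->
  (forall l m m', D m l -> D m' l -> m = m') ->
  0 < A -> 0 < B ->
  psum (fun m => U m ^+ 2) n <= A ^+ 2 -> psum (fun m => V m ^+ 2) n <= B ^+ 2 ->
  psum (fun m => psum (fun l => U m * V l * (D m l)%:R) n) n <= A * B.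
Proof.
move=> D1 D2 A0 B0 UA VB.
(* This ratio makes both halves of the inequality contribute [A B / 2]. *)
pose rho := B / A.
have rho0 : 0 < rho by rewrite divr_gt0.
have amgm m l : U m * V l * (D m l)%:R <=
    rho / 2 * (U m ^+ 2 * (D m l)%:R) + rho^-1 / 2 * (V l ^+ 2 * (D m l)%:R).
  rewrite -subr_ge0 (_ : _ - _ = rho^-1 / 2 * (rho * U m - V l) ^+ 2 * (D m l)%:R); last first.
    by field; rewrite gt_eqF.
  by rewrite mulr_ge0// mulr_ge0 ?sqr_ge0// divr_ge0// invr_ge0 ltW.
apply: (@le_trans _ _ (psum (fun m => psum (fun l => rho / 2 * (U m ^+ 2 * (D m l)%:R)
   + rho^-1 / 2 * (V l ^+ 2 * (D m l)%:R)) n) n)).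
  by apply: le_psum => m _; apply: le_psum.
have h1 : psum (fun m => psum (fun l => U m ^+ 2 * (D m l)%:R) n) n <= A ^+ 2.
  apply: le_trans UA; apply: le_psum => m _.
  rewrite psumZ ler_piMr ?sqr_ge0//; apply: psum_le1 => l l'; exact: D1.
have h2 : psum (fun m => psum (fun l => V l ^+ 2 * (D m l)%:R) n) n <= B ^+ 2.
  rewrite psum_exchange; apply: le_trans VB; apply: le_psum => m _.
  rewrite psumZ ler_piMr ?sqr_ge0//; apply: psum_le1 => l l'; exact: D2.
rewrite (@eq_psum _ _ (fun m => rho / 2 * psum (fun l => U m ^+ 2 * (D m l)%:R) n +
   rho^-1 / 2 * psum (fun l => V l ^+ 2 * (D m l)%:R) n)); last first.
  by move=> m _; rewrite psumD !psumZ.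
rewrite psumD !psumZ.
apply: (@le_trans _ _ (rho / 2 * A ^+ 2 + rho^-1 / 2 * B ^+ 2)).
  by apply: lerD; apply: ler_wpM2l => //; rewrite divr_ge0// ?invr_ge0 ltW.
rewrite /rho le_eqVlt; apply/orP; left; apply/eqP; field.
by rewrite !gt_eqF.
Qed.

Lemma coef_trig_termM u v m l b k : (0 < m)%N ->
  `|coef (fun x => trig_term u x m * trig_term v x l) b k| <=
  2^-1 * ((`|u false m| + `|u true m|) * (`|v false l| + `|v true l|)) *
  ((m == l + k)%N%:R + (l == m + k)%N%:R + (k == m + l)%N%:R).
Proof.
move=> m0; set d := (_ + _ + _ in X in _ <= X).
have ce b' j := @ebas_continuous R b' j.
have I3 b1 b2 := @Iper_ebas3 R b1 m b2 l b k m0.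
rewrite coefI (eq_Iper (g := fun x =>
  (u false m * v false l) * (ebas false m x * ebas false l x * ebas b k x) +
  ((u false m * v true l) * (ebas false m x * ebas true l x * ebas b k x) +
  ((u true m * v false l) * (ebas true m x * ebas false l x * ebas b k x) +
   (u true m * v true l) * (ebas true m x * ebas true l x * ebas b k x))))); last first.
  by move=> x; rewrite !trig_termE; ring.
have c3 b1 b2 := contM (contM (ce b1 m) (ce b2 l)) (ce b k).
rewrite (IperD (contZ (c3 false false)) (contD (contZ (c3 false true))
  (contD (contZ (c3 true false)) (contZ (c3 true true))))).
rewrite (IperD (contZ (c3 false true))
  (contD (contZ (c3 true false)) (contZ (c3 true true)))).
rewrite (IperD (contZ (c3 true false)) (contZ (c3 true true))).
rewrite (IperZ _ (c3 false false)) (IperZ _ (c3 false true)) (IperZ _ (c3 true false))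
  (IperZ _ (c3 true true)).
move: (I3 false false) (I3 false true) (I3 true false) (I3 true true) => {I3 c3}.
rewrite -/d.
set i1 := Iper _; set i2 := Iper _; set i3 := Iper _; set i4 := Iper _ => h1 h2 h3 h4.
have p0 := pi_gt0 R.
rewrite normrM ger0_norm ?invr_ge0 ?pi_ge0// ler_pdivrMl//.
have hM (c i : R) : `|i| <= pi / 2 * d -> `|c * i| <= `|c| * (pi / 2 * d).
  by move=> hi; rewrite normrM ler_wpM2l.
have := hM (u false m * v false l) _ h1; have := hM (u false m * v true l) _ h2.
have := hM (u true m * v false l) _ h3; have := hM (u true m * v true l) _ h4.
rewrite !normrM => {h1 h2 h3 h4 hM}.
set j1 := u false m * _ * _; set j2 := u false m * _ * _; set j3 := u true m * _ * _.
set j4 := u true m * _ * _.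
have := ler_normD j1 (j2 + (j3 + j4)); have := ler_normD j2 (j3 + j4).
have := ler_normD j3 j4.
rewrite !normrM.
move: (pi : R) d `|j1 + _| `|j2 + _| `|j3 + _| p0 => P d' n1 n2 n3 P0.
move: `|u _ m| `|u _ m| `|v _ l| `|v _ l| `|i1| `|i2| `|i3| `|i4| => a1 a2 b1 b2 e1 e2 e3 e4.
move=> *; apply: (@le_trans _ _ (a1 * b1 * (P / 2 * d') + a1 * b2 * (P / 2 * d')
  + a2 * b1 * (P / 2 * d') + a2 * b2 * (P / 2 * d'))); first by lra.
by rewrite le_eqVlt; apply/orP; left; apply/eqP; field.
Qed.

(* A nonzero coefficient of the product of the modes m and l has k <= m + l, so
   the exponential weight is submultiplicative. *)
Lemma coef_trigp_prod u v tau A B n b k : 0 <= tau -> 0 < A -> 0 < B ->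
  psum (fun m => expR (tau * m%:R) ^+ 2 * (u false m ^+ 2 + u true m ^+ 2)) n <= A ^+ 2 ->
  psum (fun m => expR (tau * m%:R) ^+ 2 * (v false m ^+ 2 + v true m ^+ 2)) n <= B ^+ 2 ->
  expR (tau * k%:R) *
    `|coef (fun x => psum (trig_term u x) n * psum (trig_term v x) n) b k| <= 3 * (A * B).
Proof.
move=> tau0 A0 B0 uA vB.
have ct w j := @trig_term_continuous R w j.
rewrite (@eq_coef _ _ (fun x => psum (fun m => psum (fun l => trig_term u x m * trig_term v x l) n) n));
  last first.
  move=> x; rewrite mulrC -psumZ; apply: eq_psum => m _.
  by rewrite mulrC -psumZ.
rewrite (@coef_psum _ (fun m x => psum (fun l => trig_term u x m * trig_term v x l) n)); last first.
  move=> m m0; have [|//] := @Iper_psum R (fun l x => trig_term u x m * trig_term v x l) n.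
  by move=> l l0; exact: contM (ct u m) (ct v l).
rewrite (@eq_psum _ _ (fun m => psum (fun l => coef (fun x => trig_term u x m * trig_term v x l) b k) n));
  last first.
  move=> m m0; rewrite (@coef_psum _ (fun l x => trig_term u x m * trig_term v x l))//.
  by move=> l l0; exact: contM (ct u m) (ct v l).
(* Cosine and sine amplitudes are merged, at the price of a factor 2 in the squares. Each of the
   three resonances then gives [2 A B], and the leading [2^-1] leaves the constant 3. *)
pose U m := expR (tau * m%:R) * (`|u false m| + `|u true m|).
pose V m := expR (tau * m%:R) * (`|v false m| + `|v true m|).
have sq (a c e : R) : (e * (`|a| + `|c|)) ^+ 2 <= 2 * (e ^+ 2 * (a ^+ 2 + c ^+ 2)).
  rewrite exprMn [leRHS]mulrCA; apply: ler_wpM2l; first exact: sqr_ge0.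
  rewrite -(real_normK (num_real a)) -(real_normK (num_real c)).
  have := sqr_ge0 (`|a| - `|c|); lra.
have UA : psum (fun m => U m ^+ 2) n <= (Num.sqrt 2 * A) ^+ 2.
  rewrite exprMn sqr_sqrtr//.
  apply: (@le_trans _ _ (2 * psum (fun m => expR (tau * m%:R) ^+ 2 *
    (u false m ^+ 2 + u true m ^+ 2)) n)); last by rewrite ler_pM2l.
  by rewrite -psumZ; apply: le_psum => m _; exact: sq.
have VB : psum (fun m => V m ^+ 2) n <= (Num.sqrt 2 * B) ^+ 2.
  rewrite exprMn sqr_sqrtr//.
  apply: (@le_trans _ _ (2 * psum (fun m => expR (tau * m%:R) ^+ 2 *
    (v false m ^+ 2 + v true m ^+ 2)) n)); last by rewrite ler_pM2l.
  by rewrite -psumZ; apply: le_psum => m _; exact: sq.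
have A'0 : 0 < Num.sqrt 2 * A by rewrite mulr_gt0// sqrtr_gt0.
have B'0 : 0 < Num.sqrt 2 * B by rewrite mulr_gt0// sqrtr_gt0.
have AB : Num.sqrt 2 * A * (Num.sqrt 2 * B) = 2 * (A * B).
  by rewrite mulrACA -expr2 sqr_sqrtr.
have S1 := @schur (fun m l => m == l + k)%N _ _ _ _ n _ _ A'0 B'0 UA VB.
have S2 := @schur (fun m l => l == m + k)%N _ _ _ _ n _ _ A'0 B'0 UA VB.
have S3 := @schur (fun m l => k == m + l)%N _ _ _ _ n _ _ A'0 B'0 UA VB.
have {}S1 : psum (fun m => psum (fun l => U m * V l * (m == l + k)%N%:R) n) n <= 2 * (A * B).
  rewrite -AB; apply: S1.
    by move=> m l l' /eqP -> /eqP/addIn.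
  by move=> m l l' /eqP -> /eqP.
have {}S2 : psum (fun m => psum (fun l => U m * V l * (l == m + k)%N%:R) n) n <= 2 * (A * B).
  rewrite -AB; apply: S2.
    by move=> m l l' /eqP -> /eqP.
  by move=> m l l' /eqP -> /eqP/addIn.
have {}S3 : psum (fun m => psum (fun l => U m * V l * (k == m + l)%N%:R) n) n <= 2 * (A * B).
  rewrite -AB; apply: S3.
    by move=> m l l' /eqP -> /eqP/addnI.
  by move=> m l l' /eqP -> /eqP/addIn.
apply: (@le_trans _ _ (2^-1 * psum (fun m => psum (fun l => U m * V l *
   ((m == l + k)%N%:R + (l == m + k)%N%:R + (k == m + l)%N%:R)) n) n)); last first.
  rewrite (@eq_psum _ _ (fun m => psum (fun l => U m * V l * (m == l + k)%N%:R) n +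
    psum (fun l => U m * V l * (l == m + k)%N%:R) n +
    psum (fun l => U m * V l * (k == m + l)%N%:R) n)); last first.
    by move=> m _; rewrite -!psumD; apply: eq_psum => l _; rewrite !mulrDr.
  rewrite !psumD ler_pdivrMl//.
  by move: S1 S2 S3; lra.
rewrite -psumZ.
apply: le_trans (ler_wpM2l (expR_ge0 _) (ler_norm_psum _ _)) _.
rewrite -psumZ; apply: le_psum => m m0.
apply: le_trans (ler_wpM2l (expR_ge0 _) (ler_norm_psum _ _)) _.
rewrite -!psumZ; apply: le_psum => l l0.
apply: le_trans (ler_wpM2l (expR_ge0 _) (coef_trig_termM _ _ _ _ _ m0)) _.
set d := (_ + _ + _ in X in _ <= X).
rewrite -/d [leLHS](_ : _ = 2^-1 * (expR (tau * k%:R) *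
  ((`|u false m| + `|u true m|) * (`|v false l| + `|v true l|) * d))); last by ring.
rewrite /U /V; apply: ler_wpM2l => //.
have d0 : 0 <= d by rewrite /d !addr_ge0.
have [kml|kml] := leqP k (m + l)%N; last first.
  suff -> : d = 0 by rewrite !mulr0.
  rewrite /d (ltn_eqF (leq_ltn_trans (leq_addr l m) (leq_trans kml (leq_addl l k)))).
  rewrite (ltn_eqF (leq_ltn_trans (leq_addl m l) (leq_trans kml (leq_addl m k)))).
  rewrite (gtn_eqF kml).
  by rewrite !addr0.
rewrite [X in _ <= X](_ : _ = expR (tau * m%:R) * expR (tau * l%:R) *
   ((`|u false m| + `|u true m|) * (`|v false l| + `|v true l|) * d)); last by ring.
apply: ler_wpM2r.
  by rewrite mulr_ge0// mulr_ge0// addr_ge0.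
by rewrite -expRD ler_expR -mulrDr -natrD ler_wpM2l// ler_nat.
Qed.

Lemma psum_trig_bound u K n x : sumu u K -> `|psum (trig_term u x) n| <= K + K.
Proof. by move=> uK; apply: le_trans (ler_norm_psum _ _) (trig_asum x uK n). Qed.

Lemma coef_prod u v tau A B K L b k : 0 <= tau -> 0 < A -> 0 < B ->
  sumu u K -> sumu v L ->
  (forall n, psum (fun m => expR (tau * m%:R) ^+ 2 * (u false m ^+ 2 + u true m ^+ 2)) n <= A ^+ 2) ->
  (forall n, psum (fun m => expR (tau * m%:R) ^+ 2 * (v false m ^+ 2 + v true m ^+ 2)) n <= B ^+ 2) ->
  expR (tau * k%:R) * `|coef (fun x => trig u x * trig v x) b k| <= 3 * (A * B).
Proof.
move=> tau0 A0 B0 uK vL uA vB.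
have K0 : 0 <= K := asum_le_ge0 (uK false).
have L0 : 0 <= L := asum_le_ge0 (vL false).
have h : coef (fun x => psum (trig_term u x) n * psum (trig_term v x) n) b k @[n --> \oo] -->
    coef (fun x => trig u x * trig v x) b k.
  apply: coef_uniform.
  - by apply: nearW => n; apply: contM; exact: trigp_continuous.
  - by apply: contM; exact: trig_continuous.
  move=> e e0.
  pose d := e / (2 * K + 2 * L + 1).
  have s0 : 0 < 2 * K + 2 * L + 1 by lra.
  have d0 : 0 < d by rewrite divr_gt0.
  near=> n => x.
  have hu : `|psum (trig_term u x) n - trig u x| <= d.
    by move: (x); near: n; exact: trigp_unif uK _ d0.
  have hv : `|psum (trig_term v x) n - trig v x| <= d.
    by move: (x); near: n; exact: trigp_unif vL _ d0.
  have bu := trig_bound x uK.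
  have bv := psum_trig_bound n x vL.
  set p := psum _ _ in hu *; set q := psum _ _ in hv bv *.
  rewrite (_ : p * q - _ = (p - trig u x) * q + trig u x * (q - trig v x)); last by ring.
  apply: le_trans (ler_normD _ _) _; rewrite !normrM.
  apply: (@le_trans _ _ (d * (L + L) + (K + K) * d)).
    by apply: lerD; apply: ler_pM.
  rewrite (_ : _ + _ = d * (2 * K + 2 * L)); last by ring.
  apply: (@le_trans _ _ (d * (2 * K + 2 * L + 1))); last by rewrite divfK ?gt_eqF.
  by apply: ler_wpM2l; [exact: ltW|lra].
have h2 : expR (tau * k%:R) * `|coef (fun x => psum (trig_term u x) n * psum (trig_term v x) n) b k|
   @[n --> \oo] --> expR (tau * k%:R) * `|coef (fun x => trig u x * trig v x) b k|.
  by apply: cvgMr; apply: cvg_norm; exact: h.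
refine (cvgr_to_le h2 _); near=> n.
exact: coef_trigp_prod.
Unshelve. all: by end_near. Qed.

End product_coefficients.

(** * The principal value integral of a trigonometric series *)

Section hilbert_transform.
Context {R : realType}.
Notation leb := (@lebesgue_measure R).
Implicit Types (u : bool -> nat -> R) (x z : R) (K L : R).

Definition hilbu u b k : R := if b then u false k else - u true k.

(** The modified Dirichlet kernel [1 + 2 cos z + ... + 2 cos ((k - 1) z) + cos (k z)], that is
    [sin (k z) cot (z / 2)] without its singularity at 0. The grouping in pairs gives an induction
    on [k] with a single kind of step. *)
Definition dirich (k : nat) z : R :=
  \sum_(0 <= j < k) (cos (j%:R * z) + cos (j.+1%:R * z)).

Definition sinint (j : nat) z : R := if j == 0%N then z else j%:R^-1 * sin (j%:R * z).

(** The primitive of [dirich k] that vanishes at 0. *)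
Definition dirichint (k : nat) z : R := \sum_(0 <= j < k) (sinint j z + sinint j.+1 z).

Lemma dirichE k z : sin (k%:R * z) * cos (z / 2) = dirich k z * sin (z / 2).
Proof.
rewrite /dirich; elim: k => [|k IH]; first by rewrite mul0r sin0 big_geq// !mul0r.
rewrite big_nat_recr//= mulrDl -IH -natr1 mulrDl mul1r sinD cosD.
rewrite (_ : cos z = cos (z / 2 + z / 2)); last by congr cos; field.
rewrite (_ : sin z = sin (z / 2 + z / 2)); last by congr sin; field.
rewrite cosD sinD; set c := cos (z / 2); set s := sin (z / 2).
have cs : c ^+ 2 = 1 - s ^+ 2 by rewrite /c /s cos2sin2.
set A := cos _; set B := sin _.
rewrite (_ : _ * c = (B * (c ^+ 2 - s ^+ 2) + A * (2 * s * c)) * c); last by ring.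
rewrite [RHS](_ : _ = B * c + s * (A * (1 + (c ^+ 2 - s ^+ 2)) - 2 * B * s * c)); last by ring.
rewrite cs (_ : (1 - s ^+ 2 - s ^+ 2) = 1 - 2 * s ^+ 2); last by ring.
rewrite (_ : 1 + (1 - 2 * s ^+ 2) = 2 * (1 - s ^+ 2)); last by ring.
by rewrite -cs; ring.
Qed.

Lemma dirich_le k z : `|dirich k z| <= 2 * k%:R.
Proof.
apply: le_trans (ler_norm_sum _ _ _) _.
apply: (@le_trans _ _ (\sum_(0 <= j < k) 2)).
  apply: ler_sum => j _; apply: le_trans (ler_normD _ _) _.
  by have := cos_max (j%:R * z); have := cos_max (j.+1%:R * z); lra.
by rewrite sumr_const_nat subn0 mulr_natr.
Qed.

Lemma sinint_derive j z : is_derive z (1 : R) (sinint j) (cos (j%:R * z)).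
Proof.
rewrite /sinint; case: eqVneq => [->|j0]; first by rewrite mul0r cos0; exact: is_derive_id.
have d1 : is_derive z (1 : R) (fun z => sin (j%:R * z)) (j%:R * ebas false j z) := ebas_derive true j z.
apply: is_derive_eq; rewrite /GRing.scale/= /ebas.
by rewrite mulKf// pnatr_eq0.
Qed.

Lemma dirichint_derive k z : is_derive z (1 : R) (dirichint k) (dirich k z).
Proof.
rewrite /dirichint /dirich; elim: k => [|k IH].
  rewrite big_geq// (_ : (fun z => _) = cst 0); first exact: is_derive_cst.
  by apply/funext => y; rewrite big_geq.
rewrite big_nat_recr//= (_ : (fun z => _) = (fun z => \sum_(0 <= j < k) (sinint j z + sinint j.+1 z)
   + (sinint k z + sinint k.+1 z))); last by apply/funext => y; rewrite big_nat_recr.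
have h1 := sinint_derive k z; have h2 := sinint_derive k.+1 z.
exact: is_deriveD.
Qed.

Lemma sinint_le j z : `|z| <= 4 -> `|sinint j z| <= 4.
Proof.
move=> z4; rewrite /sinint; case: eqVneq => // j0.
rewrite normrM normfV (ger0_norm (ler0n R j)) ler_pdivrMl ?ltr0n ?lt0n//.
apply: le_trans (sin_max _) _; have : 1 <= j%:R :> R by rewrite ler1n lt0n.
by lra.
Qed.

Lemma dirichint_le k z : `|z| <= 4 -> `|dirichint k z| <= 8 * k%:R.
Proof.
move=> z4; apply: le_trans (ler_norm_sum _ _ _) _.
apply: (@le_trans _ _ (\sum_(0 <= j < k) 8)).
  apply: ler_sum => j _; apply: le_trans (ler_normD _ _) _.
  by have := sinint_le j z4; have := sinint_le j.+1 z4; lra.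
by rewrite sumr_const_nat subn0 mulr_natr.
Qed.

Lemma dirichint0 k : dirichint k 0 = 0.
Proof.
have s0 i : sinint i 0 = 0 by rewrite /sinint mulr0 sin0 mulr0; case: eqP.
by rewrite /dirichint big1// => j _; rewrite !s0 addr0.
Qed.

(** All sines vanish at [pi], so only the constant term of the kernel counts. The value is the same
    for every mode, which is why the Hilbert transform merely exchanges cosines and sines. *)
Lemma dirichint_pi k : (0 < k)%N -> dirichint k pi = pi.
Proof.
case: k => // k _; rewrite /dirichint big_nat_recl//= big1 ?addr0.
  by rewrite /sinint/= sin_nat_pi mulr0 addr0.
by move=> j _; rewrite /sinint/= !sin_nat_pi !mulr0 addr0.
Qed.

Lemma hilbu_sum u K : sumu u K -> sumu (hilbu u) K.
Proof.
move=> uK [|]; first exact: (uK false).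
by apply: asum_leN; exact: (uK true).
Qed.

Lemma trig_reflect u K x z : sumu u K ->
  trig u (x - z) - trig u (x + z) =
  tsum (fun k => 2 * trig_term (hilbu u) x k * sin (k%:R * z)).
Proof.
move=> uK; rewrite /trig -(tsumB (trig_asum _ uK) (trig_asum _ uK)).
apply: eq_tsum => k _; rewrite /trig_term /hilbu mulrBr mulrDr cosB cosD sinB sinD.
by ring.
Qed.

Lemma subset_punctured x e : 0 < e -> e < pi ->
  [set y : R | e <= `|x - y| <= pi] = `[x - pi, x - e] `|` `[x + e, x + pi].
Proof.
move=> e0 ep; apply/seteqP; split => y /=; rewrite !in_itv/=.
  rewrite ler_normr ler_norml => /andP[/orP[h|h] /andP[h1 h2]]; [left|right]; lra.
by rewrite ler_normr ler_norml => -[|] h; apply/andP; split; try (apply/orP); lra.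
Qed.

Lemma Rintegral_reflect (G : R -> R) x a b : a <= b ->
  {within `[x - b, x - a], continuous G} ->
  \int[leb]_(y in `[x - b, x - a]) G y = \int[leb]_(z in `[a, b]) G (x - z).
Proof.
move=> ab cG; pose F z := x - z.
have dF z : is_derive z (1 : R) F (-1) by rewrite /F; apply: is_derive_eq; ring.
have F' : derive1 F = cst (-1).
  by apply/funext => z; rewrite derive1E; have [_ ->] := dF z.
have cF z : F s @[s --> z] --> F z by apply: cvgB; [exact: cvg_cst|exact: cvg_id].
rewrite /Rintegral (@integration_by_substitution_decreasing _ F G a b)//.
- by congr fine; apply: eq_integral => z _; rewrite F' /= fctE /= opprK mulr1.
- by move=> y z _ _; rewrite /F => ?; lra.
- by rewrite F' => z _; exact: cst_continuous.
- by rewrite F'; exact: is_cvg_cst.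
- by rewrite F'; exact: is_cvg_cst.
- split; first by move=> z _; have [] := dF z.
    exact: cvg_at_right_filter.
  exact: cvg_at_left_filter.
Qed.

Lemma Rintegral_translate (G : R -> R) x a b : a <= b ->
  {within `[x + a, x + b], continuous G} ->
  \int[leb]_(y in `[x + a, x + b]) G y = \int[leb]_(z in `[a, b]) G (x + z).
Proof.
move=> ab cG; pose F z := x + z.
have dF z : is_derive z (1 : R) F 1 by rewrite /F; apply: is_derive_eq; ring.
have F' : derive1 F = cst 1.
  by apply/funext => z; rewrite derive1E; have [_ ->] := dF z.
have cF z : F s @[s --> z] --> F z by apply: cvgD; [exact: cvg_cst|exact: cvg_id].
rewrite /Rintegral (@integration_by_substitution_increasing _ F G a b)//.
- by congr fine; apply: eq_integral => z _; rewrite F' /= fctE /= mulr1.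
- by move=> y z _ _; rewrite /F => ?; lra.
- by rewrite F' => z _; exact: cst_continuous.
- by rewrite F'; exact: is_cvg_cst.
- by rewrite F'; exact: is_cvg_cst.
- split; first by move=> z _; have [] := dF z.
    exact: cvg_at_right_filter.
  exact: cvg_at_left_filter.
Qed.

(** The two halves of the punctured period are folded onto [[e, pi]]. As the cotangent is odd, [f]
    enters through the difference [f (x - z) - f (x + z)], which will absorb the singularity. *)
Lemma hilbert_kernel_integral (f : R -> R) x e : continuous f -> 0 < e -> e < pi ->
  \int[leb]_(y in [set y : R | (e <= `|x - y| <= pi)%R])
     (f y * (cos ((x - y) / 2) / sin ((x - y) / 2))) =
  \int[leb]_(z in `[e, pi]) ((f (x - z) - f (x + z)) * (cos (z / 2) / sin (z / 2))).
Proof.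
move=> cf e0 ep.
have p0 := pi_gt0 R.
pose G y := f y * (cos ((x - y) / 2) / sin ((x - y) / 2)).
have sin_neq0 y : e <= `|x - y| <= pi -> sin ((x - y) / 2) != 0.
  rewrite ler_normr ler_norml => /andP[/orP[h|h] /andP[h1 h2]].
    by rewrite gt_eqF// sin_gt0_pi//; lra.
  rewrite -[(x - y) / 2]opprK sinN oppr_eq0 gt_eqF// sin_gt0_pi//; lra.
have cG y : e <= `|x - y| <= pi -> {for y, continuous G}.
  move=> hy; apply: cvgM; first exact: cf.
  have cxy : (x - z) / 2 @[z --> y] --> (x - y) / 2.
    by apply: cvgMl; apply: cvgB; [exact: cvg_cst|exact: cvg_id].
  apply: cvgM; first by apply: continuous_comp cxy _; exact: continuous_cos.
  apply: cvgV; first exact: sin_neq0.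
  by apply: continuous_comp cxy _; exact: continuous_sin.
have cG1 : {within `[x - pi, x - e], continuous G}.
  apply: continuous_in_subspaceT => y; rewrite inE/= in_itv/= => hy.
  by apply: cG; rewrite ger0_norm; lra.
have cG2 : {within `[x + e, x + pi], continuous G}.
  apply: continuous_in_subspaceT => y; rewrite inE/= in_itv/= => hy.
  by apply: cG; rewrite ler0_norm; lra.
rewrite subset_punctured//.
rewrite Rintegral_setU/=; [|exact: measurable_itv|exact: measurable_itv| |]; last 2 first.
- apply: continuous_compact_integrable; first by apply: compactU; exact: segment_compact.
  apply: continuous_in_subspaceT => y; rewrite inE -subset_punctured//= => hy.
  exact: cG.
- by apply/disj_setPS => y /= []; rewrite !in_itv/=; lra.
rewrite Rintegral_reflect ?Rintegral_translate ?(ltW ep)//.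
have cGz (h : R -> R) : continuous h -> (forall z, e <= z <= pi -> e <= `|x - h z| <= pi) ->
    leb.-integrable `[e, pi] (EFin \o (fun z => G (h z))).
  move=> ch hz; apply: continuous_compact_integrable; first exact: segment_compact.
  apply: continuous_in_subspaceT => z; rewrite inE/= in_itv/= => ez.
  by apply: continuous_comp; [exact: ch|apply: cG; exact: hz].
rewrite -RintegralD//; last 2 first.
- apply: (cGz (fun z => x - z)); first by move=> z; apply: cvgB; [exact: cvg_cst|exact: cvg_id].
  by move=> z hz; rewrite (_ : x - (x - z) = z) ?ger0_norm//; lra.
- apply: (cGz (fun z => x + z)); first by move=> z; apply: cvgD; [exact: cvg_cst|exact: cvg_id].
  by move=> z hz; rewrite (_ : x - (x + z) = - z) ?normrN ?ger0_norm//; lra.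
apply: eq_Rintegral => z _; rewrite /G.
rewrite (_ : x - (x - z) = z); last by ring.
rewrite (_ : (x - (x + z)) / 2 = - (z / 2)); last by field.
by rewrite cosN sinN invrN; ring.
Qed.

(** The folded difference is a series in [sin (k z)], and its product with the cotangent is a series
    in the regular kernels [dirich k z]. The truncated integral is therefore [Phi pi - Phi e] with
    [Phi] differentiable across 0. Summability of [k u_k] matches the bound [2 k] on the kernels. *)
Lemma hilbert_trig u K L x : sumu u K -> sumu (fun b k => k%:R * u b k) L ->
  hilbert (trig u) x = trig (hilbu u) x.
Proof.
move=> uK kuL.
have p0 := pi_gt0 R; have p2 := @pi2_gt0 R.
have hK := hilbu_sum uK.
pose a k := 2 * trig_term (hilbu u) x k.
have aK : asum_le a (`|2| * (K + K)) by apply: asum_leZ; exact: trig_asum.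
have kaL : asum_le (fun k => k%:R * a k) (2 * (L + L)).
  apply: (@asum_leW _ _ (fun k => 2 * (`|k%:R * u false k| + `|k%:R * u true k|))).
    move=> k _; rewrite [X in _ <= X]ger0_norm; last by rewrite mulr_ge0// addr_ge0.
    rewrite /a mulrCA normrM ger0_norm//; apply: ler_wpM2l => //.
    rewrite !normrM -mulrDr; apply: ler_wpM2l => //.
    by apply: le_trans (trig_term_le _ _ _) _; rewrite /hilbu normrN addrC.
  rewrite -[X in asum_le _ (X * _)](ger0_norm (ler0n R 2)); apply: asum_leZ; apply: asum_leD; exact: asum_norm.
pose Phi z := tsum (fun k => a k * dirichint k z).
pose dPhi z := tsum (fun k => a k * dirich k z).
have dirsum z : asum_le (fun k => a k * dirich k z) (`|2| * (2 * (L + L))).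
  apply: asum_leW (asum_leZ 2 kaL) => k _.
  rewrite mulrA !normrM mulrC; apply: ler_wpM2r => //.
  by apply: le_trans (dirich_le _ _) _; rewrite !ger0_norm.
(* An open interval containing [[0, pi]], so that [Phi] is differentiable at both ends. *)
have dPhiP z : -4 < z < 4 -> is_derive z (1 : R) Phi (dPhi z).
  move=> z4.
  apply: (@tsum_derive _ (fun z k => a k * dirichint k z) (fun z k => a k * dirich k z)
    (fun k => `|2 * (k%:R * a k)|) z (-4) 4 (`|2| * (2 * (L + L))) (`|8| * (2 * (L + L)))).
  - exact: z4.
  - exact: asum_norm (asum_leZ 2 kaL).
  - move=> s s4; apply: asum_leW (asum_leZ 8 kaL) => k _.
    rewrite mulrA !normrM mulrC; apply: ler_wpM2r => //.
    apply: le_trans (dirichint_le _ _) _; first by rewrite ler_norml; lra.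
    by rewrite !ger0_norm.
  - move=> s k _ _; have h := dirichint_derive k s.
    by apply: is_derive_eq.
  - move=> s k _ _; rewrite mulrA !normrM mulrC; apply: ler_wpM2r => //.
    by apply: le_trans (dirich_le _ _) _; rewrite !ger0_norm.
have Phipi : Phi pi = pi *+ 2 * trig (hilbu u) x.
  rewrite /Phi (@eq_tsum _ _ (fun k => (pi *+ 2) * trig_term (hilbu u) x k)).
    by rewrite (tsumZ _ (trig_asum x hK)).
  by move=> k k0; rewrite dirichint_pi// /a; move: (pi : R) => p; ring.
have Phi0 : Phi 0 = 0.
  by rewrite /Phi -[RHS]tsum0; apply: eq_tsum => k _; rewrite dirichint0 mulr0.
have p4 : pi < 4 :> R by have := pihalf_02 R; lra.
have integrandE e z : 0 < e -> e <= z <= pi ->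
    (trig u (x - z) - trig u (x + z)) * (cos (z / 2) / sin (z / 2)) = dPhi z.
  move=> e0 hz.
  have s0 : sin (z / 2) != 0 by rewrite gt_eqF// sin_gt0_pi//; lra.
  rewrite (trig_reflect _ _ uK) mulrC.
  rewrite -(@tsumZ _ (cos (z / 2) / sin (z / 2)) _ (`|2| * (K + K))).
    apply: eq_tsum => k _; rewrite -/(a k) mulrCA; congr (_ * _).
    by rewrite mulrAC (mulrC (cos _)) dirichE mulfK.
  by apply: asum_leW aK => k _; rewrite normrM ler_piMr// sin_max.
have intE e : 0 < e -> e < pi ->
  \int[leb]_(y in [set y : R | (e <= `|x - y| <= pi)%R])
     (trig u y * (cos ((x - y) / 2) / sin ((x - y) / 2))) = Phi pi - Phi e.
  move=> e0 ep; rewrite hilbert_kernel_integral//; last exact: trig_continuous uK.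
  transitivity (\int[leb]_(z in `[e, pi]) dPhi z).
    by apply: eq_Rintegral => z; rewrite inE/= in_itv/= => hz; exact: integrandE hz.
  have cdPhi : continuous dPhi.
    move=> z; apply: (@tannery _ _ _ _ _ _ (fun k => `|2 * (k%:R * a k)|) (`|2| * (2 * (L + L)))).
    - exact: asum_norm (asum_leZ 2 kaL).
    - move=> k _; rewrite mulrA !normrM mulrC; apply: ler_wpM2r => //.
      by apply: le_trans (dirich_le _ _) _; rewrite !ger0_norm.
    - near=> s => k _; rewrite mulrA !normrM mulrC; apply: ler_wpM2r => //.
      by apply: le_trans (dirich_le _ _) _; rewrite !ger0_norm.
    - move=> k _; apply: cvgMr.
      suff : continuous (dirich k) by exact.
      rewrite /dirich; elim: k => [|k IH].
        by under eq_fun do rewrite big_geq//; move=> ?; exact: cst_continuous.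
      under eq_fun do rewrite big_nat_recr//=.
      apply: contD => //; apply: contD; [exact: (@ebas_continuous _ false k)|exact: (@ebas_continuous _ false k.+1)].
  have cPhi z : -4 < z < 4 -> Phi s @[s --> z] --> Phi z.
    by move=> hz; have [+ _] := dPhiP z hz; move=> /derivable1_diffP/differentiable_continuous.
  rewrite /Rintegral (@continuous_FTC2 _ dPhi Phi e pi)//.
  - exact: continuous_subspaceT.
  - split; first by move=> z; rewrite in_itv/= => hz; have [] := dPhiP z ltac:(lra).
      by apply: cvg_at_right_filter; apply: cPhi; lra.
    by apply: cvg_at_left_filter; apply: cPhi; lra.
  - by move=> z; rewrite in_itv/= => hz; rewrite derive1E; have [_ ->] := dPhiP z ltac:(lra).
rewrite /hilbert.
set F := fun eps => _.
have hF : F e @[e --> 0^'+] --> pi *+ 2 * trig (hilbu u) x.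
  have hc : (fun e => Phi pi - Phi e) @ 0^'+ --> Phi pi - Phi 0.
    apply: cvgB; first exact: cvg_cst.
    apply: cvg_at_right_filter.
    by have [+ _] := dPhiP 0 ltac:(lra); move=> /derivable1_diffP/differentiable_continuous.
  rewrite Phi0 subr0 Phipi in hc; apply: cvg_trans hc; apply: near_eq_cvg; near=> e.
  have e0 : 0 < e by near: e; exact: nbhs_right_gt.
  have ep : e < pi by near: e; exact: nbhs_right_lt.
  by rewrite /F (intE _ e0 ep) Phipi.
by rewrite (cvg_lim (@Rhausdorff R) hF) mulKf// gt_eqF.
Unshelve. all: by end_near. Qed.

End hilbert_transform.

(** * A supersolution of the scalar equation w' + mu X w = t^(-r) exp(- la kap t^(1/al)) *)

Section comparison_principle.
Context {R : realType}.

Lemma powR_le1D (z q a : R) : 0 <= z -> 0 <= q <= a -> z `^ q <= 1 + z `^ a.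
Proof.
move=> z0 /andP[q0 qa]; have [z1|z1] := leP z 1.
  have h : z `^ q <= 1 `^ q by apply: ge0_ler_powR => //; rewrite ?nnegrE.
  by rewrite powR1 in h; have := powR_ge0 z a; lra.
have h : z `^ q <= z `^ a by rewrite ler_powR// ltW.
by lra.
Qed.

Lemma is_derive_powR_pos (p t : R) : 0 < t ->
  is_derive t (1 : R) (fun s => s `^ p) (p * t `^ (p - 1)).
Proof. by move=> t0; exact: is_derive1_powR. Qed.

Variables (mu al r la kap : R).
Hypotheses (mu0 : 0 < mu) (al1 : 1 < al) (r01 : 0 <= r < 1) (kap0 : 0 < kap).
Hypotheses (la0 : 0 <= la) (la1 : la <= al * (1 - r) / 2) (la2 : la <= al * mu / 2).

Implicit Types (s t T K : R).

Let X := kap `^ al.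
Let eta := mu / 4.
Let E (t : R) := expR (- (la * kap) * t `^ al^-1).
Let V (t : R) := (1 + eta * X * t)^-1.

(** Up to the factor [E], it interpolates between two regimes: for [X t] small a solution is about
    [t^(1 - r) / (1 - r)], the integral of the source, and for [X t] large about the equilibrium
    [t^(-r) / (mu X)]. The factor [V] switches between them. *)
Definition barrier (t : R) : R := 2 / (1 - r) * (E t * (t `^ (1 - r) * V t)).

Lemma barrier_ge0 t : 0 <= t -> 0 <= barrier t.
Proof.
move=> t0; rewrite mulr_ge0// ?divr_ge0//; first by move/andP: r01; lra.
rewrite mulr_ge0 ?expR_ge0// mulr_ge0 ?powR_ge0// invr_ge0 addr_ge0// mulr_ge0//.
by rewrite mulr_ge0 ?powR_ge0// divr_ge0// ltW.
Qed.

(** With [z = kap t^(1/al)] and [y = X t = z^al], the right side is [2 / (1 - r) E V t^(-r)] times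
    [(1 - r) - (la / al) z + mu y - eta y V]. The loss from differentiating [E] costs at most half
    of [1 - r] and half of [mu y]. As [eta = mu / 4], what remains is at least
    [(1 - r) / 2 + eta y], and the prefactor [2 / (1 - r)] normalizes it. *)
Lemma barrier_super (t : R) : 0 < t -> exists db, is_derive t (1 : R) barrier db /\
  t `^ (- r) * E t <= db + mu * X * barrier t.
Proof.
move=> t0; have /andP[r0 r1] := r01; move: (mu0) (al1) (kap0) => mu0' al1' kap0'.
have X0 : 0 < X by rewrite powR_gt0.
have eta0 : 0 < eta by rewrite divr_gt0.
have D0 : 0 < 1 + eta * X * t by rewrite addr_gt0// !mulr_gt0.
have dE : is_derive t (1 : R) E (E t * (- (la * kap) * (al^-1 * t `^ (al^-1 - 1)))).
  have d1 := is_derive_powR_pos al^-1 t0.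
  have d2 : is_derive t (1 : R) (fun s => - (la * kap) * s `^ al^-1)
      (- (la * kap) * (al^-1 * t `^ (al^-1 - 1))).
    exact: is_deriveZ.
  exact: (@is_derive1_comp _ (@expR R)).
have dQ := is_derive_powR_pos (1 - r) t0.
have dV : is_derive t (1 : R) V (- (V t ^+ 2 * (eta * X))).
  have d2 : is_derive t (1 : R) (fun s => 1 + eta * X * s) (eta * X).
    by apply: is_derive_eq; rewrite /GRing.scale/=; ring.
  have := @is_deriveV _ (fun s => 1 + eta * X * s) t (eta * X) 1.
  rewrite gt_eqF// => /(_ isT d2) d3; apply: is_derive_eq.
  by rewrite /GRing.scale/= mulNr /V exprVn.
have dQV := is_deriveM dQ dV.
have dEQV := is_deriveM dE dQV.
have dB := is_deriveZ (2 / (1 - r)) dEQV.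
exists (2 / (1 - r) * (E t * (t `^ (1 - r) * (- (V t ^+ 2 * (eta * X))) +
  V t * ((1 - r) * t `^ (1 - r - 1))) +
  (t `^ (1 - r) * V t) * (E t * (- (la * kap) * (al^-1 * t `^ (al^-1 - 1)))))).
split; first exact: dB.
have -> : 1 - r - 1 = - r by ring.
have tr : t `^ (1 - r) = t * t `^ (- r).
  by rewrite powRD ?powRr1 ?ltW//; apply/implyP => _; rewrite gt_eqF.
have tz : kap * t `^ al^-1 = kap * (t * t `^ (al^-1 - 1)).
  by rewrite mulr_powRB1 ?(ltW t0)// invr_gt0 (lt_trans _ al1).
pose z := kap * t `^ al^-1.
have z0 : 0 < z by rewrite mulr_gt0 ?powR_gt0.
pose y := X * t.
have y0 : 0 < y by rewrite mulr_gt0.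
have zy : z `^ al = y.
  by rewrite /z powRM ?powR_ge0 ?(ltW kap0)// -powRrM mulVf ?powRr1 ?(ltW t0)// gt_eqF// (lt_trans _ al1).
(* For [z <= 1] the first smallness condition on [la] suffices; for [z > 1] the second does, because
   [z <= z^al = y]. *)
have laz : la / al * z <= (1 - r) / 2 + mu / 2 * y.
  have al0 : 0 < al by rewrite (lt_trans _ al1).
  have l1 : la / al <= (1 - r) / 2 by rewrite ler_pdivrMr// mulrC mulrA.
  have l2 : la / al <= mu / 2 by rewrite ler_pdivrMr// mulrC mulrA.
  have la'0 : 0 <= la / al by rewrite divr_ge0// ltW.
  have [z1|z1] := leP z 1.
    apply: le_trans (_ : la / al <= _); first by rewrite ler_piMr.
    by apply: le_trans l1 _; rewrite lerDl mulr_ge0// ?divr_ge0 ?ltW.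
  apply: le_trans (_ : mu / 2 * y <= _); last by rewrite lerDr divr_ge0//; lra.
  apply: ler_pM => //; first exact: ltW.
  by have := ler_powR (ltW z1) (ltW al1); rewrite powRr1 ?(ltW z0)// zy.
have Vy : V t * (1 + eta * y) = 1 by rewrite /V /y mulrA mulVf// gt_eqF.
have V0 : 0 < V t by rewrite invr_gt0.
rewrite /barrier tr; set p := t `^ (- r); set e := E t.
have p0 : 0 < p by rewrite powR_gt0.
have e0 : 0 < e by rewrite expR_gt0.
rewrite (_ : _ + _ = 2 / (1 - r) * e * V t * p *
   ((1 - r) - la / al * z + mu * y - eta * y * V t)); last first.
  rewrite /z tz /y; field.
  by rewrite !gt_eqF//; lra.
have Vy1 : eta * y * V t <= eta * y.
  have ey0 : 0 < eta * y by rewrite mulr_gt0.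
  have Vey : 0 < V t * (eta * y) by rewrite mulr_gt0.
  rewrite ler_piMr ?(ltW ey0)//.
  by move: Vy Vey; rewrite mulrDr mulr1; lra.
apply: (@le_trans _ _ (2 / (1 - r) * e * V t * p * ((1 - r) / 2 * (1 + eta * y)))).
  rewrite (_ : _ * (_ * _) = p * e * (V t * (1 + eta * y))); last first.
    by field; rewrite gt_eqF//; lra.
  by rewrite Vy mulr1.
apply: ler_wpM2l.
  by rewrite !mulr_ge0 ?invr_ge0 ?(ltW V0) ?(ltW p0) ?(ltW e0)//; lra.
have : (1 - r) / 2 * (eta * y) <= eta * y.
  by rewrite ler_piMl ?mulr_ge0 ?ltW//; lra.
by move: Vy1 laz; rewrite /eta; lra.
Qed.

Lemma barrier_cvg0 : barrier t @[t --> 0^'+] --> (0 : R).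
Proof.
have /andP[r0 r1] := r01; move: (mu0) (al1) (kap0) => mu0' al1' kap0'.
have h : 2 / (1 - r) * t `^ (1 - r) @[t --> 0^'+] --> (0 : R).
  rewrite -[X in _ --> X](mulr0 (2 / (1 - r))); apply: cvgMr.
  by apply: powR_cvg0; lra.
apply: (squeeze_cvgr _ (cvg_cst 0) h); near=> t.
have t0 : 0 < t by near: t; exact: nbhs_right_gt.
rewrite barrier_ge0 ?(ltW t0)//=; rewrite /barrier; apply: ler_wpM2l; first by rewrite divr_ge0//; lra.
have e1 : E t <= 1.
  by rewrite -expR0 ler_expR mulNr oppr_le0 !mulr_ge0 ?powR_ge0// ltW.
have xt : 0 <= eta * X * t.
  by rewrite mulr_ge0 ?(ltW t0)// mulr_ge0 ?powR_ge0// divr_ge0// ltW.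
have d1 : 0 < 1 + eta * X * t by lra.
have v1 : V t <= 1 by rewrite /V invf_le1// lerDl.
have v0 : 0 <= V t by rewrite invr_ge0 ltW.
rewrite -[leRHS]mul1r; apply: ler_pM; rewrite ?expR_ge0 ?mulr_ge0 ?powR_ge0//.
by rewrite ler_piMr ?powR_ge0.
Unshelve. all: by end_near. Qed.

Lemma nondecreasing_from_zero (h dh : R -> R) T :
  (forall s, 0 < s < T -> is_derive s (1 : R) h (dh s)) ->
  (forall s, 0 < s < T -> 0 <= dh s) ->
  h s @[s --> 0^'+] --> (0 : R) ->
  forall t, 0 < t < T -> 0 <= h t.
Proof.
move=> hd h0 hc t /andP[t0 tT].
apply: (cvgr_to_le hc); near=> s.
have s0 : 0 < s by near: s; exact: nbhs_right_gt.
have st : s < t by near: s; exact: nbhs_right_lt.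
have [] := @MVT _ h dh _ _ st.
- by move=> x; rewrite in_itv/= => /andP[sx xt]; apply: hd; lra.
- apply: derivable_within_continuous => x; rewrite in_itv/= => /andP[sx xt].
  by have [] := hd x ltac:(lra).
move=> x; rewrite in_itv/= => /andP[sx xt] hE.
rewrite -subr_ge0 hE mulr_ge0//; last by lra.
by apply: h0; lra.
Unshelve. all: by end_near. Qed.

(** [K barrier + w] and [K barrier - w], multiplied by the integrating factor [exp (mu X s)], are
    nondecreasing. They start from their limit 0 at [0+], the source being singular at time 0. *)
Lemma comparison (w dw : R -> R) T K :
  (forall s, 0 < s < T -> is_derive s (1 : R) w (dw s)) ->
  w s @[s --> 0^'+] --> (0 : R) ->
  (forall s, 0 < s < T -> `|dw s + mu * X * w s| <= K * (s `^ (- r) * E s)) ->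
  forall t, 0 < t < T -> `|w t| <= K * barrier t.
Proof.
move=> wd w0 wK t tT.
have [db dbP] : exists db : R -> R, forall s, 0 < s -> is_derive s (1 : R) barrier (db s) /\
    s `^ (- r) * E s <= db s + mu * X * barrier s.
  have h s : {d | 0 < s -> is_derive s (1 : R) barrier d /\
    s `^ (- r) * E s <= d + mu * X * barrier s}.
    apply: cid; have [s0|s0] := ltP 0 s; last by exists 0.
    by have [d hd] := barrier_super s0; exists d.
  by exists (fun s => sval (h s)) => s; exact: (svalP (h s)).
have K0 : 0 <= K.
  have := wK t tT; have p : 0 < t `^ (- r) * E t.
    by rewrite mulr_gt0 ?expR_gt0 ?powR_gt0//; lra.
  by move=> /(le_trans (normr_ge0 _)); rewrite pmulr_lge0.
have key (sg : R) : sg = 1 \/ sg = -1 -> 0 <= K * barrier t + sg * w t.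
  move=> sg1.
  pose h s := expR (mu * X * s) * (K * barrier s + sg * w s).
  pose dh s := expR (mu * X * s) * (K * (db s + mu * X * barrier s) +
      sg * (dw s + mu * X * w s)).
  suff : 0 <= h t by rewrite pmulr_rge0// expR_gt0.
  apply: (@nondecreasing_from_zero h dh T _ _ _ t tT).
  - move=> s /andP[s0 sT]; have [dbs _] := dbP s s0.
    have dws : is_derive s (1 : R) w (dw s) by apply: wd; rewrite s0.
    have d1 : is_derive s (1 : R) (fun s => mu * X * s) (mu * X).
      by apply: is_derive_eq; rewrite -[RHS]mulr1.
    have d2 : is_derive s (1 : R) (fun s => expR (mu * X * s)) (expR (mu * X * s) * (mu * X)).
      exact: (@is_derive1_comp _ (@expR R)).
    apply: is_derive_eq; rewrite /dh /GRing.scale/=.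
    by ring.
  - move=> s sT; rewrite /dh mulr_ge0 ?expR_ge0//.
    have [_ hb] := dbP s ltac:(lra); have hw := wK s sT.
    have hK := ler_wpM2l K0 hb.
    set q := dw s + _ in hw *.
    have : - `|q| <= sg * q.
      case: sg1 => ->; first by rewrite mul1r lerNl ler_normr lexx orbT.
      by rewrite mulN1r lerN2 ler_norm.
    lra.
  - rewrite /h -[X in _ --> X](mulr0 (expR (mu * X * 0))); apply: cvgM.
      apply: cvg_at_right_filter; apply: continuous_comp; last exact: continuous_expR.
      by apply: cvgMr; exact: cvg_id.
    rewrite -[X in _ --> X](addr0 0); apply: cvgD.
      by rewrite -[X in _ --> X](mulr0 K); apply: cvgMr; exact: barrier_cvg0.
    by rewrite -[X in _ --> X](mulr0 sg); apply: cvgMr.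
have h1 := key 1 (or_introl erefl); have h2 := key (-1) (or_intror erefl).
by rewrite ler_norml; lra.
Qed.

End comparison_principle.

(** * Integrals singular at the initial time, and the Duhamel formula *)

Section singular_integrals.
Context {R : realType}.
Notation leb := (@lebesgue_measure R).
Implicit Types (s t u K : R).

(** [f] may blow up at 0, so the fundamental theorem of calculus is used on [[u / (n + 1), u]] and
    followed by monotone convergence; [F >= 0] lets the lower boundary term be dropped. *)
Lemma ge0_integral_le_primitive (f F : R -> R) u : 0 < u ->
  (forall s, 0 < s -> {for s, continuous f}) -> (forall s, 0 < s -> 0 <= f s) ->
  (forall s, 0 < s -> is_derive s (1 : R) F (f s)) -> (forall s, 0 < s -> 0 <= F s) ->
  (\int[leb]_(x in `]0%R, u]) (f x)%:E <= (F u)%:E)%E.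
Proof.
move=> u0 cf f0 dF F0.
pose I (n : nat) : set R := `[u / n.+1%:R, u]%classic.
have mI n : measurable (I n : set (measurableTypeR R)) by exact: measurable_itv.
have un n : 0 < u / n.+1%:R by rewrite divr_gt0.
have UI : \bigcup_n I n = `]0%R, u]%classic.
  apply/seteqP; split => x /=.
    by move=> [n _]; rewrite /I /= !in_itv/= => /andP[h ->]; rewrite andbT (lt_le_trans (un n)).
  rewrite in_itv/= => /andP[x0 xu]; exists (Num.truncn (u / x)) => //.
  rewrite /I /= in_itv/= xu andbT ler_pdivrMr// mulrC -ler_pdivrMr//.
  by rewrite ltW// truncnS_gt.
have cfI n : {within I n, continuous f}.
  apply: continuous_in_subspaceT => x; rewrite inE /I /= in_itv/= => /andP[h _].
  by apply: cf; exact: lt_le_trans (un n) h.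
have mfI n : measurable_fun (I n) f.
  exact: (@subspace_continuous_measurable_fun _ (I n) f (mI n) (cfI n)).
have ndI : nondecreasing_seq I.
  move=> m n mn; rewrite subsetEset => x; rewrite /I /= !in_itv/= => /andP[h ->]; rewrite andbT.
  apply: le_trans h; rewrite ler_pM2l// lef_pV2 ?posrE//.
  by rewrite ler_nat.
have h : (\int[leb]_(x in I n) (f x)%:E @[n --> \oo] --> \int[leb]_(x in `]0%R, u]) (f x)%:E)%E.
  rewrite -UI; apply: ge0_nondecreasing_set_cvg_integral => //.
    by move=> n; apply/measurable_EFinP; exact: mfI.
  move=> n x; rewrite /I /= in_itv/= => /andP[hx _].
  by rewrite lee_fin f0// (lt_le_trans (un n)).
rewrite -(cvg_lim _ h)//; apply: lime_le; first by apply/cvg_ex; eexists; exact: h.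
apply: nearW => n.
case: n => [|n].
  rewrite /I divr1 set_itv1 integral_set1 lee_fin; exact: F0.
have lt1 : u / n.+2%:R < u by rewrite ltr_pdivrMr// ltr_pMr// ltr1n.
have cF (x : R) : 0 < x -> F s @[s --> x] --> F x.
  by move=> x0; have [+ _] := dF x x0; move=> /derivable1_diffP/differentiable_continuous.
rewrite (@continuous_FTC2 _ f F _ _ lt1)//.
- by rewrite lee_fin lerBlDr lerDl F0.
- exact: cfI.
- split.
  + by move=> x; rewrite in_itv/= => /andP[h1 _]; have [] := dF x (lt_trans (un _) h1).
  + by apply: cvg_at_right_filter; exact: cF.
  + by apply: cvg_at_left_filter; exact: cF.
- move=> x; rewrite in_itv/= => /andP[h1 _]; rewrite derive1E.
  by have [_ ->] := dF x (lt_trans (un _) h1).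
Qed.

Lemma measurable_fun_open_continuous (E D : set R) (f : R -> R) : open E -> D `<=` E ->
  {in E, continuous f} -> measurable_fun D f.
Proof.
move=> oE DE cf; apply: measurable_funS DE _; first exact: open_measurable.
exact: open_continuous_measurable_fun.
Qed.

Lemma ge0_measurable_on (f : R -> R) u :
  (forall s, 0 < s -> {for s, continuous f}) -> measurable_fun `]0%R, u]%classic f.
Proof.
move=> cf; apply: (@measurable_fun_open_continuous `]0, +oo[%classic).
- exact: interval_open.
- by move=> x /=; rewrite !in_itv/= => /andP[->].
- by move=> x; rewrite inE/= in_itv/= andbT; exact: cf.
Qed.

Lemma ge0_integrable_primitive (f F : R -> R) u : 0 < u ->
  (forall s, 0 < s -> {for s, continuous f}) -> (forall s, 0 < s -> 0 <= f s) ->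
  (forall s, 0 < s -> is_derive s (1 : R) F (f s)) -> (forall s, 0 < s -> 0 <= F s) ->
  leb.-integrable `]0, u] (EFin \o f).
Proof.
move=> u0 cf f0 dF F0; apply/integrableP; split.
  by apply/measurable_EFinP; exact: ge0_measurable_on.
apply: le_lt_trans (ltry (F u)).
apply: le_trans (ge0_integral_le_primitive u0 cf f0 dF F0).
rewrite le_eqVlt; apply/orP; left; apply/eqP; apply: eq_integral => x.
rewrite inE/= in_itv/= => /andP[x0 _].
by rewrite ger0_norm// f0.
Qed.

Lemma powR_continuous_pos (p s : R) : 0 < s -> {for s, continuous (fun x => x `^ p)}.
Proof.
by move=> s0; have [+ _] := is_derive_powR_pos p s0; move=> /derivable1_diffP/differentiable_continuous.
Qed.

Lemma powR_primitive r s : r < 1 -> 0 < s ->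
  is_derive s (1 : R) (fun s => (1 - r)^-1 * s `^ (1 - r)) (s `^ (- r)).
Proof.
move=> r1 s0; have r10 : 1 - r != 0 by rewrite gt_eqF// subr_gt0.
have h := is_derive_powR_pos (1 - r) s0.
apply: is_derive_eq; rewrite /GRing.scale/= mulKf//.
by congr (_ `^ _); ring.
Qed.

Lemma powR_integrable r u : r < 1 -> 0 < u ->
  leb.-integrable `]0, u] (EFin \o (fun s => s `^ (- r))) /\
  \int[leb]_(s in `]0, u]) (s `^ (- r)) <= (1 - r)^-1 * u `^ (1 - r).
Proof.
move=> r1 u0.
have c s : 0 < s -> {for s, continuous (fun x : R => x `^ (- r))} by exact: powR_continuous_pos.
have p s : 0 < s -> 0 <= s `^ (- r) by move=> _; exact: powR_ge0.
have d s : 0 < s -> is_derive s (1 : R) (fun s => (1 - r)^-1 * s `^ (1 - r)) (s `^ (- r)).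
  exact: powR_primitive.
have F0 s : 0 < s -> 0 <= (1 - r)^-1 * s `^ (1 - r).
  by move=> _; rewrite mulr_ge0 ?powR_ge0// invr_ge0 subr_ge0 ltW.
have I := ge0_integrable_primitive u0 c p d F0; split => //.
rewrite -lee_fin /Rintegral fineK; last exact: integrable_fin_num.
exact: (ge0_integral_le_primitive u0 c p d F0).
Qed.

(** The solution of [w' + x w = N] that tends to 0 at [0+]. Taking [exp (- x t)] out of the integral
    leaves an integrand independent of [t], which the fundamental theorem can differentiate. *)
Definition duhamel (x : R) (N : R -> R) t : R :=
  expR (- (x * t)) * \int[leb]_(s in `]0, t]) (expR (x * s) * N s).

Lemma duhamelP (x r K T : R) (N : R -> R) : 0 < T -> 0 <= x -> r < 1 ->
  (forall s, 0 < s < T -> {for s, continuous N}) ->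
  (forall s, 0 < s < T -> `|N s| <= K * s `^ (- r)) ->
  (forall t, 0 < t < T -> is_derive t (1 : R) (duhamel x N) (N t - x * duhamel x N t)) /\
  duhamel x N t @[t --> 0^'+] --> (0 : R).
Proof.
move=> T0 x0 r1 cN NK.
pose f s := expR (x * s) * N s.
have cexp (y : R) : continuous (fun s : R => expR (y * s)).
  by move=> s; apply: continuous_comp; [apply: cvgMr; exact: cvg_id|exact: continuous_expR].
have cf s : 0 < s < T -> {for s, continuous f}.
  by move=> sT; apply: cvgM; [exact: cexp|exact: cN].
have K0 s : 0 < s < T -> 0 <= K.
  move=> sT; have := NK s sT => /(le_trans (normr_ge0 _)); rewrite pmulr_lge0//.
  by rewrite powR_gt0//; lra.
have fK s : 0 < s < T -> `|f s| <= expR (x * T) * K * s `^ (- r).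
  move=> sT; rewrite normrM ger0_norm ?expR_ge0// -mulrA.
  apply: ler_pM => //; last exact: NK.
  by rewrite ler_expR ler_wpM2l//; lra.
have intf u : 0 < u < T -> leb.-integrable `]0, u] (EFin \o f).
  move=> /andP[u0 uT].
  have [I _] := powR_integrable r1 u0.
  have I2 : leb.-integrable `]0, u] (fun s => (expR (x * T) * K)%:E * (s `^ (- r))%:E)%E.
    exact: integrableZl.
  apply: le_integrable I2 => //.
  - apply/measurable_EFinP.
    apply: (@measurable_fun_open_continuous `]0, T[%classic).
    + exact: interval_open.
    + by move=> z /=; rewrite !in_itv/=; lra.
    + by move=> z; rewrite inE/= in_itv/=; exact: cf.
  - move=> s /=; rewrite in_itv/= => su; rewrite !lee_fin.
    by apply: le_trans (fK s ltac:(lra)) (ler_norm _).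
pose F t := \int[leb]_(s in `]0, t]) f s.
have Fle t : 0 < t < T -> `|F t| <= expR (x * T) * K * ((1 - r)^-1 * t `^ (1 - r)).
  move=> tT; have /andP[t0 tT'] := tT.
  have [I Ile] := powR_integrable r1 t0.
  apply: le_trans (le_normr_Rintegral _ (intf t tT)) _ => //.
  apply: (@le_trans _ _ (\int[leb]_(s in `]0, t]) (expR (x * T) * K * s `^ (- r)))).
    apply: le_Rintegral => //.
    - by have /integrable_norm := intf t tT.
    - by have : leb.-integrable `]0, t] (fun s => (expR (x * T) * K)%:E * (s `^ (- r))%:E)%E;
        first exact: integrableZl.
    - by move=> s /=; rewrite in_itv/= => sT; apply: fK; lra.
  rewrite RintegralZl//; apply: ler_wpM2l => //.
  by rewrite mulr_ge0 ?expR_ge0// (K0 t).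
split.
- move=> t tT; have /andP[t0 tT'] := tT.
  (* A point beyond [t] up to which [f] is integrable, so that [t] is interior to []0, u]]. *)
  pose u := (t + T) / 2.
  have tu : t < u by rewrite /u; lra.
  have uT : 0 < u < T by rewrite /u; lra.
  have a0t : (BRight 0 < BRight t)%O by rewrite bnd_simp.
  have [dF F'] := continuous_FTC1 tu (intf u uT) a0t (cf t tT).
  have hF : is_derive t (1 : R) F (f t).
    by apply: DeriveDef; [exact: dF|rewrite -derive1E; exact: F'].
  have d1 : is_derive t (1 : R) (fun s => - (x * s)) (- x).
    by apply: is_derive_eq; rewrite /GRing.scale/=; ring.
  have d2 : is_derive t (1 : R) (fun s => expR (- (x * s))) (expR (- (x * t)) * - x).
    exact: (@is_derive1_comp _ (@expR R)).
  rewrite /duhamel; apply: is_derive_eq.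
  have ee : expR (- (x * t)) * expR (x * t) = 1 by rewrite -expRD addNr expR0.
  rewrite /GRing.scale/= -/(F t) /f [X in X + _ = _](_ : _ = N t); first by ring.
  by rewrite mulrA ee mul1r.
- apply: norm_cvg0.
  have hz : expR (x * T) * K * ((1 - r)^-1 * t `^ (1 - r)) @[t --> 0^'+] --> (0 : R).
    rewrite -[X in _ --> X](mulr0 (expR (x * T) * K)); apply: cvgMr.
    rewrite -[X in _ --> X](mulr0 (1 - r)^-1); apply: cvgMr.
    by apply: powR_cvg0; rewrite subr_gt0.
  apply: (squeeze_cvgr _ (cvg_cst 0) hz); near=> t.
  have t0 : 0 < t by near: t; exact: nbhs_right_gt.
  have tT : t < T by near: t; exact: nbhs_right_lt.
  rewrite normr_ge0/= normrM ger0_norm ?expR_ge0//.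
  apply: le_trans (Fle t _); last by rewrite t0.
  by rewrite ler_piMl// -expR0 ler_expR oppr_le0 mulr_ge0// ltW.
Unshelve. all: by end_near. Qed.

End singular_integrals.

(** * Weighted bounds for the supersolution *)

Section weighted_barrier.
Context {R : realType}.
Variables (mu al la : R) (k : nat).
Hypotheses (mu0 : 0 < mu) (al2 : 5 / 2 < al) (la0 : 0 <= la) (k0 : (0 < k)%N).

Let r := 2 / al.

Definition weight (la' al' t : R) (j : nat) : R :=
  expR (la' * t `^ al'^-1 * j%:R) * (1 + t `^ al'^-1 * j%:R) ^+ 2.

(** The exponential weight cancels the factor [E] exactly; what remains is a quotient of powers of
    [t] and [k]. *)
Lemma barrier_expR (t : R) :
  expR (la * t `^ al^-1 * k%:R) * barrier mu al r la k%:R t =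
  2 / (1 - r) * (t `^ (1 - r) / (1 + mu / 4 * k%:R `^ al * t)).
Proof.
rewrite /barrier mulrCA; congr (_ * _); rewrite [LHS]mulrA -expRD.
by rewrite (_ : _ + _ = 0) ?expR0 ?mul1r//; ring.
Qed.

Let z (t : R) := t `^ al^-1 * k%:R.

Let eqs (t : R) : 0 < t -> [/\ 0 < al, 0 < k%:R :> R, 0 < z t, z t `^ al = k%:R `^ al * t & r < 1].
Proof.
move: (al2) => al2' t0.
have kp : 0 < k%:R :> R by rewrite ltr0n.
have ap : 0 < al by lra.
split => //.
- by rewrite mulr_gt0 ?powR_gt0.
- by rewrite /z powRM ?powR_ge0 ?(ltW kp)// -powRrM mulVf ?gt_eqF// powRr1 1?mulrC// ltW.
- by rewrite /r ltr_pdivrMr// mul1r; lra.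
Qed.

Let denom (t : R) : 0 < t ->
  1 + z t `^ al <= (1 + 4 / mu) * (1 + mu / 4 * k%:R `^ al * t).
Proof.
move=> t0; have [ap kp zp zal r1] := eqs t0.
rewrite -mulrA -zal; have y0 := powR_ge0 (z t) al; set y := _ `^ _ in y0 *.
rewrite [leRHS](_ : _ = 1 + y + 4 / mu + mu / 4 * y); last by field; rewrite gt_eqF.
have m4 : 0 < 4 / mu by rewrite divr_gt0.
have m5 : 0 <= mu / 4 * y by rewrite mulr_ge0// divr_ge0// ltW.
by lra.
Qed.

Let quot (t q : R) : 0 < t -> q <= 1 + z t `^ al ->
  q / (1 + mu / 4 * k%:R `^ al * t) <= 1 + 4 / mu.
Proof.
move=> t0 qz; have [ap kp zp zal r1] := eqs t0.
rewrite ler_pdivrMr ?(le_trans qz (denom t0))//.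
by rewrite ltr_pwDl// !mulr_ge0 ?powR_ge0 ?divr_ge0 ?ltW.
Qed.

(** With [z = t^(1/al) k], [t^(1 - r) = z^kp t^(1 - r - kp / al) k^(-kp)]. Up to a constant the
    denominator dominates [1 + z^al], which absorbs [(1 + z)^2 z^kp] because [2 + kp <= al]; the 4
    comes from the square. *)
Lemma barrier_weight (kp t : R) : 0 < kp <= al - 2 -> 0 < t ->
  weight la al t k * barrier mu al r la k%:R t <=
  2 / (1 - r) * (4 * (1 + 4 / mu)) * (t `^ (1 - r - kp / al) * k%:R `^ (- kp)).
Proof.
move=> /andP[kp0 kpa] t0; have [ap kP zp zal r1] := eqs t0.
have zk : t `^ (1 - r) = z t `^ kp * (t `^ (1 - r - kp / al) * k%:R `^ (- kp)).
  rewrite /z powRM ?powR_ge0 ?(ltW kP)// -powRrM mulrACA (mulrC al^-1).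
  rewrite -powRD; last by apply/implyP => _; rewrite gt_eqF.
  rewrite -powRD; last by apply/implyP => _; rewrite gt_eqF.
  by rewrite subrr powRr0 mulr1; congr (_ `^ _); ring.
rewrite /weight mulrAC barrier_expR -/(z t) -(mulrA (2 / (1 - r))) -(mulrA (2 / (1 - r))).
have c0 : 0 <= 2 / (1 - r) by rewrite divr_ge0// subr_ge0 ltW.
apply: ler_wpM2l => //.
rewrite {1}zk -/(z t).
set A := t `^ _ * k%:R `^ _; set V := (1 + _)^-1.
rewrite [leLHS](_ : _ = (1 + z t) ^+ 2 * z t `^ kp / 4 * V * (4 * A)); last by field.
rewrite [leRHS](_ : _ = (1 + 4 / mu) * (4 * A)); last by ring.
apply: ler_wpM2r; first by rewrite !mulr_ge0 ?powR_ge0.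
apply: quot => //.
have h1 : z t `^ kp <= 1 + z t `^ al by apply: powR_le1D; [exact: ltW|move: (al2); lra].
have h2 : z t `^ (2 + kp) <= 1 + z t `^ al by apply: powR_le1D; [exact: ltW|move: (al2); lra].
have h3 : z t `^ (2 + kp) = z t ^+ 2 * z t `^ kp.
  by rewrite powRD ?powR_mulrn ?ltW//; apply/implyP => _; rewrite gt_eqF.
rewrite h3 in h2; rewrite ler_pdivrMr//.
apply: (@le_trans _ _ ((2 + 2 * z t ^+ 2) * z t `^ kp)).
  apply: ler_wpM2r; first exact: powR_ge0.
  have := sqr_ge0 (1 - z t); rewrite -subr_ge0; lra.
by lra.
Qed.

(** Without the polynomial weight all [al - 2] spare powers of [z] can be traded for decay in [k].
    The exponent of [t] is then 0 and the bound is uniform in time. *)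
Lemma barrier_uniform (t : R) : 0 < t ->
  expR (la * t `^ al^-1 * k%:R) * barrier mu al r la k%:R t <=
  2 / (1 - r) * (1 + 4 / mu) * k%:R `^ (- (al - 2)).
Proof.
move=> t0; have [ap kP zp zal r1] := eqs t0.
have zk : t `^ (1 - r) = z t `^ (al - 2) * k%:R `^ (- (al - 2)).
  rewrite /z powRM ?powR_ge0 ?(ltW kP)// -powRrM -mulrA.
  rewrite -powRD; last by apply/implyP => _; rewrite gt_eqF.
  rewrite subrr powRr0 mulr1; congr (_ `^ _); rewrite /r; field.
  by rewrite gt_eqF.
rewrite barrier_expR -(mulrA (2 / (1 - r))).
have c0 : 0 <= 2 / (1 - r) by rewrite divr_ge0// subr_ge0 ltW.
apply: ler_wpM2l => //.
rewrite zk mulrAC; apply: ler_wpM2r; first exact: powR_ge0.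
by apply: quot => //; apply: powR_le1D; [exact: ltW|move: (al2); lra].
Qed.

End weighted_barrier.

(** * Uniform convergence of products and linear combinations *)

Section uniform_convergence.
Context {R : realType}.

Definition ucvg (T : Type) (F : set_system T) (f : T -> R -> R) (g : R -> R) :=
  forall e, 0 < e -> \forall t \near F, forall x, `|f t x - g x| <= e.

Lemma ucvgM (T : Type) (F : set_system T) {FF : Filter F} (f f' : T -> R -> R) (g g' : R -> R) C :
  (forall x, `|g x| <= C) -> (forall x, `|g' x| <= C) ->
  ucvg F f g -> ucvg F f' g' -> ucvg F (fun t x => f t x * f' t x) (fun x => g x * g' x).
Proof.
move=> gC g'C fg fg' e e0.
have C0 : 0 <= C by apply: le_trans (gC 0).
pose d := Num.min 1 (e / (2 * C + 1)).
have s0 : 0 < 2 * C + 1 by lra.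
have d0 : 0 < d by rewrite lt_min ltr01 divr_gt0.
have d1 : d <= 1 by rewrite ge_min lexx.
have de : d * (2 * C + 1) <= e by rewrite -ler_pdivlMr// ge_min lexx orbT.
near=> t => x.
have h : `|f t x - g x| <= d by move: (x); near: t; exact: fg.
have h' : `|f' t x - g' x| <= d by move: (x); near: t; exact: fg'.
rewrite (_ : _ - _ = (f t x - g x) * (f' t x - g' x) + (f t x - g x) * g' x + g x * (f' t x - g' x));
  last by ring.
have h1 : `|(f t x - g x) * (f' t x - g' x)| <= d * 1.
  by rewrite normrM; apply: ler_pM => //; exact: le_trans h' d1.
have h2 : `|(f t x - g x) * g' x| <= d * C by rewrite normrM; apply: ler_pM.
have h3 : `|g x * (f' t x - g' x)| <= C * d by rewrite normrM; apply: ler_pM.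
have := ler_normD ((f t x - g x) * (f' t x - g' x) + (f t x - g x) * g' x) (g x * (f' t x - g' x)).
have := ler_normD ((f t x - g x) * (f' t x - g' x)) ((f t x - g x) * g' x).
by move: h1 h2 h3 de; lra.
Unshelve. all: by end_near. Qed.

Lemma ucvg_lin (T : Type) (F : set_system T) {FF : Filter F} (f f' : T -> R -> R) (g g' : R -> R) (c c' : R) :
  ucvg F f g -> ucvg F f' g' -> ucvg F (fun t x => c * f t x + c' * f' t x) (fun x => c * g x + c' * g' x).
Proof.
move=> fg fg' e e0.
pose d := e / (`|c| + `|c'| + 1).
have s0 : 0 < `|c| + `|c'| + 1 by rewrite ltr_wpDl// addr_ge0.
have d0 : 0 < d by rewrite divr_gt0.
have de : d * (`|c| + `|c'| + 1) = e by rewrite divfK// gt_eqF.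
near=> t => x.
have h : `|f t x - g x| <= d by move: (x); near: t; exact: fg.
have h' : `|f' t x - g' x| <= d by move: (x); near: t; exact: fg'.
rewrite (_ : _ - _ = c * (f t x - g x) + c' * (f' t x - g' x)); last by ring.
have h1 : `|c * (f t x - g x)| <= `|c| * d by rewrite normrM; apply: ler_pM.
have h2 : `|c' * (f' t x - g' x)| <= `|c'| * d by rewrite normrM; apply: ler_pM.
have := ler_normD (c * (f t x - g x)) (c' * (f' t x - g' x)).
by move: h1 h2 de; lra.
Unshelve. all: by end_near. Qed.

End uniform_convergence.

(** * The quadratic nonlinearity in terms of coefficients *)

Section nonlinearity.
Context {R : realType}.
Variables (ca cb : R).
Implicit Types (u v w : bool -> nat -> R) (x t : R) (b : bool) (k j : nat) (K A B : R).

Definition kmul u b k : R := k%:R * u b k.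

(** Coefficients of a smooth function. The class is stable under [kmul] and [dxu], so that series of
    derivatives can be summed freely. *)
Definition fast u : Prop := forall j, exists K, sumu (fun b k => k%:R ^+ j * u b k) K.

Lemma fast_sum u : fast u -> exists K, sumu u K.
Proof.
move=> /(_ 0%N)[K uK]; exists K; apply: sumu_leW uK => b k _.
by rewrite expr0 mul1r.
Qed.

Lemma fast_kmul u : fast u -> fast (kmul u).
Proof.
move=> fu j; have [K uK] := fu j.+1; exists K; apply: sumu_leW uK => b k _.
by rewrite /kmul mulrA -exprSr.
Qed.

Lemma fast_dxu u : fast u -> fast (dxu u).
Proof.
move=> fu j; have [K uK] := fu j.+1; exists K => b.
apply: asum_leW (uK (~~ b)) => k _.
by case: b; rewrite /dxu/= ?mulrN ?normrN mulrA -exprSr.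
Qed.

Lemma fastB u v : fast u -> fast v -> fast (fun b k => u b k - v b k).
Proof.
move=> fu fv j; have [K uK] := fu j; have [L vL] := fv j; exists (K + L).
by apply: sumu_leW (sumuB uK vL) => b k _; rewrite mulrBr.
Qed.

(** The bilinear form behind [- (a B J_x + b J B_x)] with [J = - Lambda B]: the two signs cancel,
    and [kmul] is [Lambda] on coefficients. It has two arguments so that differences of solutions
    can be expanded. *)
Definition nonlin u v x : R :=
  ca * (trig u x * trig (dxu (kmul v)) x) + cb * (trig (kmul u) x * trig (dxu v) x).

Lemma fast_trig_continuous u : fast u -> continuous (trig u).
Proof. by move=> /fast_sum[K uK]; exact: trig_continuous uK. Qed.

Lemma nonlin_continuous u v : fast u -> fast v -> continuous (nonlin u v).
Proof.
move=> fu fv; apply: contD; apply: contZ; apply: contM; apply: fast_trig_continuous => //.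
- by apply: fast_dxu; exact: fast_kmul.
- exact: fast_kmul.
- exact: fast_dxu.
Qed.

Lemma nonlin_periodic u v : periodic (nonlin u v) (pi *+ 2).
Proof. by move=> x; rewrite /nonlin !trig_periodic. Qed.

Definition ncoef u v b k : R := coef (nonlin u v) b k.

Lemma trig_fastB u v x : fast u -> fast v ->
  trig (fun b k => u b k - v b k) x = trig u x - trig v x.
Proof. by move=> /fast_sum[K uK] /fast_sum[L vL]; exact: trigB uK vL. Qed.

Lemma kmulB u v : kmul (fun b k => u b k - v b k) = (fun b k => kmul u b k - kmul v b k).
Proof. by apply/funext => b; apply/funext => k; rewrite /kmul mulrBr. Qed.

Lemma dxuB u v : dxu (fun b k => u b k - v b k) = (fun b k => dxu u b k - dxu v b k).
Proof. by apply/funext => -[]; apply/funext => k; rewrite /dxu mulrBr ?opprB ?opprD// opprK addrC. Qed.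

Lemma ncoefB u v b k : fast u -> fast v ->
  ncoef u u b k - ncoef v v b k =
  ncoef (fun b k => u b k - v b k) u b k + ncoef v (fun b k => u b k - v b k) b k.
Proof.
move=> fu fv; have fw := fastB fu fv.
rewrite /ncoef -coefB; [|exact: nonlin_continuous..].
rewrite -coefD; [|exact: nonlin_continuous..].
apply: eq_coef => x; rewrite /nonlin kmulB !dxuB.
have ku := fast_kmul fu; have kv := fast_kmul fv.
have du := fast_dxu fu; have dv := fast_dxu fv.
have dku := fast_dxu ku; have dkv := fast_dxu kv.
rewrite (trig_fastB _ fu fv) (trig_fastB _ ku kv) (trig_fastB _ du dv) (trig_fastB _ dku dkv).
by ring.
Qed.

Variables (al la : R).
Hypotheses (al2 : 5 / 2 < al) (la0 : 0 <= la).

Lemma weight_ge1 t k : 0 < t -> 1 <= weight la al t k.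
Proof.
move=> t0; rewrite -[leLHS]mul1r; apply: ler_pM => //.
  by rewrite -expR0 ler_expR !mulr_ge0 ?powR_ge0.
rewrite exprn_ege1// lerDl mulr_ge0 ?powR_ge0//.
Qed.

(** A weighted l2 norm is at most [A], expressed by squares of partial sums: summability is part of
    the statement, and the bound survives coefficientwise limits. *)
Definition ebound t u A : Prop := forall n,
  psum (fun k => weight la al t k ^+ 2 * (u false k ^+ 2 + u true k ^+ 2)) n <= A ^+ 2.

Lemma ebound_term t u A b k : 0 <= A -> ebound t u A -> (0 < k)%N ->
  weight la al t k * `|u b k| <= A.
Proof.
move=> A0 uA k0.
have h : weight la al t k ^+ 2 * (u false k ^+ 2 + u true k ^+ 2) <= A ^+ 2.
  apply: le_trans (uA k.+1).
  apply: (@psum_term _ (fun k => weight la al t k ^+ 2 * (u false k ^+ 2 + u true k ^+ 2))) => // j _.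
  by rewrite mulr_ge0 ?sqr_ge0// addr_ge0 ?sqr_ge0.
have w0 : 0 <= weight la al t k by rewrite mulr_ge0 ?expR_ge0// sqr_ge0.
have wu0 := mulr_ge0 w0 (normr_ge0 (u b k)).
rewrite -(@ler_pXn2r _ 2%N) ?nnegrE//.
apply: le_trans h; rewrite exprMn real_normK ?num_real//.
apply: ler_wpM2l; first exact: sqr_ge0.
by case: (b);  rewrite ?lerDl ?lerDr sqr_ge0.
Qed.

Lemma ebound_le t u v A : (forall b k, (0 < k)%N -> `|u b k| <= `|v b k|) ->
  ebound t v A -> ebound t u A.
Proof.
move=> uv vA n; apply: le_trans (vA n); apply: le_psum => k k0.
apply: ler_wpM2l; first exact: sqr_ge0.
by apply: lerD; rewrite -(real_normK (num_real (u _ _))) -(real_normK (num_real (v _ _)))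
  ler_pXn2r ?nnegrE ?uv.
Qed.

Lemma ebound_leA t u A B : 0 <= A <= B -> ebound t u A -> ebound t u B.
Proof.
move=> /andP[A0 AB] uA n; apply: le_trans (uA n) _.
by rewrite ler_pXn2r ?nnegrE// (le_trans A0).
Qed.

(* Minkowski: (x + y)^2 <= (1 + B/A) x^2 + (1 + A/B) y^2. *)
Lemma eboundD t u v A B : 0 < A -> 0 < B -> ebound t u A -> ebound t v B ->
  ebound t (fun b k => u b k + v b k) (A + B).
Proof.
move=> A0 B0 uA vB n.
pose p := 1 + B / A; pose q := 1 + A / B.
have p0 : 0 < p by rewrite addr_gt0// divr_gt0.
have q0 : 0 < q by rewrite addr_gt0// divr_gt0.
have key (x y : R) : (x + y) ^+ 2 <= p * x ^+ 2 + q * y ^+ 2.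
  rewrite -subr_ge0 (_ : _ - _ = A / B * (B / A * x - y) ^+ 2).
    by rewrite mulr_ge0 ?sqr_ge0// divr_ge0 ?ltW.
  by rewrite /p /q; field; rewrite !gt_eqF.
apply: (@le_trans _ _ (p * A ^+ 2 + q * B ^+ 2)); last first.
  by rewrite le_eqVlt; apply/orP; left; apply/eqP; rewrite /p /q; field; rewrite !gt_eqF.
apply: le_trans (_ : p * psum (fun k => weight la al t k ^+ 2 * (u false k ^+ 2 + u true k ^+ 2)) n +
  q * psum (fun k => weight la al t k ^+ 2 * (v false k ^+ 2 + v true k ^+ 2)) n <= _); last first.
  by apply: lerD; rewrite ler_pM2l// ?uA ?vB.
rewrite -!psumZ -psumD; apply: le_psum => k _.
rewrite [leRHS](_ : _ = weight la al t k ^+ 2 * ((p * u false k ^+ 2 + q * v false k ^+ 2) +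
  (p * u true k ^+ 2 + q * v true k ^+ 2))); last by ring.
by apply: ler_wpM2l; [exact: sqr_ge0|apply: lerD; exact: key].
Qed.

(** Lower semicontinuity of the norm: each partial sum depends continuously on finitely many
    coefficients. *)
Lemma ebound_lim (T : Type) (F : set_system T) {FF : ProperFilter F}
    (u : T -> bool -> nat -> R) v t A :
  (forall b k, (0 < k)%N -> u s b k @[s --> F] --> v b k) ->
  (\forall s \near F, ebound t (u s) A) -> ebound t v A.
Proof.
move=> uv uA n.
have h : psum (fun k => weight la al t k ^+ 2 * (u s false k ^+ 2 + u s true k ^+ 2)) n @[s --> F] -->
    psum (fun k => weight la al t k ^+ 2 * (v false k ^+ 2 + v true k ^+ 2)) n.
  apply: (@cvg_psum _ _ F _ (fun s k => weight la al t k ^+ 2 * (u s false k ^+ 2 + u s true k ^+ 2))).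
  move=> k k0; apply: cvgMr; apply: cvgD; apply: cvgM; exact: uv.
refine (cvgr_to_le h _); near=> s.
have : ebound t (u s) A by near: s.
by [].
Unshelve. all: by end_near. Qed.

Let tau t := la * t `^ al^-1.

Lemma coef_nonlin u v A B b k t : 0 < t -> 0 < A -> 0 < B ->
  fast u -> fast v -> ebound t u A -> ebound t v B ->
  expR (la * t `^ al^-1 * k%:R) * `|ncoef u v b k| <=
    3 * (`|ca| + `|cb|) * (A * B) * t `^ (- (2 / al)).
Proof.
move=> t0 A0 B0 fu fv uA vB.
have ap : 0 < al by move: (al2); lra.
pose s := t `^ al^-1.
have s0 : 0 < s by rewrite powR_gt0.
have tau0 : 0 <= la * s by rewrite mulr_ge0// ltW.
have s2 : t `^ (- (2 / al)) = s^-1 ^+ 2.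
  rewrite mulrC powRN powRrM powR_mulrn ?powR_ge0// -exprVn//.
have wE (j : nat) : weight la al t j = expR (la * s * j%:R) * (1 + s * j%:R) ^+ 2 by [].
have sj (j : nat) : 0 <= s * j%:R by rewrite mulr_ge0// ltW.
have e2 (j : nat) : 0 <= expR (la * s * j%:R) ^+ 2 by exact: sqr_ge0.
have w_e (j : nat) (y c : R) : 0 <= y -> 0 <= c -> c <= (1 + s * j%:R) ^+ 4 ->
    expR (la * s * j%:R) ^+ 2 * (c * y) <= weight la al t j ^+ 2 * y.
  move=> y0 c0 hc; rewrite wE exprMn -[leRHS]mulrA; apply: ler_wpM2l => //.
  by rewrite -exprM; apply: ler_wpM2r.
(* The squared weight contains [(1 + s k)^4], which pays for the squares of zero, one and two
   derivatives; each derivative costs a factor [s^-1]. *)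
have p4 (j : nat) : [/\ 1 <= (1 + s * j%:R) ^+ 4, s ^+ 2 * j%:R ^+ 2 <= (1 + s * j%:R) ^+ 4 &
    s ^+ 4 * j%:R ^+ 4 <= (1 + s * j%:R) ^+ 4].
  have := sj j; rewrite -!exprMn; set y := s * j%:R => y0.
  have y1 : 1 <= 1 + y by lra.
  split; first exact: exprn_ege1.
    apply: le_trans (_ : (1 + y) ^+ 2 <= _); first by rewrite ler_pXn2r// ?nnegrE; lra.
    by rewrite ler_weXn2l.
  by rewrite ler_pXn2r// ?nnegrE; lra.
have hu : forall n, psum (fun m => expR (la * s * m%:R) ^+ 2 * (u false m ^+ 2 + u true m ^+ 2)) n <= A ^+ 2.
  move=> n; apply: le_trans (uA n); apply: le_psum => j _.
  have [h _ _] := p4 j; rewrite -[X in _ * X <= _]mul1r; apply: w_e => //.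
  by rewrite addr_ge0 ?sqr_ge0.
have hku w C : ebound t w C ->
   forall n, psum (fun m => expR (la * s * m%:R) ^+ 2 * (kmul w false m ^+ 2 + kmul w true m ^+ 2)) n <= (s^-1 * C) ^+ 2.
  move=> wC n; rewrite exprMn; apply: le_trans (_ : s^-1 ^+ 2 * psum (fun k => weight la al t k ^+ 2 *
     (w false k ^+ 2 + w true k ^+ 2)) n <= _); last first.
    by apply: ler_wpM2l => //; exact: sqr_ge0.
  rewrite -psumZ; apply: le_psum => j _.
  have [_ h _] := p4 j; have := w_e j (w false j ^+ 2 + w true j ^+ 2) _ _ _ h => hh.
  rewrite [leRHS]mulrC -ler_pdivrMr ?exprn_gt0 ?invr_gt0//.
  rewrite [leLHS](_ : _ = expR (la * s * j%:R) ^+ 2 * (s ^+ 2 * j%:R ^+ 2 * (w false j ^+ 2 + w true j ^+ 2))).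
    by apply: hh; [apply: addr_ge0; exact: sqr_ge0|apply: mulr_ge0; exact: sqr_ge0].
  by rewrite /kmul; field; rewrite gt_eqF.
have hdu w C : ebound t w C ->
   forall n, psum (fun m => expR (la * s * m%:R) ^+ 2 * (dxu w false m ^+ 2 + dxu w true m ^+ 2)) n <= (s^-1 * C) ^+ 2.
  move=> wC n; apply: le_trans (hku w C wC n); apply: le_psum => j _.
  by rewrite /dxu /kmul sqrrN addrC.
have hdku : forall n, psum (fun m => expR (la * s * m%:R) ^+ 2 *
    (dxu (kmul v) false m ^+ 2 + dxu (kmul v) true m ^+ 2)) n <= (s^-1 ^+ 2 * B) ^+ 2.
  move=> n; rewrite exprMn; apply: le_trans (_ : s^-1 ^+ 2 ^+ 2 * psum (fun k => weight la al t k ^+ 2 *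
     (v false k ^+ 2 + v true k ^+ 2)) n <= _); last first.
    by apply: ler_wpM2l => //; exact: sqr_ge0.
  rewrite -psumZ; apply: le_psum => j _.
  have [_ _ h] := p4 j; have := w_e j (v false j ^+ 2 + v true j ^+ 2) _ _ _ h => hh.
  rewrite [leRHS]mulrC -ler_pdivrMr ?exprn_gt0 ?invr_gt0//.
  rewrite [leLHS](_ : _ = expR (la * s * j%:R) ^+ 2 * (s ^+ 4 * j%:R ^+ 4 * (v false j ^+ 2 + v true j ^+ 2))).
    by apply: hh; [apply: addr_ge0; exact: sqr_ge0|apply: mulr_ge0; apply: exprn_ge0 => //; exact: ltW].
  by rewrite /dxu /kmul; field; rewrite gt_eqF.
have ku := fast_kmul fu; have kv := fast_kmul fv.
have dv := fast_dxu fv; have dkv := fast_dxu kv.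
have [K1 S1] := fast_sum fu; have [K2 S2] := fast_sum ku.
have [K3 S3] := fast_sum dkv; have [K4 S4] := fast_sum dv.
have si0 : 0 < s^-1 by rewrite invr_gt0.
have P1 := coef_prod b k tau0 A0 (mulr_gt0 (exprn_gt0 2 si0) B0) S1 S3 hu hdku.
have P2 := coef_prod b k tau0 (mulr_gt0 si0 A0) (mulr_gt0 si0 B0) S2 S4 (hku _ _ uA) (hdu _ _ vB).
have c1 : continuous (fun x => trig u x * trig (dxu (kmul v)) x).
  by apply: contM; exact: fast_trig_continuous.
have c2 : continuous (fun x => trig (kmul u) x * trig (dxu v) x).
  by apply: contM; exact: fast_trig_continuous.
rewrite /ncoef /nonlin coefD; [|exact: contZ|exact: contZ].
rewrite !coefZ// s2 -/s.
move: P1 P2; set e := expR _; set n1 := coef _ b k; set n2 := coef _ b k => P1 P2.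
have e0 : 0 <= e by exact: expR_ge0.
apply: le_trans (ler_wpM2l e0 (ler_normD _ _)) _.
rewrite !normrM mulrDr mulrCA [X in _ + X]mulrCA.
apply: (@le_trans _ _ (`|ca| * (3 * (A * (s^-1 ^+ 2 * B))) + `|cb| * (3 * (s^-1 * A * (s^-1 * B))))).
  by apply: lerD; apply: ler_wpM2l.
by rewrite le_eqVlt; apply/orP; left; apply/eqP; ring.
Qed.

Lemma ucvg_trig (T : Type) (F : set_system T) {FF : Filter F}
    (u : T -> bool -> nat -> R) v (g : nat -> R) K :
  asum_le g K ->
  (forall b k, (0 < k)%N -> `|v b k| <= g k) ->
  (\forall s \near F, forall b k, (0 < k)%N -> `|u s b k| <= g k) ->
  (forall b k, (0 < k)%N -> u s b k @[s --> F] --> v b k) ->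
  ucvg F (fun s => trig (u s)) (trig v).
Proof.
move=> gK vg ug uv e e0.
have gsum w : (forall b k, (0 < k)%N -> `|w b k| <= g k) -> sumu w K.
  by move=> wg b; apply: asum_leW gK => k k0; rewrite (le_trans (wg _ _ k0))// ler_norm.
have h : norm1 (fun b k => u s b k - v b k) @[s --> F] --> (0 : R) by exact: norm1_cvg0 gK vg ug uv.
have /cvgrPdist_le/(_ _ e0) h' := h.
near=> s => x.
have ut : forall b k, (0 < k)%N -> `|u s b k| <= g k by near: s.
rewrite -(trigB _ (gsum _ ut) (gsum _ vg)).
apply: le_trans (trig_norm1 _ (sumuB (gsum _ ut) (gsum _ vg))) _.
have : `|0 - norm1 (fun b k => u s b k - v b k)| <= e by near: s.
by rewrite sub0r normrN; apply: le_trans; exact: ler_norm.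
Unshelve. all: by end_near. Qed.

(* The decay k^-4 is what makes the series of the second derivative converge. *)
Lemma ncoef_cvg (T : Type) (F : set_system T) {FF : Filter F}
    (u : T -> bool -> nat -> R) v (C : R) b k :
  fast v -> (\forall s \near F, fast (u s)) ->
  (forall b k, (0 < k)%N -> `|v b k| <= C * k%:R ^- 4) ->
  (\forall s \near F, forall b k, (0 < k)%N -> `|u s b k| <= C * k%:R ^- 4) ->
  (forall b k, (0 < k)%N -> u s b k @[s --> F] --> v b k) ->
  ncoef (u s) (u s) b k @[s --> F] --> ncoef v v b k.
Proof.
move=> fv fu vC uC uv.
have [K2 hK2] := @asum_pow2 R.
pose g (j : nat) := C * j%:R ^- 2.
have gK : asum_le g (`|C| * K2) by exact: asum_leZ.
have C0 : 0 <= C.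
  by have := vC false 1%N isT; rewrite expr1n invr1 mulr1; apply: le_trans.
have pow (m j : nat) (y : R) : (0 < j)%N -> (m <= 2)%N -> `|y| <= C * j%:R ^- 4 -> `|j%:R ^+ m * y| <= g j.
  move=> j0 m2 hy; have jp : 0 < j%:R :> R by rewrite ltr0n.
  rewrite normrM ger0_norm ?exprn_ge0//.
  apply: le_trans (ler_wpM2l (exprn_ge0 m (ltW jp)) hy) _.
  rewrite /g mulrCA; apply: ler_wpM2l => //.
  rewrite (_ : 4%N = (2 + 2)%N)// exprD invfM mulrA ler_piMl ?invr_ge0 ?exprn_ge0//.
  rewrite ler_pdivrMr ?exprn_gt0// mul1r ler_weXn2l// ler1n//.
(* The four series entering [nonlin] are treated at once: each operator multiplies by [j^m] with
   [m <= 2], up to a sign and an exchange of the two families. *)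
have gen (D : (bool -> nat -> R) -> bool -> nat -> R) (m : nat) (sg : bool -> bool) (c : bool -> R) :
    (m <= 2)%N -> (forall b', `|c b'| = 1) ->
    (forall w b' j, D w b' j = c b' * (j%:R ^+ m * w (sg b') j)) ->
    ucvg F (fun s => trig (D (u s))) (trig (D v)).
  move=> m2 c1 DE; apply: (ucvg_trig gK).
  - by move=> b' j j0; rewrite DE normrM c1 mul1r; apply: pow => //; exact: vC.
  - near=> s => b' j j0; rewrite DE normrM c1 mul1r; apply: pow => //.
    by move: (sg b') (j) (j0); near: s.
  - move=> b' j j0; under eq_fun do rewrite DE; rewrite DE.
    by apply: cvgMr; apply: cvgMr; exact: uv.
have U0 : ucvg F (fun s => trig (u s)) (trig v).
  apply: (gen id 0%N id (fun=> 1)) => // [b'|w b' j]; first by rewrite normr1.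
  by rewrite expr0 !mul1r.
have U1 : ucvg F (fun s => trig (kmul (u s))) (trig (kmul v)).
  apply: (gen kmul 1%N id (fun=> 1)) => // [b'|w b' j]; first by rewrite normr1.
  by rewrite expr1 !mul1r.
have U2 : ucvg F (fun s => trig (dxu (u s))) (trig (dxu v)).
  apply: (gen dxu 1%N negb (fun b' => if b' then -1 else 1)) => // [b'|w b' j].
    by case: b'; rewrite ?normrN normr1.
  by case: b'; rewrite /dxu expr1/= ?mulN1r ?mul1r.
have U3 : ucvg F (fun s => trig (dxu (kmul (u s)))) (trig (dxu (kmul v))).
  apply: (gen (fun w => dxu (kmul w)) 2%N negb (fun b' => if b' then -1 else 1)) => // [b'|w b' j].
    by case: b'; rewrite ?normrN normr1.
  by case: b'; rewrite /dxu /kmul/= ?mulN1r ?mul1r expr2 mulrA.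
have kv := fast_kmul fv; have dv := fast_dxu fv; have dkv := fast_dxu kv.
have bd w : fast w -> exists L, forall x, `|trig w x| <= L.
  by move=> /fast_sum[L wL]; exists (L + L) => x; exact: trig_bound.
have [L0 B0] := bd _ fv; have [L1 B1] := bd _ kv; have [L2 B2] := bd _ dv; have [L3 B3] := bd _ dkv.
pose L := Num.max (Num.max L0 L1) (Num.max L2 L3).
have LE : [/\ L0 <= L, L1 <= L, L2 <= L & L3 <= L] by rewrite !le_max !lexx ?orbT.
have [E0 E1 E2 E3] := LE.
apply: coef_uniform.
- by near=> s; apply: nonlin_continuous; near: s.
- exact: nonlin_continuous.
- apply: ucvg_lin; (apply: (@ucvgM _ _ _ _ _ _ _ _ L) => //) => x.
  + exact: le_trans (B0 x) E0.
  + exact: le_trans (B3 x) E3.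
  + exact: le_trans (B1 x) E1.
  + exact: le_trans (B2 x) E2.
Unshelve. all: by end_near. Qed.

(** The inequality [y <= exp y] at [y = x / n], raised to the power [n]. *)
Lemma exp_ge_pow n (x : R) : 0 <= x -> (0 < n)%N -> x ^+ n <= n%:R ^+ n * expR x.
Proof.
move=> x0 n0; have np : 0 < n%:R :> R by rewrite ltr0n.
rewrite -ler_pdivrMl ?exprn_gt0// -exprVn -exprMn.
apply: le_trans (_ : expR (n%:R^-1 * x) ^+ n <= _).
  rewrite ler_pXn2r ?nnegrE ?expR_ge0 ?mulr_ge0 ?invr_ge0 ?(ltW np)//.
  by apply: le_trans (expR_ge1Dx _); rewrite lerDr.
by rewrite -expRM_natl mulrA mulfV ?mul1r// gt_eqF.
Qed.

(** For [t >= t0] the weight is at least [exp (c k)] with [c = la t0^(1/al)], which beats every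
    power of [k] with a constant independent of [t]. The power [j + 1] is used because [exp_ge_pow]
    asks for a positive exponent. *)
Lemma ebound_decay (t0 A : R) (j : nat) : 0 < la -> 0 < t0 -> 0 <= A ->
  exists C, 0 <= C /\ forall t u, t0 <= t -> ebound t u A ->
    forall b k, (0 < k)%N -> `|u b k| <= C * k%:R ^- j.
Proof.
move=> lap t00 A0; pose c := la * t0 `^ al^-1.
have c0 : 0 < c by rewrite mulr_gt0 ?powR_gt0.
exists (A * (j.+1%:R ^+ j.+1 / c ^+ j.+1)).
have D0 : 0 <= j.+1%:R ^+ j.+1 / c ^+ j.+1.
  by rewrite divr_ge0 ?exprn_ge0// ltW.
split; first by rewrite mulr_ge0.
move=> t u tt0 uA b k k0.
have kp : 0 < k%:R :> R by rewrite ltr0n.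
have tp : 0 < t by lra.
have h := ebound_term b A0 uA k0.
have h2 : expR (c * k%:R) * `|u b k| <= A.
  apply: le_trans h; apply: ler_wpM2r => //.
  rewrite -[leLHS]mulr1; apply: ler_pM => //.
    rewrite ler_expR; apply: ler_wpM2r; first exact: ltW.
    apply: ler_wpM2l => //; apply: ge0_ler_powR; rewrite ?nnegrE ?invr_ge0 ?(ltW tp) ?(ltW t00)//.
    by move: (al2); lra.
  by rewrite exprn_ege1// lerDl mulr_ge0 ?powR_ge0.
have h3 := exp_ge_pow (mulr_ge0 (ltW c0) (ltW kp)) (ltn0Sn j).
rewrite exprMn -ler_pdivlMl ?exprn_gt0// in h3.
have h4 : k%:R ^+ j <= k%:R ^+ j.+1 :> R by rewrite ler_weXn2l// ler1n.
rewrite ler_pdivlMr ?exprn_gt0//.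
apply: le_trans (ler_wpM2l (normr_ge0 _) (le_trans h4 h3)) _.
rewrite [leLHS](_ : _ = j.+1%:R ^+ j.+1 / c ^+ j.+1 * (expR (c * k%:R) * `|u b k|)); last by ring.
by rewrite [leRHS]mulrC; apply: ler_wpM2l.
Qed.

Lemma ebound_fast t u A : 0 < la -> 0 < t -> 0 <= A -> ebound t u A -> fast u.
Proof.
move=> lap t0 A0 uA j.
have [C [C0 hC]] := @ebound_decay t A (j + 2)%N lap t0 A0.
have [K2 hK2] := @asum_pow2 R.
exists (`|C| * K2) => b; apply: asum_leW (asum_leZ C hK2) => k k0.
have kp : 0 < k%:R :> R by rewrite ltr0n.
rewrite normrM ger0_norm ?exprn_ge0 ?(ltW kp)//.
apply: le_trans (ler_wpM2l (exprn_ge0 j (ltW kp)) (hC t u (lexx t) uA b k k0)) _.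
rewrite [X in _ <= X]ger0_norm; last by rewrite mulr_ge0// invr_ge0 exprn_ge0// ltW.
by rewrite exprD invfM mulrCA mulVKf// expf_neq0// gt_eqF.
Qed.

End nonlinearity.

(** * Choice of the exponents, and the linear estimates *)

Section linear_estimates.
Context {R : realType}.
Variables (mu al : R).
Hypotheses (mu0 : 0 < mu) (al2 : 5 / 2 < al).
Implicit Types (t s T K A B M : R) (b : bool) (k n : nat).

Let r := 2 / al.

(** Since [al > 1], this value meets both smallness conditions on [la] in the comparison
    principle. *)
Definition rate : R := Num.min ((1 - r) / 2) (mu / 2).

(** The midpoint of [1 / 2] and [al - 2]: above the first, the squares of [k^(-decay_exp)] are
    summable; below the second, a positive power of [t] is left. *)
Definition decay_exp : R := (al - 3 / 2) / 2.

(** The power of [t] left by [barrier_weight], equal to [(al - 2 - decay_exp) / al]. *)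
Definition gain : R := 1 - r - decay_exp / al.

Lemma exponent_facts : [/\ 0 < al, 0 <= r, r < 1, 1 / 2 < decay_exp < al - 2 & 0 < gain].
Proof.
move: (al2) => al2'; have ap : 0 < al by lra.
split => //.
- by rewrite divr_ge0// ltW.
- by rewrite /r ltr_pdivrMr// mul1r; lra.
- by rewrite /decay_exp; lra.
- rewrite /gain /r /decay_exp -addrA -opprD -mulrDl subr_gt0 ltr_pdivrMr// mul1r; lra.
Qed.

Lemma rate_facts : [/\ 0 < rate, rate <= al * (1 - r) / 2 & rate <= al * mu / 2].
Proof.
have [ap r0 r1 _ _] := exponent_facts; move: (mu0) (al2) => mu0' al2'.
have h1 : rate <= (1 - r) / 2 by rewrite ge_min lexx.
have h2 : rate <= mu / 2 by rewrite ge_min lexx orbT.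
split.
- by rewrite lt_min; apply/andP; split; lra.
- apply: le_trans h1 _; rewrite -mulrA ler_peMl//; lra.
- apply: le_trans h2 _; rewrite -mulrA ler_peMl//; lra.
Qed.

(** Comparison mode by mode, then [barrier_weight] at [decay_exp] and summation of the squares. The
    constant is uniform for [la] in [[0, rate]]: existence takes [la = rate] and uniqueness
    [la = 0]. The barrier bound is kept as a second conclusion because it describes single modes as
    [t] tends to 0. *)
Lemma linear_gain : exists C, 0 < C /\ forall la T K (w dw : R -> bool -> nat -> R),
  0 <= la <= rate -> 0 <= K ->
  (forall b k, (0 < k)%N -> forall s, 0 < s < T -> is_derive s (1 : R) (fun s => w s b k) (dw s b k)) ->
  (forall b k, (0 < k)%N -> w s b k @[s --> 0^'+] --> (0 : R)) ->
  (forall b k, (0 < k)%N -> forall s, 0 < s < T ->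
     expR (la * s `^ al^-1 * k%:R) * `|dw s b k + mu * k%:R `^ al * w s b k| <= K * s `^ (- r)) ->
  forall t, 0 < t < T -> ebound al la t (w t) (C * K * t `^ gain) /\
    forall b k, (0 < k)%N -> `|w t b k| <= K * barrier mu al r la k%:R t.
Proof.
have [ap r0 r1 /andP[kp1 kp2] g0] := exponent_facts; have [ra0 ra1 ra2] := rate_facts.
have s1 : 1 < decay_exp + decay_exp by lra.
have [S hS] := asum_powR s1; have S0 : 0 <= S := asum_le_ge0 hS.
pose C1 := 2 / (1 - r) * (4 * (1 + 4 / mu)).
have C10 : 0 < C1.
  by rewrite !mulr_gt0 ?invr_gt0 ?subr_gt0// addr_gt0// divr_gt0.
(* [(1 + 2 S)^2] exceeds the [2 S] produced by the two families, which avoids a square root. *)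
exists (C1 * (1 + 2 * S)); split; first by rewrite mulr_gt0//; lra.
move=> la T K w dw /andP[la0 lar] K0 wd w0 wK t tT.
have t0 : 0 < t by lra.
have cmp b k : (0 < k)%N -> `|w t b k| <= K * barrier mu al r la k%:R t.
  move=> k0; have kp : 0 < k%:R :> R by rewrite ltr0n.
  apply: (@comparison _ mu al r la k%:R _ _ _ _ _ _ _ (fun s => w s b k) (fun s => dw s b k) T K) => //.
  - by move: (al2); lra.
  - by rewrite r0.
  - exact: le_trans ra1.
  - exact: le_trans ra2.
  - exact: wd.
  - exact: w0.
  - move=> s sT; have := wK b k k0 s sT.
    rewrite -ler_pdivlMl ?expR_gt0// => h; apply: le_trans h _.
    rewrite -expRN [leLHS]mulrC -[leLHS]mulrA le_eqVlt; apply/orP; left; apply/eqP.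
    by congr (_ * (_ * expR _)); ring.
split => // n.
have term k : (0 < k)%N -> weight la al t k ^+ 2 * (w t false k ^+ 2 + w t true k ^+ 2) <=
    2 * (K * C1 * t `^ gain) ^+ 2 * `|k%:R `^ (- (decay_exp + decay_exp))|.
  move=> k0.
  have wb := @barrier_weight R mu al la k mu0 al2 k0 decay_exp t ltac:(lra) t0.
  have w_ge0 : 0 <= weight la al t k by rewrite mulr_ge0 ?expR_ge0// sqr_ge0.
  have one b : (weight la al t k * `|w t b k|) ^+ 2 <= (K * C1 * t `^ gain) ^+ 2 * `|k%:R `^ (- (decay_exp + decay_exp))|.
    have -> : `|k%:R `^ (- (decay_exp + decay_exp))| = (k%:R `^ (- decay_exp)) ^+ 2 :> R.
      rewrite ger0_norm ?powR_ge0// opprD powRD ?expr2//.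
      by apply/implyP => _; rewrite pnatr_eq0 -lt0n.
    rewrite -exprMn.
    have h0 := mulr_ge0 w_ge0 (normr_ge0 (w t b k)).
    have h : weight la al t k * `|w t b k| <= K * C1 * t `^ gain * k%:R `^ (- decay_exp).
      apply: le_trans (ler_wpM2l w_ge0 (cmp b k k0)) _.
      rewrite mulrCA -!(mulrA K); apply: ler_wpM2l => //.
      by rewrite -mulrA.
    by rewrite ler_pXn2r ?nnegrE//; exact: le_trans h0 h.
  have h1 := one false; have h2 := one true.
  rewrite !exprMn !real_normK ?num_real// in h1 h2.
  rewrite -!exprMn in h1 h2.
  rewrite mulrDr; move: h1 h2; rewrite !exprMn; lra.
apply: le_trans (_ : 2 * (K * C1 * t `^ gain) ^+ 2 * S <= _).
  apply: le_trans (le_psum _ term) _; rewrite psumZ.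
  by apply: ler_wpM2l; rewrite ?hS// mulr_ge0// sqr_ge0.
rewrite [leRHS](_ : _ = (K * C1 * t `^ gain) ^+ 2 * (1 + 2 * S) ^+ 2); last by ring.
rewrite mulrAC mulrC; apply: ler_wpM2l; first exact: sqr_ge0.
by have := sqr_ge0 S; lra.
Qed.

Definition heat (u0 : bool -> nat -> R) t b k : R := expR (- (mu * k%:R `^ al * t)) * u0 b k.

(** With [z = t^(1/al) k] and [y = z^al], one half of [exp (- mu y)] absorbs [exp (rate z)], as
    [rate <= mu / 2] and [z <= 1 + y]; the other half absorbs [(1 + z)^2 <= 4 (1 + y)]. *)
Lemma weight_heat : exists C, 1 <= C /\ forall t k, 0 < t -> (0 < k)%N ->
  weight rate al t k * expR (- (mu * k%:R `^ al * t)) <= C.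
Proof.
have [ap r0 r1 kp g0] := exponent_facts; have [ra0 ra1 ra2] := rate_facts.
have m2 : 0 < 2 / mu by rewrite divr_gt0.
exists (expR rate * (4 * (1 + 2 / mu))); split.
  rewrite -[leLHS]mulr1; apply: ler_pM => //; last by lra.
  by rewrite -expR0 ler_expR ltW.
move=> t k t0 k0; have kp0 : 0 < k%:R :> R by rewrite ltr0n.
pose z := t `^ al^-1 * k%:R.
have z0 : 0 < z by rewrite mulr_gt0 ?powR_gt0.
have zal : z `^ al = k%:R `^ al * t.
  by rewrite /z powRM ?powR_ge0 ?(ltW kp0)// -powRrM mulVf ?gt_eqF// powRr1 1?mulrC// ltW.
pose y := z `^ al; have y0 : 0 < y by rewrite powR_gt0.
have hz (q : R) : 0 <= q <= al -> z `^ q <= 1 + y by move=> hq; apply: powR_le1D => //; exact: ltW.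
have z1 : z <= 1 + y.
  by have := hz 1; rewrite powRr1 ?(ltW z0)//; apply; move: (al2); lra.
have z2 : z ^+ 2 <= 1 + y.
  by have := hz 2; rewrite powR_mulrn ?(ltW z0)//; apply; move: (al2); lra.
rewrite /weight -(mulrA rate) -/z -(mulrA mu) -zal -/y.
have r2 : rate <= mu / 2 by rewrite ge_min lexx orbT.
have e1 : expR (rate * z) <= expR rate * expR (mu / 2 * y).
  rewrite -expRD ler_expR; apply: le_trans (ler_wpM2l (ltW ra0) z1) _.
  rewrite mulrDr mulr1 lerD2l; apply: ler_wpM2r => //; exact: ltW.
have sq : (1 + z) ^+ 2 <= 4 * (1 + y) by have := sqr_ge0 (1 - z); lra.
have e2 : 1 + y <= (1 + 2 / mu) * expR (mu / 2 * y).
  apply: (@le_trans _ _ ((1 + 2 / mu) * (1 + mu / 2 * y))).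
    rewrite [leRHS](_ : _ = 1 + y + 2 / mu + mu / 2 * y); last by field; rewrite gt_eqF.
    have : 0 < mu / 2 * y by rewrite mulr_gt0// divr_gt0.
    lra.
  by apply: ler_wpM2l; [lra|exact: expR_ge1Dx].
have -> : expR (- (mu * y)) = (expR (mu / 2 * y))^-1 * (expR (mu / 2 * y))^-1.
  by rewrite -!expRN -expRD; congr expR; field.
set e := expR (mu / 2 * y) in e1 e2 *.
have e0 : 0 < e by exact: expR_gt0.
rewrite -[leLHS]mulrA; apply: (@le_trans _ _ (expR rate * e * ((4 * ((1 + 2 / mu) * e)) * (e^-1 * e^-1)))).
  have ee0 : 0 <= e^-1 * e^-1 by rewrite mulr_ge0 ?invr_ge0 ?(ltW e0).
  apply: ler_pM; [exact: expR_ge0|by apply: mulr_ge0 => //; exact: sqr_ge0|exact: e1|].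
  apply: ler_wpM2r => //.
  by apply: le_trans sq _; rewrite ler_pM2l.
by rewrite le_eqVlt; apply/orP; left; apply/eqP; field; rewrite !gt_eqF.
Qed.

Lemma heat_ebound : exists C, 1 <= C /\ forall (u0 : bool -> nat -> R) A t, 0 < t ->
  (forall n, psum (fun k => u0 false k ^+ 2 + u0 true k ^+ 2) n <= A ^+ 2) ->
  ebound al rate t (heat u0 t) (C * A).
Proof.
have [C [C1 hC]] := weight_heat; exists C; split => // u0 A t t0 uA n.
rewrite exprMn; apply: (@le_trans _ _ (C ^+ 2 * psum (fun k => u0 false k ^+ 2 + u0 true k ^+ 2) n)).
  rewrite -psumZ; apply: le_psum => k k0.
  rewrite [leLHS](_ : _ = (weight rate al t k * expR (- (mu * k%:R `^ al * t))) ^+ 2 *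
    (u0 false k ^+ 2 + u0 true k ^+ 2)); last first.
    by rewrite /heat; move: (weight _ _ _ _) (expR _) => W E; ring.
  apply: ler_wpM2r; first by rewrite addr_ge0 ?sqr_ge0.
  have h0 : 0 <= weight rate al t k * expR (- (mu * k%:R `^ al * t)).
    by apply: mulr_ge0; [apply: mulr_ge0; [exact: expR_ge0|exact: sqr_ge0]|exact: expR_ge0].
  by rewrite ler_pXn2r ?nnegrE ?hC//; lra.
by apply: ler_wpM2l => //; exact: sqr_ge0.
Qed.

Lemma heat_derive u0 t b k :
  is_derive t (1 : R) (fun s => heat u0 s b k) (- (mu * k%:R `^ al) * heat u0 t b k).
Proof.
have d1 : is_derive t (1 : R) (fun s => - (mu * k%:R `^ al * s)) (- (mu * k%:R `^ al)).
  by apply: is_derive_eq; rewrite /GRing.scale/=; ring.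
have d2 : is_derive t (1 : R) (fun s => expR (- (mu * k%:R `^ al * s)))
    (expR (- (mu * k%:R `^ al * t)) * - (mu * k%:R `^ al)).
  exact: (@is_derive1_comp _ (@expR R)).
rewrite /heat; apply: is_derive_eq; rewrite /GRing.scale/=; ring.
Qed.

Lemma is_derive_continuous (f : R -> R) t (d : R) : is_derive t (1 : R) f d -> {for t, continuous f}.
Proof. by move=> [+ _]; move=> /derivable1_diffP/differentiable_continuous. Qed.

End linear_estimates.

(** * The contraction argument for the Duhamel equation *)

Section fixed_point.
Context {R : realType}.
#[local] Opaque ncoef duhamel.
Variables (mu al ca cb : R).
Hypotheses (mu0 : 0 < mu) (al2 : 5 / 2 < al).
Implicit Types (t s T K A B M : R) (b : bool) (k n j : nat) (u v : R -> bool -> nat -> R).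

Let r := 2 / al.
Let la := rate mu al.
Let th := gain al.
Let ebd := ebound al la.

(* Nonlinearity constant; the summand 1 keeps it positive when ca = cb = 0. *)
Definition nonlin_const : R := 3 * (`|ca| + `|cb|) + 1.

Let CN := nonlin_const.

(** The ball on which the iteration runs. Continuity in time of each coefficient is carried along
    because the Duhamel formula is differentiated for continuous sources. *)
Definition admissible T M u : Prop :=
  (forall t, 0 < t < T -> ebd t (u t) M) /\
  (forall b k, (0 < k)%N -> forall t, 0 < t < T -> {for t, continuous (fun s => u s b k)}).

Lemma CN_gt0 : 0 < CN.
Proof. by rewrite ltr_wpDl// mulr_ge0// addr_ge0. Qed.

Lemma admissible_fast T M u t : 0 <= M -> admissible T M u -> 0 < t < T -> fast (u t).
Proof.
have [ra0 _ _] := rate_facts mu0 al2.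
move=> M0 [uM _] tT; apply: (@ebound_fast _ al la al2 (ltW ra0) t _ M) => //; first by case/andP: tT.
exact: uM.
Qed.

Lemma ncoef_bound t (u v : bool -> nat -> R) A B b k : 0 < t -> 0 < A -> 0 < B ->
  ebd t u A -> ebd t v B ->
  expR (la * t `^ al^-1 * k%:R) * `|ncoef ca cb u v b k| <= CN * (A * B) * t `^ (- r).
Proof.
move=> t0 A0 B0 uA vB.
have [ra0 _ _] := rate_facts mu0 al2.
have fu : fast u by apply: (@ebound_fast _ al la al2 (ltW ra0) t _ A) => //; exact: ltW.
have fv : fast v by apply: (@ebound_fast _ al la al2 (ltW ra0) t _ B) => //; exact: ltW.
apply: le_trans (coef_nonlin ca cb al2 (ltW ra0) b k t0 A0 B0 fu fv uA vB) _.
apply: ler_wpM2r; first exact: powR_ge0.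
apply: ler_wpM2r; first by rewrite mulr_ge0 ?ltW.
by rewrite lerDl.
Qed.

Lemma ncoef_bound1 t (u v : bool -> nat -> R) A B b k : 0 < t -> 0 < A -> 0 < B ->
  ebd t u A -> ebd t v B ->
  `|ncoef ca cb u v b k| <= CN * (A * B) * t `^ (- r).
Proof.
move=> t0 A0 B0 uA vB; apply: le_trans (ncoef_bound b k t0 A0 B0 uA vB).
have [ra0 _ _] := rate_facts mu0 al2.
by rewrite ler_peMl// -expR0 ler_expR !mulr_ge0 ?powR_ge0// ltW.
Qed.

(** Near [t] only times beyond [t / 2] matter, and there the exponential weight gives a decay
    [k^(-4)] uniform in time. *)
Lemma ncoef_continuous T M u b k : 0 < M -> admissible T M u ->
  forall t, 0 < t < T -> {for t, continuous (fun s => ncoef ca cb (u s) (u s) b k)}.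
Proof.
move=> M0 uM t /andP[t0 tT]; have [ra0 _ _] := rate_facts mu0 al2.
have t20 : 0 < t / 2 by lra.
have [C [C0 hC]] := @ebound_decay R al la al2 (ltW ra0) (t / 2) M 4 ra0 t20 (ltW M0).
have nt : \forall s \near t, t / 2 < s < T.
  have : \forall s \near t, s \in `]t / 2, T[ by apply: near_in_itvoo; rewrite in_itv/=; lra.
  by apply: filterS => s; rewrite in_itv.
have dec s : t / 2 < s < T -> forall b k, (0 < k)%N -> `|u s b k| <= C * k%:R ^- 4.
  by move=> hs b' k' k'0; apply: (hC s) => //; [lra|apply: uM.1; lra].
apply: (@ncoef_cvg _ ca cb _ (nbhs t) _ u (u t) C b k).
- by apply: admissible_fast uM _; [exact: ltW|rewrite t0].
- by apply: filterS nt => s hs; apply: admissible_fast uM _; [exact: ltW|lra].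
- by apply: dec; lra.
- by apply: filterS nt => s hs; exact: dec.
- by move=> b' k' k'0; apply: uM.2 => //; rewrite t0.
Qed.

Definition duh u t b k : R :=
  duhamel (mu * k%:R `^ al) (fun s => ncoef ca cb (u s) (u s) b k) t.

Lemma rate_ge0 k : 0 <= mu * k%:R `^ al.
Proof. by rewrite mulr_ge0 ?powR_ge0// ltW. Qed.

Lemma duhP T M u b k : 0 < T -> 0 < M -> admissible T M u ->
  (forall t, 0 < t < T -> is_derive t (1 : R) (fun s => duh u s b k)
     (ncoef ca cb (u t) (u t) b k - mu * k%:R `^ al * duh u t b k)) /\
  duh u t b k @[t --> 0^'+] --> (0 : R).
Proof.
move=> T0 M0 uM; have [ap r0 r1 _ _] := exponent_facts al2.
apply: (@duhamelP _ _ r (CN * (M * M)) T) => //; first exact: rate_ge0.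
- exact: ncoef_continuous uM.
- move=> s sT; apply: ncoef_bound1 => //; [by case/andP: sT|exact: uM.1|exact: uM.1].
Qed.

Definition picard (u0 : bool -> nat -> R) u t b k : R := heat mu al u0 t b k + duh u t b k.

(** The constant of [linear_gain] becomes a parameter, because the time of existence is computed
    from it. *)
Variable C3 : R.
Hypothesis C30 : 0 < C3.
Hypothesis gainP : forall la T K (w dw : R -> bool -> nat -> R),
  0 <= la <= rate mu al -> 0 <= K ->
  (forall b k, (0 < k)%N -> forall s, 0 < s < T -> is_derive s (1 : R) (fun s => w s b k) (dw s b k)) ->
  (forall b k, (0 < k)%N -> w s b k @[s --> 0^'+] --> (0 : R)) ->
  (forall b k, (0 < k)%N -> forall s, 0 < s < T ->
     expR (la * s `^ al^-1 * k%:R) * `|dw s b k + mu * k%:R `^ al * w s b k| <= K * s `^ (- (2 / al))) ->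
  forall t, 0 < t < T -> ebound al la t (w t) (C3 * K * t `^ gain al) /\
    forall b k, (0 < k)%N -> `|w t b k| <= K * barrier mu al (2 / al) la k%:R t.

Let la_ok : 0 <= la <= rate mu al.
Proof. by have [ra0 _ _] := rate_facts mu0 al2; rewrite /la (ltW ra0) lexx. Qed.

Lemma duh_bound T M u : 0 < T -> 0 < M -> admissible T M u ->
  forall t, 0 < t < T -> ebd t (duh u t) (C3 * (CN * (M * M)) * t `^ th) /\
    forall b k, (0 < k)%N -> `|duh u t b k| <= CN * (M * M) * barrier mu al r la k%:R t.
Proof.
move=> T0 M0 uM; have K0 : 0 <= CN * (M * M) by rewrite !mulr_ge0 ?(ltW CN_gt0) ?ltW.
apply: (gainP (dw := fun t b k => ncoef ca cb (u t) (u t) b k - mu * k%:R `^ al * duh u t b k)).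
- exact: la_ok.
- exact: K0.
- by move=> b k _; have [h _] := duhP b k T0 M0 uM; exact: h.
- by move=> b k _; have [_ h] := duhP b k T0 M0 uM; exact: h.
- move=> b k _ s sT; rewrite subrK; apply: ncoef_bound => //; [by case/andP: sT|exact: uM.1|exact: uM.1].
Qed.

(** The difference solves the same linear equations with the polarized source of [ncoefB], whose two
    terms account for the factor [2 M d]. *)
Lemma duh_diff T M d u v : 0 < T -> 0 < M -> 0 < d -> admissible T M u -> admissible T M v ->
  (forall t, 0 < t < T -> ebd t (fun b k => u t b k - v t b k) d) ->
  forall t, 0 < t < T ->
    ebd t (fun b k => duh u t b k - duh v t b k) (C3 * (CN * (2 * M * d)) * t `^ th).
Proof.
move=> T0 M0 d0 uM vM uvd t tT.
have K0 : 0 <= CN * (2 * M * d) by rewrite !mulr_ge0 ?(ltW CN_gt0) ?ltW.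
have hh := @gainP la T (CN * (2 * M * d)) (fun t b k => duh u t b k - duh v t b k)
  (fun t b k => ncoef ca cb (u t) (u t) b k - ncoef ca cb (v t) (v t) b k
    - mu * k%:R `^ al * (duh u t b k - duh v t b k)) la_ok K0 _ _ _ t tT.
apply: (proj1 (hh _ _ _)).
- move=> b k _ s sT; have [h1 _] := duhP b k T0 M0 uM; have [h2 _] := duhP b k T0 M0 vM.
  have d1 := h1 s sT; have d2 := h2 s sT.
  apply: (is_derive_eq (is_deriveB d1 d2)).
  by rewrite mulrBr !opprD !opprK addrACA.
- move=> b k _; have [_ h1] := duhP b k T0 M0 uM; have [_ h2] := duhP b k T0 M0 vM.
  by rewrite -[X in _ --> X](subrr 0); apply: cvgB; [exact: h1|exact: h2].
- move=> b k _ s sT; have s0 : 0 < s by case/andP: sT.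
  rewrite subrK ncoefB; [|exact: (admissible_fast (ltW M0) uM sT)|exact: (admissible_fast (ltW M0) vM sT)].
  apply: le_trans (ler_wpM2l (expR_ge0 _) (ler_normD _ _)) _; rewrite mulrDr.
  have h1 := ncoef_bound b k s0 d0 M0 (uvd s sT) (uM.1 s sT).
  have h2 := ncoef_bound b k s0 M0 d0 (vM.1 s sT) (uvd s sT).
  apply: le_trans (lerD h1 h2) _; rewrite -/r.
  by rewrite le_eqVlt; apply/orP; left; apply/eqP; move: (s `^ _) CN => p c; ring.
Qed.

Lemma powR_le_gain T t : 0 < t < T -> t `^ th <= T `^ th.
Proof.
have [_ _ _ _ g0] := exponent_facts al2.
move=> /andP[t0 tT]; apply: ge0_ler_powR; rewrite ?nnegrE; try lra.
exact: ltW.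
Qed.

Lemma ebound0 t : 0 <= t -> forall A, ebd t (fun _ _ => 0) A.
Proof.
move=> t0 A n; rewrite /psum big1 ?sqr_ge0// => k _.
by rewrite expr0n/= addr0 mulr0.
Qed.

Variables (u0 : bool -> nat -> R) (m CH : R).
Hypotheses (m0 : 0 <= m) (CH1 : 1 <= CH).
Hypothesis u0m : forall n, psum (fun k => u0 false k ^+ 2 + u0 true k ^+ 2) n <= m ^+ 2.
Hypothesis heatP : forall t, 0 < t -> ebd t (heat mu al u0 t) (CH * m).

(** The radius of the ball: the heat part is at most [CH (m + 1) = M / 4], and the smallness of [T]
    makes the Duhamel part at most [M / 4]. The summand 1 keeps [M] positive for zero data. *)
Variable M : R.
Hypothesis M_def : M = 4 * CH * (m + 1).

Variable T : R.
Hypotheses (T0 : 0 < T) (Tsmall : C3 * CN * (4 * M) * T `^ th <= 1).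

Let M0 : 0 < M.
Proof. by rewrite M_def !mulr_gt0//; move: (m0) (CH1); lra. Qed.

Let small t : 0 < t < T -> 0 < C3 * CN * t `^ th /\ C3 * CN * t `^ th * (4 * M) <= 1.
Proof.
move=> tT; have /andP[t0 tT'] := tT; split.
  by rewrite !mulr_gt0 ?CN_gt0 ?powR_gt0.
apply: le_trans Tsmall; rewrite mulrAC; apply: ler_wpM2l; last exact: powR_le_gain.
by rewrite !mulr_ge0 ?(ltW C30) ?(ltW CN_gt0) ?(ltW M0).
Qed.

Lemma heat_admissible : admissible T M (heat mu al u0).
Proof.
have hM : CH * m <= M.
  have : 0 <= CH * m by rewrite mulr_ge0//; move: (CH1); lra.
  by rewrite M_def; move: (CH1); lra.
split.
  move=> t /andP[t0 _]; apply: ebound_leA (heatP t0); rewrite hM andbT mulr_ge0//.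
  by move: (CH1); lra.
by move=> b k _ t _; exact: is_derive_continuous (heat_derive mu al u0 t b k).
Qed.

Lemma picard_admissible u : admissible T M u -> admissible T M (picard u0 u).
Proof.
move=> uM; split.
  move=> t tT; have /andP[t0 _] := tT; have [sm0 sm] := small tT.
  have [hd _] := duh_bound T0 M0 uM tT.
  have e1 : ebd t (heat mu al u0 t) (CH * (m + 1)).
    apply: ebound_leA (heatP t0); rewrite mulr_ge0//=; last by move: (CH1); lra.
    by rewrite ler_wpM2l//; move: (CH1); lra.
  have e10 : 0 < CH * (m + 1) by rewrite mulr_gt0//; move: (CH1) (m0); lra.
  have e20 : 0 < C3 * (CN * (M * M)) * t `^ th.
    by rewrite !mulr_gt0 ?CN_gt0 ?powR_gt0.
  apply: ebound_leA (eboundD e10 e20 e1 hd).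
  rewrite (ltW (addr_gt0 e10 e20))/=.
  have : C3 * CN * t `^ th * (4 * M) * M <= 1 * M by rewrite ler_pM2r.
  by rewrite M_def; lra.
move=> b k k0 t tT; have [h1 _] := duhP b k T0 M0 uM.
apply: cvgD.
  exact: is_derive_continuous (heat_derive mu al u0 t b k).
exact: is_derive_continuous (h1 t tT).
Qed.

Fixpoint iter_picard n : R -> bool -> nat -> R :=
  if n is n'.+1 then picard u0 (iter_picard n') else heat mu al u0.

Let P := iter_picard.

Lemma iter_admissible n : admissible T M (P n).
Proof. by elim: n => [|n IH]; [exact: heat_admissible|exact: picard_admissible]. Qed.

Lemma picard_diff u v d t : 0 < d -> admissible T M u -> admissible T M v ->
  (forall t, 0 < t < T -> ebd t (fun b k => u t b k - v t b k) d) ->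
  0 < t < T -> ebd t (fun b k => picard u0 u t b k - picard u0 v t b k) (d / 2).
Proof.
move=> d0 uM vM uvd tT; have [sm0 sm] := small tT.
have := duh_diff T0 M0 d0 uM vM uvd tT => h.
have -> : (fun b k => picard u0 u t b k - picard u0 v t b k) = (fun b k => duh u t b k - duh v t b k).
  by apply/funext => b; apply/funext => k; rewrite /picard opprD addrACA subrr add0r.
apply: ebound_leA h; apply/andP; split.
  by rewrite !mulr_ge0 ?powR_ge0 ?(ltW C30) ?(ltW CN_gt0) ?(ltW M0) ?(ltW d0).
have : C3 * CN * t `^ th * (4 * M) * d <= 1 * d by rewrite ler_pM2r.
by lra.
Qed.

Lemma iter_diff n t : 0 < t < T ->
  ebd t (fun b k => P n.+1 t b k - P n t b k) (M / 2 ^+ n).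
Proof.
elim: n t => [|n IH] t tT.
  rewrite expr0 divr1; have [sm0 sm] := small tT.
  have [hd _] := duh_bound T0 M0 (iter_admissible 0) tT.
  have -> : (fun b k => P 1 t b k - P 0 t b k) = duh (P 0) t.
    by apply/funext => b; apply/funext => k; rewrite /P /= /picard addrAC subrr add0r.
  apply: ebound_leA hd; apply/andP; split.
    by rewrite !mulr_ge0 ?powR_ge0 ?(ltW C30) ?(ltW CN_gt0) ?(ltW M0).
  have : C3 * CN * t `^ th * (4 * M) * M <= 1 * M by rewrite ler_pM2r.
  have : 0 < C3 * CN * t `^ th * M * M by apply: mulr_gt0 => //; exact: mulr_gt0.
  by lra.
have -> : M / 2 ^+ n.+1 = M / 2 ^+ n / 2 by rewrite exprS invfM mulrA mulrAC.
have d0 : 0 < M / 2 ^+ n by rewrite divr_gt0.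
exact: (picard_diff d0 (iter_admissible n.+1) (iter_admissible n) IH tT).
Qed.

Lemma iter_diffn n j t : 0 < t < T ->
  ebd t (fun b k => P (n + j)%N t b k - P n t b k) (2 * M / 2 ^+ n).
Proof.
move=> tT; elim: j n => [|j IH] n.
  have -> : (fun b k => P (n + 0)%N t b k - P n t b k) = (fun _ _ => 0).
    by apply/funext => b; apply/funext => k; rewrite addn0 subrr.
  by apply: ebound0; lra.
have -> : (fun b k => P (n + j.+1)%N t b k - P n t b k) =
   (fun b k => (P n.+1 t b k - P n t b k) + (P (n.+1 + j)%N t b k - P n.+1 t b k)).
  have tele (x y z : R) : x - y = (z - y) + (x - z) by ring.
  by apply/funext => b; apply/funext => k; rewrite addnS addSn; exact: tele.
have -> : 2 * M / 2 ^+ n = M / 2 ^+ n + 2 * M / 2 ^+ n.+1.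
  by rewrite exprS invfM; move: (2 ^+ n)^-1 => q; field.
apply: eboundD; [| |exact: iter_diff|exact: IH]; by rewrite ?divr_gt0 ?mulr_gt0.
Qed.

Lemma geo_cvg0 : (fun n => 2 * M / 2 ^+ n) @ \oo --> (0 : R).
Proof.
rewrite -[X in _ --> X](mulr0 (2 * M)); apply: cvgMr.
under eq_fun do rewrite -exprVn; apply: cvg_expr.
by rewrite ger0_norm//; lra.
Qed.

(** The limit of the iterates is taken coefficient by coefficient; the norm bounds pass to it by
    [ebound_lim]. *)
Definition mild t b k : R := limn (fun n => P n t b k).

Lemma iter_unif n j t b k : 0 < t < T -> (0 < k)%N ->
  `|P (n + j)%N t b k - P n t b k| <= 2 * M / 2 ^+ n.
Proof.
move=> tT k0; have [ra0 _ _] := rate_facts mu0 al2; have /andP[t0 _] := tT.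
have c0 : 0 <= 2 * M / 2 ^+ n by rewrite divr_ge0// mulr_ge0// ltW.
apply: le_trans (ebound_term b c0 (iter_diffn n j tT) k0).
by rewrite ler_peMl// weight_ge1// ltW.
Qed.

Lemma mild_cvg t b k : 0 < t < T -> (0 < k)%N -> P n t b k @[n --> \oo] --> mild t b k.
Proof.
move=> tT k0; suff : cvgn (fun n => P n t b k) by [].
apply: cauchy_cvg; apply/cauchy_exP => e e0.
have /cvgrPdist_lt/(_ _ e0)[N _ hN] := geo_cvg0.
exists (P N t b k); exists N => // n /= Nn.
have := hN N (leqnn N); rewrite /= sub0r normrN => h.
rewrite /ball/= distrC -(subnKC Nn).
apply: le_lt_trans (iter_unif N (n - N) b tT k0) _.
by apply: le_lt_trans h; exact: ler_norm.
Qed.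

Lemma mild_diff n t : 0 < t < T -> ebd t (fun b k => mild t b k - P n t b k) (2 * M / 2 ^+ n).
Proof.
move=> tT.
apply: (@ebound_lim _ al la _ \oo _ (fun j b k => P j t b k - P n t b k)).
  by move=> b k k0; apply: cvgB; [exact: mild_cvg|exact: cvg_cst].
near=> j; have nj : (n <= j)%N by near: j; exact: nbhs_infty_ge.
by rewrite -(subnKC nj); exact: iter_diffn.
Unshelve. all: by end_near. Qed.

Lemma mild_unif n t b k : 0 < t < T -> (0 < k)%N ->
  `|mild t b k - P n t b k| <= 2 * M / 2 ^+ n.
Proof.
move=> tT k0; have [ra0 _ _] := rate_facts mu0 al2; have /andP[t0 _] := tT.
have c0 : 0 <= 2 * M / 2 ^+ n by rewrite divr_ge0// mulr_ge0// ltW.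
apply: le_trans (ebound_term b c0 (mild_diff n tT) k0).
by rewrite ler_peMl// weight_ge1// ltW.
Qed.

(** The iterates converge uniformly in time on []0, T[], so continuity passes to the limit by an
    [e / 3] argument. *)
Lemma mild_admissible : admissible T M mild.
Proof.
split.
  move=> t tT; apply: (@ebound_lim _ al la _ \oo _ (fun j b k => P j t b k)).
    by move=> b k k0; exact: mild_cvg.
  by apply: nearW => j; exact: (iter_admissible j).1.
move=> b k k0 t tT; apply/cvgrPdist_le => e e0.
have e3 : 0 < e / 3 by lra.
have /cvgrPdist_le/(_ _ e3)[N _ hN] := geo_cvg0.
have hN' : 2 * M / 2 ^+ N <= e / 3.
  by have := hN N (leqnn N); rewrite /= sub0r normrN; apply: le_trans; exact: ler_norm.
have /cvgrPdist_le/(_ _ e3) hc := (iter_admissible N).2 b k k0 t tT.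
have nt : \forall s \near t, 0 < s < T.
  have : \forall s \near t, s \in `]0, T[ by apply: near_in_itvoo; rewrite in_itv.
  by apply: filterS => s; rewrite in_itv.
near=> s.
have sT : 0 < s < T by near: s.
have h1 := mild_unif N b tT k0; have h2 := mild_unif N b sT k0.
have h3 : `|P N t b k - P N s b k| <= e / 3 by near: s.
rewrite (_ : _ - _ = (mild t b k - P N t b k) + (P N t b k - P N s b k) - (mild s b k - P N s b k)); last first.
  by move: (mild _ _ _) (mild _ _ _) (P N t b k) (P N s b k) => p1 p2 p3 p4; ring.
have := ler_normB ((mild t b k - P N t b k) + (P N t b k - P N s b k)) (mild s b k - P N s b k).
have := ler_normD (mild t b k - P N t b k) (P N t b k - P N s b k).
by lra.
Unshelve. all: by end_near. Qed.

(** The shifted iterates converge to [mild] and, by the contraction, also to [picard u0 mild]. *)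
Lemma mild_fixed t b k : 0 < t < T -> (0 < k)%N -> mild t b k = picard u0 mild t b k.
Proof.
move=> tT k0.
have h : (fun n => P n.+1 t b k) @ \oo --> mild t b k.
  by have := @mild_cvg t b k tT k0; rewrite -(cvg_shiftS (fun n => P n t b k)).
suff h2 : (fun n => P n.+1 t b k) @ \oo --> picard u0 mild t b k.
  by rewrite -(cvg_lim (@Rhausdorff R) h) (cvg_lim (@Rhausdorff R) h2).
apply/cvgrPdist_le => e e0; have /cvgrPdist_le/(_ _ e0) hg := geo_cvg0.
near=> n.
have c0 : 0 < 2 * M / 2 ^+ n by rewrite divr_gt0// mulr_gt0.
have := picard_diff c0 mild_admissible (iter_admissible n) (fun s sT => mild_diff n sT) tT.
have c20 : 0 <= 2 * M / 2 ^+ n / 2 by rewrite divr_ge0// ltW.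
have [ra0 _ _] := rate_facts mu0 al2; have /andP[t0 _] := tT.
move=> /(ebound_term b c20)/(_ k0) hb.
have gn : 2 * M / 2 ^+ n <= e.
  have : `|0 - 2 * M / 2 ^+ n| <= e by near: n.
  by rewrite sub0r normrN; apply: le_trans; exact: ler_norm.
apply: (@le_trans _ _ (2 * M / 2 ^+ n / 2)); last by lra.
apply: le_trans hb; rewrite ler_peMl// weight_ge1// ltW.
Unshelve. all: by end_near. Qed.

End fixed_point.

(** * Existence in terms of coefficients, on a time determined by the size of the data *)

Section mild_solution.
Context {R : realType}.
#[local] Opaque ncoef duhamel.
Variables (mu al ca cb : R).
Hypotheses (mu0 : 0 < mu) (al2 : 5 / 2 < al).

Lemma mild_existence : exists Tm : R -> R, forall m, 0 <= m -> 0 < Tm m /\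
  forall u0 : bool -> nat -> R,
  (forall n, psum (fun k => u0 false k ^+ 2 + u0 true k ^+ 2) n <= m ^+ 2) ->
  exists (M : R) (v : R -> bool -> nat -> R), [/\ 0 < M, admissible mu al (Tm m) M v,
    (forall t b k, 0 < t < Tm m -> (0 < k)%N ->
       is_derive t (1 : R) (fun s => v s b k)
         (ncoef ca cb (v t) (v t) b k - mu * k%:R `^ al * v t b k)) &
    (forall t b k, 0 < t < Tm m -> (0 < k)%N ->
       `|v t b k - heat mu al u0 t b k| <= M * barrier mu al (2 / al) (rate mu al) k%:R t)].
Proof.
have [C3 [C30 gainP]] := linear_gain mu0 al2.
have [CH [CH1 heatP]] := heat_ebound mu0 al2.
have [_ _ _ _ g0] := exponent_facts al2.
pose CN := nonlin_const ca cb; have CN0 : 0 < CN := CN_gt0 ca cb.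
pose M m := 4 * CH * (m + 1).
have M0 m : 0 <= m -> 0 < M m by move=> ?; rewrite !mulr_gt0//; lra.
(* The time [T] with [C3 CN (4 M) T^gain = 1]; apart from [m] it involves constants of the equation
   only. *)
exists (fun m => (C3 * CN * (4 * M m)) `^ (- (gain al)^-1)) => m m0.
have D0 : 0 < C3 * CN * (4 * M m).
  by apply: mulr_gt0; [exact: mulr_gt0|apply: mulr_gt0 => //; exact: M0].
have T0 : 0 < (C3 * CN * (4 * M m)) `^ (- (gain al)^-1) by rewrite powR_gt0.
split => // u0 u0m; set T := _ `^ _ in T0 *.
have Tsmall : C3 * CN * (4 * M m) * T `^ gain al <= 1.
  rewrite /T -powRrM mulNr mulVf; last by rewrite gt_eqF.
  by rewrite powR_inv1 ?(ltW D0)// mulfV// gt_eqF.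
have hu0 t : 0 < t -> ebound al (rate mu al) t (heat mu al u0 t) (CH * m).
  by move=> t0; exact: heatP.
pose v := mild mu al ca cb u0.
have vM : admissible mu al T (M m) v by exact: (mild_admissible mu0 al2 C30 gainP m0 CH1 hu0 erefl T0 Tsmall).
have vfix t b k : 0 < t < T -> (0 < k)%N -> v t b k = heat mu al u0 t b k + duh mu al ca cb v t b k.
  by move=> tT k0; exact: (mild_fixed mu0 al2 C30 gainP m0 CH1 hu0 erefl T0 Tsmall).
have KM : 0 < CN * (M m * M m) by apply: mulr_gt0 => //; apply: mulr_gt0; exact: M0.
(* One constant serves both as radius of the ball and as factor of the barrier. *)
exists (Num.max (M m) (CN * (M m * M m))), v; split.
- by rewrite lt_max M0.
- split; last exact: vM.2.
  move=> t tT; apply: ebound_leA (vM.1 t tT).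
  by rewrite ltW ?M0//= le_max lexx.
- move=> t b k tT k0.
  have [hd _] := duhP ca cb mu0 al2 b k T0 (M0 _ m0) vM.
  have d1 := hd t tT; have d2 := heat_derive mu al u0 t b k.
  have d3 : is_derive t (1 : R) (fun s => heat mu al u0 s b k + duh mu al ca cb v s b k)
     (ncoef ca cb (v t) (v t) b k - mu * k%:R `^ al * v t b k).
    by apply: (is_derive_eq (is_deriveD d2 d1)); rewrite vfix// mulrDr opprD mulNr addrCA.
  apply: near_eq_is_derive d3.
  have : \forall s \near t, s \in `]0, T[ by apply: near_in_itvoo; rewrite in_itv.
  by apply: filterS => s; rewrite in_itv/= => sT; rewrite vfix.
- move=> t b k tT k0; rewrite vfix// addrAC subrr add0r.
  have [_ h] := duh_bound ca cb mu0 al2 gainP T0 (M0 _ m0) vM tT.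
  apply: le_trans (h b k k0) _; apply: ler_wpM2r; last by rewrite le_max lexx orbT.
  have [ap r0 r1 _ _] := exponent_facts al2; have /andP[t0 _] := tT.
  by apply: barrier_ge0; rewrite ?r0 ?(ltW t0).
Qed.

End mild_solution.

(** * Square integrable functions, Bessel's inequality and difference quotients *)

Section square_integrable.
Context {R : realType}.
Notation leb := (@lebesgue_measure R).
Implicit Types (f g : R -> R) (b : bool) (k n : nat) (K : R).

Let mS := @measurable_S1 R.

Lemma memL2_measurable f : memL2 f -> measurable_fun (S1 R) f.
Proof.
move=> [_]; rewrite inE => /andP[+ _]; rewrite inE/= => h.
by apply/(measurable_restrictT _ _).2.
Qed.

Lemma memL2_sqr_integrable f : memL2 f -> leb.-integrable (S1 R) (EFin \o (fun x => f x ^+ 2)).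
Proof.
move=> [_ /Lfun2_integrable_sqr h]; apply/(integrable_mkcond _ mS).2.
apply: eq_integrable h => // x _ /=; rewrite /patch; case: ifPn => // _.
by rewrite expr0n.
Qed.

Lemma memL2_integrable f : memL2 f -> leb.-integrable (S1 R) (EFin \o f).
Proof.
move=> fL; have h := memL2_sqr_integrable fL.
have h1 : leb.-integrable (S1 R) (EFin \o (fun=> 1 : R)).
  by apply: S1_integrable => ?; exact: cst_continuous.
apply: le_integrable (integrableD mS h1 h) => //.
  by apply/measurable_EFinP; exact: memL2_measurable.
move=> x _ /=; rewrite lee_fin [leRHS]ger0_norm; last by rewrite addr_ge0 ?sqr_ge0.
rewrite -(real_normK (num_real (f x))); have := sqr_ge0 (`|f x| - 1).
by have := normr_ge0 (f x); lra.
Qed.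

Lemma mulr_continuous_integrable f g : leb.-integrable (S1 R) (EFin \o f) -> continuous g ->
  leb.-integrable (S1 R) (EFin \o (fun x => f x * g x)).
Proof.
move=> fi cg.
have : leb.-integrable (S1 R) ((EFin \o f) \* (EFin \o g))%E.
  apply: integrableMl => //.
    by apply: measurable_funTS; exact: continuous_measurable_fun.
  have : bounded_set (g @` S1 R).
    apply: compact_bounded; apply: continuous_compact; last exact: segment_compact.
    exact: continuous_subspaceT.
  move=> [M [Mr hM]]; exists M; split => // y My x Sx; apply: (hM y My); by exists x.
by apply: eq_integrable => // x _.
Qed.

Lemma normL2_sqr f : normL2 f = ((\int[leb]_(x in S1 R) (f x ^+ 2)%:E) `^ 2^-1)%E.
Proof.
rewrite /normL2 unlock/=; congr (_ `^ _)%E.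
rewrite [RHS]integral_mkcond; apply: eq_integral => x _.
rewrite /= /restrict /patch; case: ifPn => xS.
  by rewrite powR_mulrn// real_normK ?num_real.
by rewrite normr0 powR0 ?pnatr_eq0.
Qed.

Lemma normL2E f : memL2 f -> normL2 f = (Num.sqrt (Iper (fun x => f x ^+ 2)))%:E.
Proof.
move=> fL; rewrite normL2_sqr poweR12_sqrt; last first.
  by apply: integral_ge0 => x _; rewrite lee_fin sqr_ge0.
rewrite /Iper /Rintegral -[in LHS](fineK (integrable_fin_num mS (memL2_sqr_integrable fL))).
by [].
Qed.

Lemma continuous_memL2 f : continuous f -> periodic f (pi *+ 2) -> memL2 f.
Proof.
move=> cf fp; split => //; rewrite inE; apply/andP; rewrite !inE/=; split.
  apply/(measurable_restrictT _ _).1 => //.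
  by apply: measurable_funTS; exact: continuous_measurable_fun.
rewrite /finite_norm -/(normL2 f) normL2_sqr.
apply: poweR_lty.
have := S1_integrable (contM cf cf) => /integrableP[_]; apply: le_lt_trans.
rewrite le_eqVlt; apply/orP; left; apply/eqP; apply: eq_integral => x _ /=.
by rewrite -expr2 ger0_norm ?sqr_ge0.
Qed.

Lemma memL2B f g : memL2 f -> memL2 g -> memL2 (fun x => f x - g x).
Proof.
move=> [fp fL] [gp gL]; split; first by move=> x; rewrite fp gp.
have -> : (fun x => f x - g x) \_ (S1 R) = f \_ (S1 R) - g \_ (S1 R).
  apply/funext => x; rewrite /patch -[RHS]/((if x \in S1 R then f x else point) - (if x \in S1 R then g x else point)).
  by case: ifPn => // _; rewrite subrr.
have h12 : (1 <= 2%:E :> \bar R)%E by rewrite lee_fin; lra.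
have [_ h] := Lfun_submod_closed leb h12.
by have := h (-1) _ _ gL fL; rewrite scaleN1r addrC.
Qed.

Lemma psum_sqr_trig (u : bool -> nat -> R) n f :
  leb.-integrable (S1 R) (EFin \o f) ->
  Iper (fun x => f x * psum (trig_term u x) n) =
    pi * psum (fun k => u false k * coef f false k + u true k * coef f true k) n.
Proof.
move=> fi.
have ci b k : leb.-integrable (S1 R) (EFin \o (fun x => f x * ebas b k x)).
  by apply: mulr_continuous_integrable => //; exact: ebas_continuous.
have ck k : leb.-integrable (S1 R) (EFin \o (fun x => f x * trig_term u x k)).
  by apply: mulr_continuous_integrable => //; exact: trig_term_continuous.
have Ik k : Iper (fun x => f x * trig_term u x k) =
    pi * (u false k * coef f false k + u true k * coef f true k).
  rewrite !coefI (eq_Iper (g := fun x => u false k * (f x * ebas false k x) + u true k * (f x * ebas true k x))).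
    rewrite /Iper RintegralD ?RintegralZl//.
    - have p0 : (pi : R) != 0 by rewrite gt_eqF// pi_gt0.
      move: (\int[_]_(_ in _) _) (\int[_]_(_ in _) _) (pi : R) p0 => A B p p0; field.
      by [].
    - by have := integrableZl mS (u false k) (ci false k).
    - by have := integrableZl mS (u true k) (ci true k).
  by move=> x; rewrite trig_termE; ring.
have cn m : leb.-integrable (S1 R) (EFin \o (fun x => f x * psum (trig_term u x) m)).
  by apply: mulr_continuous_integrable => //; exact: trigp_continuous.
case: n => [|n].
  rewrite [in RHS]/psum big_geq// mulr0 (eq_Iper (g := fun=> 0)).
    by rewrite Iper_cst mul0r.
  by move=> x; rewrite /psum big_geq// mulr0.
elim: n => [|n IH].
  rewrite [in RHS]/psum big_geq// mulr0 (eq_Iper (g := fun=> 0)).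
    by rewrite Iper_cst mul0r.
  by move=> x; rewrite /psum big_geq// mulr0.
rewrite (eq_Iper (g := fun x => f x * psum (trig_term u x) n.+1 + f x * trig_term u x n.+1)).
  rewrite {1}/Iper RintegralD//.
  by rewrite -/(Iper _) -/(Iper _) IH Ik -mulrDr [in RHS]/psum big_nat_recr.
by move=> x; rewrite -mulrDr /psum big_nat_recr.
Qed.

Lemma Iper_trigp_sqr (u : bool -> nat -> R) n :
  Iper (fun x => psum (trig_term u x) n ^+ 2) = pi * psum (fun k => u false k ^+ 2 + u true k ^+ 2) n.
Proof.
rewrite (eq_Iper (g := fun x => psum (trig_term u x) n * psum (trig_term u x) n)) => [|//].
rewrite psum_sqr_trig; last by apply: S1_integrable; exact: trigp_continuous.
congr (_ * _); apply: eq_big_nat => k /andP[k0 kn].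
by rewrite !coef_trigp k0 kn.
Qed.

(** Expansion of the integral of [(f - S)^2 >= 0], where [S] is a partial Fourier sum; the cross
    term and the integral of [S^2] both reduce to the sum of squares. *)
Lemma bessel f n : memL2 f ->
  pi * psum (fun k => coef f false k ^+ 2 + coef f true k ^+ 2) n <= Iper (fun x => f x ^+ 2).
Proof.
move=> fL; set S := fun x => psum (trig_term (coef f) x) n.
have fi := memL2_integrable fL; have f2 := memL2_sqr_integrable fL.
have cS : continuous S by exact: trigp_continuous.
have fSi := mulr_continuous_integrable fi cS.
have S2i := S1_integrable (contM cS cS).
have I2 := psum_sqr_trig (coef f) n fi; have I3 := Iper_trigp_sqr (coef f) n.
have h : 0 <= Iper (fun x => (f x - S x) ^+ 2) by apply: Rintegral_ge0 => x _; exact: sqr_ge0.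
move: h; rewrite (eq_Iper (g := fun x => f x ^+ 2 - 2 * (f x * S x) + S x * S x)); last first.
  by move=> x; ring.
have z2 : leb.-integrable (S1 R) (EFin \o (fun x => 2 * (f x * S x))).
  by have := integrableZl mS 2 fSi.
have d2 : leb.-integrable (S1 R) (EFin \o (fun x => f x ^+ 2 - 2 * (f x * S x))).
  by have := integrableB mS f2 z2.
rewrite /Iper RintegralD// RintegralB// RintegralZl//.
rewrite -/(Iper (fun x => f x ^+ 2)) -/(Iper (fun x => f x * S x)) -/(Iper (fun x => S x * S x)).
rewrite I2 (_ : Iper (fun x => S x * S x) = Iper (fun x => S x ^+ 2)); last by apply: eq_Iper.
rewrite I3 -/(psum _ n) (@eq_psum _ (fun k => coef f false k * coef f false k + coef f true k * coef f true k)
   (fun k => coef f false k ^+ 2 + coef f true k ^+ 2)) => [|//].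
by lra.
Qed.

Lemma trig_sqr (u : bool -> nat -> R) K L : sumu u K ->
  (forall n, psum (fun k => u false k ^+ 2 + u true k ^+ 2) n <= L) ->
  Iper (fun x => trig u x ^+ 2) <= pi * L.
Proof.
move=> uK uL.
have cu := trig_continuous uK.
have h : Iper (fun x => trig u x * psum (trig_term u x) n) @[n --> \oo] --> Iper (fun x => trig u x * trig u x).
  apply: Iper_uniform.
  - by apply: nearW => n; apply: contM => //; exact: trigp_continuous.
  - exact: contM.
  move=> e e0; have K0 : 0 <= K := asum_le_ge0 (uK false).
  have s0 : 0 < 2 * K + 1 by lra.
  near=> n => x; rewrite -mulrBr normrM.
  have h1 := trig_bound x uK.
  have h2 : `|psum (trig_term u x) n - trig u x| <= e / (2 * K + 1).
    by move: (x); near: n; apply: trigp_unif uK _ _; rewrite divr_gt0.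
  apply: le_trans (ler_pM _ _ h1 h2) _ => //.
  by rewrite mulrA ler_pdivrMr// mulrC; apply: ler_wpM2l; [exact: ltW|lra].
rewrite (eq_Iper (g := fun x => trig u x * trig u x)) => [|//].
refine (cvgr_to_le h _); near=> n.
rewrite psum_sqr_trig; last exact: S1_integrable.
rewrite (@eq_psum _ _ (fun k => u false k ^+ 2 + u true k ^+ 2)); last first.
  by move=> k k0; rewrite !(coef_trig _ uK).
by apply: ler_wpM2l; [exact: pi_ge0|exact: uL].
Unshelve. all: by end_near. Qed.

(** The difference quotient multiplies the complex coefficients by [(exp (i k h) - 1) / h], of
    modulus at most [k], so its L2 norm is bounded uniformly in [h]. *)
Lemma trig_quotient_sqr (v : bool -> nat -> R) (K L h : R) : h != 0 -> sumu v K ->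
  (forall n, psum (fun k => k%:R ^+ 2 * (v false k ^+ 2 + v true k ^+ 2)) n <= L) ->
  exists q : R -> R, [/\ continuous q, (forall x, q x = h^-1 * (trig v (x + h) - trig v x)) &
    Iper (fun x => q x ^+ 2) <= pi * L].
Proof.
move=> h0 vK vL.
(* In real form: the pair of coefficients is rotated by the angle [k h], minus the identity. *)
pose w b k := h^-1 * (if b then v true k * (cos (k%:R * h) - 1) - v false k * sin (k%:R * h)
   else v false k * (cos (k%:R * h) - 1) + v true k * sin (k%:R * h)).
have wK : sumu w (`|h^-1| * (`|3| * K + `|3| * K)).
  have s3 : sumu (fun b k => 3 * v false k + 3 * v true k) (`|3| * K + `|3| * K).
    by move=> b; apply: asum_leD; apply: asum_leZ; exact: vK.
  apply: (@sumu_leW _ _ (fun b k => h^-1 * (3 * `|v false k| + 3 * `|v true k|))); last first.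
    apply: sumuZ => b; apply: asum_leD; apply: asum_leZ; apply: asum_norm; exact: vK.
  move=> b k k0; rewrite !normrM; apply: ler_wpM2l => //.
  rewrite [leRHS]ger0_norm; last by rewrite addr_ge0// mulr_ge0.
  have c1 := cos_max (k%:R * h); have s1 := sin_max (k%:R * h).
  have c2 : `|cos (k%:R * h) - 1| <= 2.
    by apply: le_trans (ler_normB _ _) _; rewrite normr1; lra.
  case: b; [apply: le_trans (ler_normB _ _) _|apply: le_trans (ler_normD _ _) _]; rewrite !normrM.
    have := ler_wpM2l (normr_ge0 (v true k)) c2; have := ler_wpM2l (normr_ge0 (v false k)) s1.
    by have := normr_ge0 (v false k); have := normr_ge0 (v true k); lra.
  have := ler_wpM2l (normr_ge0 (v false k)) c2; have := ler_wpM2l (normr_ge0 (v true k)) s1.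
  by have := normr_ge0 (v false k); have := normr_ge0 (v true k); lra.
exists (trig w); split.
- exact: trig_continuous wK.
- move=> x; rewrite /trig -(tsumB (trig_asum _ vK) (trig_asum _ vK)).
  rewrite -(tsumZ _ (asum_leD (trig_asum (x + h) vK) (asum_leN (trig_asum x vK)))).
  apply: eq_tsum => k _; rewrite /= /trig_term /w (mulrDr _ x h) cosD sinD.
  by ring.
- apply: trig_sqr wK _ => n; apply: le_trans (vL n); apply: le_psum => k k0.
  rewrite /w; set C := cos _; set S := sin _.
  have CS : C ^+ 2 + S ^+ 2 = 1 by rewrite /C /S cos2Dsin2.
  have kh : (C - 1) ^+ 2 + S ^+ 2 <= (k%:R * h) ^+ 2.
    (* This is the square of the modulus of [exp (i k h) - 1]. *)
    have -> : (C - 1) ^+ 2 + S ^+ 2 = 4 * sin (k%:R * h / 2) ^+ 2.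
      rewrite (_ : _ + _ = 2 - 2 * C); last by rewrite sqrrB expr1n mulr1; lra.
      rewrite /C (_ : k%:R * h = k%:R * h / 2 + k%:R * h / 2) ?cosD; last by field.
      have := cos2Dsin2 (k%:R * h / 2); rewrite (_ : (_ + _) / 2 = k%:R * h / 2); last by field.
      by lra.
    have sx (y : R) : `|sin y| <= `|y|.
      have pos (z : R) : 0 <= z -> `|sin z| <= z.
        rewrite le_eqVlt => /predU1P[<-|z0]; first by rewrite sin0 normr0.
        have [|c _] := @MVT R sin cos 0 z z0.
        - by apply: continuous_subspaceT; exact: continuous_sin.
        rewrite sin0 !subr0 => ->; rewrite normrM (gtr0_norm z0) ler_piMl ?(ltW z0)//.
        exact: cos_max.
      have [y0|y0] := leP 0 y; first by rewrite (ger0_norm y0); exact: pos.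
      by rewrite -normrN -sinN (ltr0_norm y0); apply: pos; lra.
    have := sx (k%:R * h / 2).
    rewrite -(@ler_pXn2r _ 2%N)// ?nnegrE// !real_normK ?num_real// => hs.
    have -> : (k%:R * h) ^+ 2 = 4 * (k%:R * h / 2) ^+ 2 by field.
    by lra.
  rewrite [leLHS](_ : _ = h^-1 ^+ 2 * (((C - 1) ^+ 2 + S ^+ 2) * (v false k ^+ 2 + v true k ^+ 2))); last by ring.
  rewrite [leRHS](_ : _ = h^-1 ^+ 2 * ((k%:R * h) ^+ 2 * (v false k ^+ 2 + v true k ^+ 2))); last by field.
  by apply: ler_wpM2l; [exact: sqr_ge0|apply: ler_wpM2r => //; rewrite addr_ge0 ?sqr_ge0].
Qed.

End square_integrable.

(** * Primitives of integrable functions and Parseval's inequality *)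

Section primitives.
Context {R : realType}.
Notation leb := (@lebesgue_measure R).
Implicit Types (f g : R -> R) (b : bool) (k n : nat) (K L x : R).

Let mS := @measurable_S1 R.
Let Npp : - (pi : R) < pi.
Proof. by have := pi_gt0 R; lra. Qed.

Definition clamp x : R := Num.max (- pi) (Num.min x pi).

(* Constant outside of the period, so that it is continuous on the line. *)
Definition prim f x : R := \int[leb]_(y in `[- pi, clamp x]) f y.

Lemma clamp_id x : - pi <= x <= pi -> clamp x = x.
Proof. by move=> /andP[a c]; rewrite /clamp min_l// max_r. Qed.

Lemma clamp_itv x : - pi <= clamp x <= pi.
Proof.
by rewrite /clamp le_max lexx/= ge_max ge_min lexx orbT andbT; move: Npp; lra.
Qed.

Lemma clamp_continuous : continuous clamp.
Proof.
move=> x; apply: (@continuous_max _ _ (fun=> - pi) (fun x => Num.min x pi)); first exact: cst_continuous.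
by apply: (@continuous_min _ _ id (fun=> pi)); [exact: cvg_id|exact: cst_continuous].
Qed.

Let sub x : `[- pi, clamp x] `<=` S1 R.
Proof. by apply: subset_itvl; rewrite bnd_simp; case/andP: (clamp_itv x). Qed.

Let intS f x : leb.-integrable (S1 R) (EFin \o f) -> leb.-integrable `[- pi, clamp x] (EFin \o f).
Proof. by apply: integrableS => //; exact: sub. Qed.

Lemma prim_continuous f : leb.-integrable (S1 R) (EFin \o f) -> continuous (prim f).
Proof.
move=> fi x; have /subspace_continuousP h1 := parameterized_integral_continuous (ltW Npp) fi.
have ci : (S1 R) (clamp x) by have := clamp_itv x; rewrite /S1/= in_itv.
apply: (cvg_comp _ _ _ (h1 _ ci)) => P hP.
have cx : clamp y @[y --> x] --> clamp x := @clamp_continuous x.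
have h2 : \forall y \near x, S1 R (clamp y) -> P (clamp y) by have := cx _ hP.
apply: filterS h2 => y; apply.
by have := clamp_itv y; rewrite /S1/= in_itv.
Qed.

Lemma prim_left f : prim f (- pi) = 0.
Proof.
rewrite /prim clamp_id; last by move: Npp; lra.
by rewrite set_itv1 Rintegral_set1.
Qed.

Lemma prim_right f : prim f pi = Iper f.
Proof. by rewrite /prim clamp_id// lexx andbT; move: Npp; lra. Qed.

Lemma primB f g x : leb.-integrable (S1 R) (EFin \o f) -> leb.-integrable (S1 R) (EFin \o g) ->
  `|prim f x - prim g x| <= Iper (fun y => `|f y - g y|).
Proof.
move=> fi gi; have di : leb.-integrable (S1 R) (EFin \o (fun y => f y - g y)).
  by have := integrableB mS fi gi.
rewrite /prim -RintegralB//; [|exact: intS|exact: intS].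
apply: le_trans (le_normr_Rintegral _ (intS x di)) _ => //.
have ni := integrable_norm di.
rewrite /Iper /Rintegral; apply: fine_le.
- exact: integrable_fin_num (intS x ni).
- exact: integrable_fin_num ni.
by apply: ge0_subset_integral => //; case/integrableP: ni.
Qed.

Lemma prim_derive f x : continuous f -> - pi < x < pi -> is_derive x 1 (prim f) (f x).
Proof.
move=> cf /andP[x1 x2].
have [|d e] := @continuous_FTC1_closed R f (- pi) x pi x2 (S1_integrable cf) x1.
  exact: cf.
have d' : is_derive x 1 (fun y => \int[leb]_(t in `[- pi, y]) f t) (f x).
  by apply: DeriveDef; [exact: d|rewrite -derive1E; exact: e].
apply: near_eq_is_derive d'.
near=> y; rewrite /prim clamp_id//.
have y1 : - pi < y by near: y; exact: lt_nbhsr.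
have y2 : y < pi by near: y; exact: lt_nbhsl.
by rewrite !ltW.
Unshelve. all: by end_near. Qed.

Let parts_continuous f (phi dphi : R -> R) : continuous f ->
  (forall x, is_derive x 1 phi (dphi x)) -> continuous dphi ->
  Iper (fun x => prim f x * dphi x) = Iper f * phi pi - Iper (fun x => f x * phi x).
Proof.
move=> cf d cd; have fi := S1_integrable cf; have cF := prim_continuous fi.
have cphi x : {for x, continuous phi}.
  by have [/derivable1_diffP/differentiable_continuous] := d x.
rewrite /Iper (@Rintegration_by_parts R (prim f) phi f dphi _ _ Npp).
- by rewrite prim_right prim_left mul0r subr0.
- exact: continuous_subspaceT.
- split.
  + by move=> x; rewrite in_itv/= => hx; have [] := prim_derive cf hx.
  + by apply: cvg_at_right_filter; exact: cF.
  + by apply: cvg_at_left_filter; exact: cF.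
- by move=> x; rewrite in_itv/= => hx; have := prim_derive cf hx => -[_ <-]; rewrite derive1E.
- exact: continuous_subspaceT.
- split.
  + by move=> x _; have [] := d x.
  + by apply: cvg_at_right_filter; exact: cphi.
  + by apply: cvg_at_left_filter; exact: cphi.
- by move=> x _; have [_ <-] := d x; rewrite derive1E.
Qed.

(** Integration by parts holds for continuous [f]. For bounded [phi] and [dphi] both sides depend
    continuously on [f] in L1, where continuous functions are dense. *)
Lemma Iper_prim f (phi dphi : R -> R) (C : R) : leb.-integrable (S1 R) (EFin \o f) ->
  (forall x, is_derive x 1 phi (dphi x)) -> continuous dphi ->
  (forall x, `|phi x| <= C) -> (forall x, `|dphi x| <= C) ->
  Iper (fun x => prim f x * dphi x) = Iper f * phi pi - Iper (fun x => f x * phi x).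
Proof.
move=> fi d cd bphi bd.
have cphi : continuous phi.
  by move=> x; have [/derivable1_diffP/differentiable_continuous] := d x.
have C0 : 0 <= C := le_trans (normr_ge0 _) (bd 0).
have [g [cg _ /fine_cvgP[_ gf]]] : exists g_ : (R -> R)^nat,
    [/\ forall n, continuous (g_ n), forall n, leb.-integrable (S1 R) (EFin \o g_ n) &
        (\int[leb]_(z in S1 R) `|(f z - g_ n z)%:E| @[n --> \oo] --> 0)%E].
  apply: approximation_continuous_integrable => //.
  by apply: compact_finite_measure; exact: segment_compact.
apply/eqP; rewrite -subr_eq0 -normr_le0; apply/ler_addgt0Pl => e e0; rewrite addr0.
(* The sum of the three error factors: [2 pi C] from the left side, [C] from the boundary term and
   [C] from the last integral. *)
pose D : R := C * (pi *+ 2) + C + C.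
have D0 : 0 <= D.
  have := @pi2_gt0 R; rewrite /D; move: (pi *+ 2) => p p0.
  by have := mulr_ge0 C0 (ltW p0); lra.
have eD : 0 < e / (D + 1) by rewrite divr_gt0// ltr_wpDl.
move/cvgrPdist_lt : gf => /(_ _ eD)[N _ /(_ N (leqnn N))].
rewrite sub0r normrN /=.
set h := g N; have ch : continuous h := cg N; have hi := S1_integrable ch.
pose eps := Iper (fun z => `|f z - h z|); rewrite -[fine _]/eps => he.
have eps0 : 0 <= eps by apply: Rintegral_ge0 => x _; exact: normr_ge0.
have {he} he : eps <= e / (D + 1) by apply: ltW; move: he; rewrite ger0_norm.
have di : leb.-integrable (S1 R) (EFin \o (fun y => f y - h y)).
  by have := integrableB mS fi hi.
have ni := integrable_norm di.
have E1 : `|Iper (fun x => prim f x * dphi x) - Iper (fun x => prim h x * dphi x)| <= eps * C * (pi *+ 2).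
  have c1 : continuous (fun x => prim f x * dphi x) by apply: contM => //; exact: prim_continuous.
  have c2 : continuous (fun x => prim h x * dphi x) by apply: contM => //; exact: prim_continuous.
  rewrite -IperB//; apply: Iper_bound; first exact: contB.
  by move=> x; rewrite -mulrBl normrM; apply: ler_pM => //; exact: primB.
have E2 : `|Iper f - Iper h| <= eps.
  by rewrite /Iper -RintegralB//; exact: le_normr_Rintegral.
have E3 : `|Iper (fun x => f x * phi x) - Iper (fun x => h x * phi x)| <= C * eps.
  have i1 := mulr_continuous_integrable fi cphi; have i2 := mulr_continuous_integrable hi cphi.
  have i3 : leb.-integrable (S1 R) (EFin \o (fun x => f x * phi x - h x * phi x)).
    by have := integrableB mS i1 i2.
  rewrite /Iper -RintegralB//; apply: le_trans (le_normr_Rintegral _ i3) _ => //.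
  rewrite -RintegralZl//; apply: le_Rintegral => //.
  - exact: integrable_norm i3.
  - by have := integrableZl mS C ni.
  - by move=> x _; rewrite -mulrBl normrM mulrC; apply: ler_wpM2r.
have E0 := parts_continuous ch d cd.
have E4 : `|(Iper f - Iper h) * phi pi| <= eps * C by rewrite normrM; apply: ler_pM.
rewrite (_ : _ - _ = (Iper (fun x => prim f x * dphi x) - Iper (fun x => prim h x * dphi x))
   - (Iper f - Iper h) * phi pi + (Iper (fun x => f x * phi x) - Iper (fun x => h x * phi x))); last first.
  by rewrite E0; ring.
apply: le_trans (ler_normD _ _) _; apply: le_trans (lerD (ler_normB _ _) (lexx _)) _.
apply: le_trans (lerD (lerD E1 E4) E3) _.
have -> : eps * C * (pi *+ 2) + eps * C + C * eps = D * eps by rewrite /D; ring.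
apply: le_trans (ler_wpM2l D0 he) _; rewrite mulrA ler_pdivrMr; last by lra.
by rewrite mulrC; apply: ler_wpM2l; lra.
Qed.

(** Integration by parts against the other family at the same frequency; the boundary term carries
    the mean of [f], which is 0. *)
Lemma coef_prim f b k : leb.-integrable (S1 R) (EFin \o f) -> zero_mean f -> (0 < k)%N ->
  coef (prim f) b k = (if b then coef f false k else - coef f true k) / k%:R.
Proof.
move=> fi f0 k0; have kp : 0 < k%:R :> R by rewrite ltr0n.
have I0 : Iper f = 0 by exact: f0.
pose dphi x : R := if ~~ b then k%:R * ebas false k x else - (k%:R * ebas true k x).
have cd : continuous dphi.
  rewrite /dphi; case: (~~ b); first by apply: contZ; exact: ebas_continuous.
  by move=> x; apply: cvgN; apply: contZ; exact: ebas_continuous.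
have k1 : 1 <= k%:R :> R by rewrite ler1n.
have := @Iper_prim f (ebas (~~ b) k) dphi k%:R fi (ebas_derive (~~ b) k) cd.
have b1 x : `|ebas (~~ b) k x| <= k%:R by apply: le_trans (ebas_le1 _ _ _) k1.
have b2 x : `|dphi x| <= k%:R.
  rewrite /dphi; case: (~~ b); rewrite ?normrN normrM (gtr0_norm kp) ger_pMr//; exact: ebas_le1.
move=> /(_ b1 b2); rewrite I0 mul0r sub0r.
have cp : continuous (fun x => prim f x * ebas b k x).
  by apply: contM; [exact: prim_continuous|exact: ebas_continuous].
rewrite (eq_Iper (g := fun x => (if ~~ b then k%:R else - k%:R) * (prim f x * ebas b k x))); last first.
  by move=> x; rewrite /dphi; case: b {b1 b2 cp cd dphi} => /=; ring.
rewrite IperZ// !coefI => h.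
case: b {b1 b2 cp cd dphi} h => /= h; apply/eqP; rewrite eq_sym -subr_eq0; apply/eqP.
  have -> : Iper (fun x => f x * ebas false k x) = k%:R * Iper (fun x => prim f x * ebas true k x) by lra.
  by move: (pi^-1) => q; field; rewrite gt_eqF.
have -> : Iper (fun x => f x * ebas true k x) = - (k%:R * Iper (fun x => prim f x * ebas false k x)) by lra.
by move: (pi^-1) => q; field; rewrite gt_eqF.
Qed.

Lemma coef_cst (c : R) b k : coef (fun=> c) b k = if ~~ b && (k == 0)%N then c *+ 2 else 0.
Proof.
have h0 x : ebas false 0 x = 1 :> R by rewrite /ebas mul0r cos0.
have p0 : (pi : R) != 0 by rewrite gt_eqF// pi_gt0.
rewrite coefI; case: k => [|k].
  case: b => /=.
    rewrite (eq_Iper (g := fun=> 0)) ?Iper_cst ?mul0r ?mulr0// => x.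
    by rewrite /ebas mul0r sin0 mulr0.
  rewrite (eq_Iper (g := fun=> c)) => [|x]; last by rewrite -[LHS]/(c * ebas false 0 x) h0 mulr1.
  by rewrite Iper_cst mulrnAr mulrnAr mulrCA mulVf// mulr1.
rewrite andbF (eq_Iper (g := fun x => c * (ebas b k.+1 x * ebas false 0 x))) => [|x]; last by rewrite h0 mulr1.
rewrite IperZ; last by apply: contM; exact: ebas_continuous.
by rewrite Iper_ebas2// andbF mulr0 mulr0.
Qed.

(** The converse of [bessel]: it lets smallness of coefficients imply smallness in L2, as the
    continuity of the solution in L2 requires. *)
Lemma parseval_le f L : memL2 f -> zero_mean f ->
  (forall n, psum (fun k => coef f false k ^+ 2 + coef f true k ^+ 2) n <= L) ->
  Iper (fun x => f x ^+ 2) <= pi * L.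
Proof.
move=> fL f0 fl; have fi := memL2_integrable fL; have cG := prim_continuous fi.
pose v := coef (prim f).
have vE k : (0 < k)%N -> k%:R ^+ 2 * (v false k ^+ 2 + v true k ^+ 2) =
    coef f false k ^+ 2 + coef f true k ^+ 2.
  by move=> k0; rewrite /v !coef_prim//; field; rewrite pnatr_eq0 -lt0n.
have vL n : psum (fun k => k%:R ^+ 2 * (v false k ^+ 2 + v true k ^+ 2)) n <= L.
  by rewrite (eq_psum _ vE).
have [K hK] := @asum_pow2 R.
(* [|v| <= k^(-2) + k^2 v^2] turns square summability of [k v] into absolute summability of [v]. *)
have vK : sumu v (K + L).
  move=> b n; apply: le_trans (lerD (hK n) (vL n)); rewrite -psumD; apply: le_psum => k k0.
  have kp : 0 < k%:R :> R by rewrite ltr0n.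
  have h : `|v b k| <= k%:R ^- 2 + k%:R ^+ 2 * v b k ^+ 2.
    have := sqr_ge0 (k%:R^-1 - k%:R * `|v b k|).
    rewrite sqrrB exprVn exprMn real_normK ?num_real// mulrA mulVf ?gt_eqF// mul1r.
    have := normr_ge0 (v b k); lra.
  rewrite [`|k%:R ^- 2|]ger0_norm ?invr_ge0 ?sqr_ge0//; apply: le_trans h _; rewrite lerD2l.
  apply: ler_wpM2l; first exact: sqr_ge0.
  by case: b; rewrite ?lerDl ?lerDr sqr_ge0.
(* The coefficient [coef _ false 0] is twice the mean, hence the division by 2. *)
pose c := coef (prim f) false 0 / 2.
have ct := trig_continuous vK.
pose g x := prim f x - (c + trig v x).
have ch : continuous (fun x => c + trig v x).
  by apply: contD => //; exact: cst_continuous.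
have cg : continuous g by exact: contB.
have g0 b k : coef g b k = 0.
  rewrite /g coefB// coefD//; last exact: cst_continuous.
  rewrite coef_cst; case: k => [|k] /=; last by rewrite (coef_trig _ vK)// andbF add0r subrr.
  rewrite (coef_trig0 _ vK) addr0; case: b => /=.
    rewrite subr0 -[fsin _ _]/(coef (prim f) true 0) coefI (eq_Iper (g := fun=> 0)) ?Iper_cst ?mul0r ?mulr0// => x.
    by rewrite /ebas mul0r sin0 mulr0.
  by rewrite -mulr_natr /c mulfVK ?subrr// pnatr_eq0.
(* [prim f] is constant outside the period instead of periodic, so uniqueness of coefficients is
   used on the open period only. *)
have inside x : - pi < x < pi -> prim f x = c + trig v x.
  move=> hx; apply/eqP; rewrite -subr_eq0 eq_le (coef0_eq0_pos cg g0 hx)/=.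
  rewrite -oppr_le0; apply: (@coef0_eq0_pos _ (fun x => - g x)) => //.
    by move=> y; apply: cvgN; exact: cg.
  move=> b k; rewrite (eq_coef (g := fun x => -1 * g x)); last by move=> y; rewrite mulN1r.
  by rewrite coefZ// g0 mulr0.
have /choice[q hq] : forall n, exists q : R -> R, [/\ continuous q,
    (forall x, q x = n.+1%:R^-1^-1 * (trig v (x + n.+1%:R^-1) - trig v x)) &
    Iper (fun x => q x ^+ 2) <= pi * L].
  by move=> n; apply: trig_quotient_sqr vK vL; rewrite invr_eq0 pnatr_eq0.
pose g1 := f \_ (S1 R).
have g1i (A : set R) : measurable A -> leb.-integrable A (EFin \o g1).
  move=> mA; apply: (@integrableS _ _ _ _ setT) => //.
  by have /(integrable_mkcond _ mS) := fi; apply: eq_integrable => // x _; rewrite /= /g1 /patch; case: ifP.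
have gF x : - pi < x < pi -> \int[leb]_(t in `[- pi, x]) g1 t = prim f x.
  move=> /andP[x1 x2]; rewrite /prim clamp_id ?ltW//; apply: eq_Rintegral => y.
  rewrite inE/= in_itv/= => /andP[y1 y2]; rewrite /g1 patchE mem_set//.
  by rewrite /S1/= in_itv/= y1 (le_trans y2)// ltW.
pose F (y : R) : R := \int[leb]_(t in `[- pi, y]) g1 t.
(* Lebesgue's differentiation theorem; [f] has been cut off outside the period to be integrable on
   the line. *)
have ae1 : {ae leb, forall x : R, - pi < x < pi -> derivable F x 1 /\ derive1 F x = f x}.
  have := @FTC1 R g1 (BLeft (- pi)) (fun y => g1i _ (measurable_itv _)) (integrable_locally mS fi).
  apply: filterS; first exact: (ae_filter_ringOfSetsType leb).
  move=> x h /andP[x1 x2].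
  have [|d e] := h; first exact: x1.
  split; first exact: d.
  rewrite -[f x](_ : g1 x = _); first exact: e.
  by rewrite /g1 patchE mem_set// /S1/= in_itv/= !ltW.
have cq x : - pi < x < pi -> derivable F x 1 -> q n x @[n --> \oo] --> derive1 F x.
  move=> hx dF; rewrite derive1E.
  have h1 : h^-1 *: ((F \o shift x) (h *: 1) - F x) @[h --> 0^'] --> 'D_1 F x := dF.
  have h2 : @harmonic R @ \oo --> 0^'.
    move=> P hP; have : \forall n \near \oo, @harmonic R n != 0 -> P (@harmonic R n).
      by have := @cvg_harmonic R _ hP.
    by apply: filterS => n; apply; exact: lt0r_neq0 (harmonic_gt0 n).
  have h3 := cvg_comp _ _ h2 h1; apply: cvg_trans h3; apply: near_eq_cvg.
  have [x1 x2] := andP hx.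
  have hs : \forall n \near \oo, harmonic n < pi - x.
    by apply: (cvgr_lt _ (@cvg_harmonic R)); rewrite subr_gt0.
  near=> n; have [_ -> _] := hq n.
  rewrite /= [n.+1%:R^-1%:A](_ : _ = harmonic n); last exact: mulr1.
  have hn : 0 < harmonic n :> R by exact: harmonic_gt0.
  have hn2 : harmonic n < pi - x by near: n.
  have hx2 : - pi < harmonic n + x < pi by apply/andP; split; lra.
  rewrite /F (gF _ hx2) (gF _ hx) (inside _ hx2) (inside _ hx) [x + _]addrC.
  have e3 (u w z : R) : u + w - (u + z) = w - z by ring.
  by rewrite e3.
pose D : set (measurableTypeR R) := [set` `]- pi, pi[ : interval R].
have mD : measurable D by exact: measurable_itv.
have DS : D `<=` S1 R by exact: subset_itv_oo_cc.
have mf2 : measurable_fun (S1 R) (fun x => (f x ^+ 2)%:E).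
  by case/integrableP: (memL2_sqr_integrable fL).
have cq2 n : continuous (fun x => q n x ^+ 2).
  have [c1 _ _] := hq n; rewrite (_ : (fun x => _) = fun x => q n x * q n x); last exact/funext.
  exact: contM.
have mq2 n : measurable_fun D (fun x => (q n x ^+ 2)%:E).
  apply/measurable_EFinP; apply: measurable_funTS.
  by apply: continuous_measurable_fun.
have p0 := @pi_ge0 R.
suff h : (\int[leb]_(x in S1 R) (f x ^+ 2)%:E <= (pi * L)%:E)%E.
  rewrite -lee_fin /Iper /Rintegral fineK//.
  by have := integrable_fin_num mS (memL2_sqr_integrable fL).
rewrite /S1 integral_itv_bndoo; last exact: measurable_funS mf2.
rewrite -/D (@ae_eq_integral _ _ _ leb D (fun x => limn_einf (fun n => (q n x ^+ 2)%:E))) //; first last.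
- have : {ae leb, forall x : R, - pi < x < pi -> derivable F x 1 /\ derive1 F x = f x} := ae1.
  apply: filterS; first exact: (ae_filter_ringOfSetsType leb).
  move=> x h; rewrite /D/= in_itv/= => hx; have [d e] := h hx.
  have c1 := cq x hx d; rewrite e in c1.
  have c2 : (q n x ^+ 2)%:E @[n --> \oo] --> (f x ^+ 2)%:E.
    by apply: cvg_EFin; [exact: nearW|exact: cvgM].
  by rewrite (cvg_limn_einf_sup c2).1.
- apply: (measurableT_comp (@oppe_measurable R setT)).
  by apply: measurable_fun_limn_esup => n; apply: measurableT_comp => //; exact: mq2.
- exact: measurable_funS mf2.
apply: le_trans (fatou leb mD mq2 _) _; first by move=> n x _; rewrite lee_fin sqr_ge0.
rewrite limn_einf_lim; apply: lime_le; first exact: is_cvg_einfs.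
apply: nearW => n; apply: (@le_trans _ _ (\int[leb]_(x in D) (q n x ^+ 2)%:E)%E).
  by apply: ereal_inf_lbound; exists n => //=.
have -> : (\int[leb]_(x in D) (q n x ^+ 2)%:E = \int[leb]_(x in S1 R) (q n x ^+ 2)%:E)%E.
  by apply/esym; apply: integral_itv_bndoo; have := mq2 n.
have [_ _] := hq n; rewrite -lee_fin /Iper /Rintegral fineK//.
by have := integrable_fin_num mS (S1_integrable (cq2 n)).
Unshelve. all: by end_near. Qed.

End primitives.

(** * Sobolev norms as sums over the modes *)

Section sobolev_norms.
Context {R : realType}.
Notation leb := (@lebesgue_measure R).
Implicit Types (f g : R -> R) (u : bool -> nat -> R) (b : bool) (k n : nat) (s t A K L T : R).

Definition hterm s u k : R := (1 + k%:R ^+ 2) `^ s * ((u false k ^+ 2 + u true k ^+ 2) / 2).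

Lemma hterm_ge0 s u k : 0 <= hterm s u k.
Proof. by rewrite mulr_ge0 ?powR_ge0// divr_ge0// addr_ge0 ?sqr_ge0. Qed.

Lemma psum_hterm_nd s u : {homo (fun n => (psum (hterm s u) n)%:E) : m n / (m <= n)%N >-> (m <= n)%E}.
Proof. by move=> m n mn; rewrite lee_fin; apply: psum_nd => // k _; exact: hterm_ge0. Qed.

Let psum_cvg s u : cvgn (fun n => (psum (hterm s u) n)%:E).
Proof. exact: ereal_nondecreasing_is_cvgn (psum_hterm_nd s u). Qed.

Let normHE s f : coef f false 0 = 0 ->
  normH s f = sqrte (limn (fun n => (psum (hterm s (coef f)) n)%:E)).
Proof.
move=> f0; rewrite /normH -[fcos f 0]/(coef f false 0) f0 expr0n mul0r add0e.
congr (sqrte (limn _)); apply/funext => n.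
by rewrite sumEFin.
Qed.

Let lim_ge0 s u : (0 <= limn (fun n => (psum (hterm s u) n)%:E))%E.
Proof.
apply: lime_ge; first exact: psum_cvg.
by apply: nearW => n; rewrite lee_fin psum_ge0// => k _; exact: hterm_ge0.
Qed.

Lemma normH_sqr s f : coef f false 0 = 0 ->
  (normH s f ^+ 2 = limn (fun n => (psum (hterm s (coef f)) n)%:E))%E.
Proof. by move=> f0; rewrite normHE// sqr_sqrte. Qed.

Lemma normH_fin s f K : coef f false 0 = 0 -> asum_le (hterm s (coef f)) K ->
  normH s f = (Num.sqrt (tsum (hterm s (coef f))))%:E.
Proof.
move=> f0 hK; rewrite normHE//.
have -> : limn (fun n => (psum (hterm s (coef f)) n)%:E) = (tsum (hterm s (coef f)))%:E.
  by apply: cvg_lim => //; apply: cvg_EFin; [exact: nearW|exact: asum_cvg hK].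
by [].
Qed.

Lemma psum_le_normH s f A n : coef f false 0 = 0 -> 0 <= A -> (normH s f <= A%:E)%E ->
  psum (hterm s (coef f)) n <= A ^+ 2.
Proof.
move=> f0 A0; have A0e : (0 <= A%:E)%E by rewrite lee_fin.
rewrite -(lee_sqr (sqrte_ge0 _) A0e).
rewrite normH_sqr// => h; rewrite -lee_fin EFin_expe; apply: le_trans h.
have /cvg_lim -> // := ereal_nondecreasing_cvgn (psum_hterm_nd s (coef f)).
by apply: ereal_sup_ubound; exists n.
Qed.

End sobolev_norms.

(** * Continuity in L2 and continuity of the coefficients *)

Section coefficient_continuity.
Context {R : realType}.
Notation leb := (@lebesgue_measure R).
Implicit Types (f g : R -> R) (u : bool -> nat -> R) (b : bool) (k n : nat) (s t A K L T : R).

Let mS := @measurable_S1 R.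

Lemma coefB_memL2 f g b k : memL2 f -> memL2 g ->
  coef (fun x => f x - g x) b k = coef f b k - coef g b k.
Proof.
move=> fL gL; rewrite !coefI -mulrBr; congr (_ * _).
have ci h : memL2 h -> leb.-integrable (S1 R) (EFin \o (fun x => h x * ebas b k x)).
  by move=> hL; apply: mulr_continuous_integrable; [exact: memL2_integrable|exact: ebas_continuous].
rewrite /Iper -RintegralB//; [|exact: ci|exact: ci].
by apply: eq_Rintegral => x _; rewrite mulrBl.
Qed.

Lemma zero_meanB f g : memL2 f -> memL2 g -> zero_mean f -> zero_mean g ->
  zero_mean (fun x => f x - g x).
Proof.
move=> fL gL f0 g0; rewrite /zero_mean RintegralB// ?f0 ?g0 ?subrr//; exact: memL2_integrable.
Qed.

Lemma coef_le_normL2 f b k : memL2 f -> (0 < k)%N -> `|coef f b k| <= fine (normL2 f).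
Proof.
move=> fL k0; rewrite normL2E//=.
rewrite -(sqrtr_sqr (coef f b k)) ler_sqrt; last by apply: Rintegral_ge0 => x _; exact: sqr_ge0.
apply: le_trans (bessel k.+1 fL).
have h : coef f b k ^+ 2 <= psum (fun k => coef f false k ^+ 2 + coef f true k ^+ 2) k.+1.
  apply: le_trans (@psum_term _ (fun k => coef f false k ^+ 2 + coef f true k ^+ 2) k k.+1 _ k0 (leqnn _)).
    by case: b; rewrite ?lerDl ?lerDr sqr_ge0.
  by move=> j _; rewrite addr_ge0 ?sqr_ge0.
apply: le_trans h _; apply: ler_peMl; last by have := @pi_ge2 R; lra.
by apply: psum_ge0 => j _; rewrite addr_ge0 ?sqr_ge0.
Qed.

Lemma contL2_coef T B b k t0 : contL2 T B -> (0 < k)%N -> t0 \in `[0, T[ ->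
  coef (B t) b k @[t --> within `[0, T[ (nbhs t0)] --> coef (B t0) b k.
Proof.
move=> [BL Bc] k0 tT; have /fine_cvgP[_ h] := Bc _ tT.
apply/cvgrPdist_le => e e0.
move/cvgrPdist_le : h => /(_ _ e0) h.
have hw : \forall t \near within `[0, T[ (nbhs t0), t \in `[0, T[.
  by apply: withinT; exact: filter_filter.
near=> t.
have tI : t \in `[0, T[ by near: t.
have tL := BL _ tI; have t0L := BL _ tT.
rewrite distrC -coefB_memL2//; apply: le_trans (coef_le_normL2 b (memL2B tL t0L) k0) _.
have : `|0 - fine (normL2 (fun x => B t x - B t0 x))| <= e by near: t; exact: h.
by rewrite sub0r normrN; apply: le_trans; exact: ler_norm.
Unshelve. all: by end_near. Qed.

(** [parseval_le] bounds the L2 distance by the l2 distance of the coefficients, which tends to 0 by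
    dominated convergence. The majorant is [8 g]: each squared difference is at most [4 g], and
    there are two families. *)
Lemma coef_contL2 T B (g : nat -> R) K :
  (forall t, t \in `[0, T[ -> memL2 (B t) /\ zero_mean (B t)) ->
  asum_le g K ->
  (forall t b k, t \in `[0, T[ -> (0 < k)%N -> coef (B t) b k ^+ 2 <= g k) ->
  (forall t0 b k, t0 \in `[0, T[ -> (0 < k)%N ->
     coef (B t) b k @[t --> within `[0, T[ (nbhs t0)] --> coef (B t0) b k) ->
  contL2 T B.
Proof.
move=> BL gK Bg Bc; split=> [t /BL[]//|t0 t0T]; have [t0L t00] := BL _ t0T.
pose D t k := (coef (B t) false k - coef (B t0) false k) ^+ 2 +
  (coef (B t) true k - coef (B t0) true k) ^+ 2.
have D0 t k : 0 <= D t k by rewrite addr_ge0 ?sqr_ge0.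
have Dg t k : t \in `[0, T[ -> (0 < k)%N -> `|D t k| <= 8 * g k.
  move=> tT k0; rewrite ger0_norm//.
  have sq b : (coef (B t) b k - coef (B t0) b k) ^+ 2 <= 4 * g k.
    have := Bg t b k tT k0; have := Bg t0 b k t0T k0.
    have := sqr_ge0 (coef (B t) b k + coef (B t0) b k).
    by move: (coef _ _ _) (coef _ _ _) => x y; nra.
  by rewrite /D; have := sq false; have := sq true; lra.
have g8 : asum_le (fun k => 8 * g k) (`|8| * K) by exact: asum_leZ.
have hw : \forall t \near within `[0, T[ (nbhs t0), t \in `[0, T[.
  by apply: withinT; exact: filter_filter.
have Dc : tsum (D t) @[t --> within `[0, T[ (nbhs t0)] --> tsum (fun=> 0 : R).
  apply: tannery g8 _ _ _.
  - by move=> k k0; rewrite normr0; apply: le_trans (Dg _ _ t0T k0).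
  - by near=> t; move=> k k0; apply: Dg => //; near: t.
  - move=> k k0; rewrite -[X in _ --> X](_ : 0 ^+ 2 + 0 ^+ 2 = 0); last by rewrite expr0n addr0.
    have c b : coef (B t) b k - coef (B t0) b k @[t --> within `[0, T[ (nbhs t0)] --> (0 : R).
      by rewrite -[X in _ --> X](subrr (coef (B t0) b k)); apply: cvgB; [exact: Bc|exact: cvg_cst].
    by apply: cvgD; apply: cvgM; exact: c.
rewrite tsum0 in Dc.
have sc : Num.sqrt (pi * tsum (D t)) @[t --> within `[0, T[ (nbhs t0)] --> (0 : R).
  rewrite -[X in _ --> X](_ : Num.sqrt (pi * 0) = 0); last by rewrite mulr0 sqrtr0.
  apply: continuous_cvg; first exact: sqrt_continuous.
  by apply: cvgM; [exact: cvg_cst|exact: Dc].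
apply/fine_cvgP; split.
  near=> t; have tI : t \in `[0, T[ by near: t.
  by have [tL _] := BL _ tI; rewrite normL2E//; exact: memL2B.
apply: (squeeze_cvgr _ (cvg_cst (0 : R)) sc).
near=> t; have tI : t \in `[0, T[ by near: t.
have [tL tz] := BL _ tI; have dL := memL2B tL t0L.
rewrite /= normL2E//= sqrtr_ge0/= ler_sqrt; last first.
  apply: mulr_ge0; first exact: pi_ge0.
  apply: (@tsum_ge0 _ _ (`|8| * K)); last by move=> k _; exact: D0.
  apply: asum_leW g8 => k k0; apply: le_trans (Dg _ _ tI k0) _; exact: ler_norm.
apply: parseval_le => //; first exact: zero_meanB.
move=> n; have Da : asum_le (D t) (`|8| * K).
  by apply: asum_leW g8 => k k0; apply: le_trans (Dg _ _ tI k0) _; exact: ler_norm.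
rewrite (@eq_psum _ _ (D t)) => [|k k0]; last by rewrite !coefB_memL2.
have := @nondecreasing_cvgn_le _ (psum (D t)) _ _ n; apply.
  by move=> i j ij; apply: psum_nd.
by apply/cvg_ex; exists (tsum (D t)); exact: asum_cvg Da.
Unshelve. all: by end_near. Qed.

End coefficient_continuity.

(** * Continuity, smoothing and integrability of the constructed solution *)

Section smoothing.
Context {R : realType}.
#[local] Opaque ncoef duhamel.
Implicit Types (t s x : R) (b : bool) (k n : nat).

Lemma powR_le_expR (q la : R) : 0 <= q -> 0 < la ->
  exists C, 0 <= C /\ forall z, 0 <= z -> z `^ q <= C * expR (la * z).
Proof.
move=> q0 la0; pose n := (Num.trunc q).+1.
have qn : q <= n%:R by apply: ltW; exact: truncnS_gt.
have n0 : 0 < la ^+ n by exact: exprn_gt0.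
exists (1 + n%:R ^+ n / la ^+ n); split.
  by rewrite addr_ge0// divr_ge0 ?exprn_ge0// ltW.
move=> z z0; have lz : 0 <= la * z by rewrite mulr_ge0// ltW.
apply: (@le_trans _ _ (1 + z `^ n%:R)); first by apply: powR_le1D => //; rewrite q0.
rewrite powR_mulrn// mulrDl mul1r; apply: lerD; first by rewrite -expR0 ler_expR.
rewrite mulrAC ler_pdivlMr// -exprMn [z * _]mulrC; exact: exp_ge_pow.
Qed.

Variables (mu al ca cb T M : R) (B0 : R -> R) (v : R -> bool -> nat -> R).
Hypotheses (mu0 : 0 < mu) (al2 : 5 / 2 < al) (T0 : 0 < T) (M0 : 0 < M).
Hypotheses (B0L : memL2 B0) (B0z : zero_mean B0).
Let u0 := coef B0.
Let la := rate mu al.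
Let r := 2 / al.
Hypothesis vA : admissible mu al T M v.
Hypothesis vD : forall t b k, 0 < t < T -> (0 < k)%N ->
  is_derive t (1 : R) (fun s => v s b k)
    (ncoef ca cb (v t) (v t) b k - mu * k%:R `^ al * v t b k).
Hypothesis vB : forall t b k, 0 < t < T -> (0 < k)%N ->
  `|v t b k - heat mu al u0 t b k| <= M * barrier mu al r la k%:R t.

Let v_fast t : 0 < t < T -> fast (v t).
Proof. exact: admissible_fast (ltW M0) vA. Qed.

(** At [t = 0] the datum itself is taken, because its Fourier series need not converge pointwise. *)
Definition flow t x : R := if t == 0 then B0 x else trig (v t) x.

Definition flow_coef t b k : R := if t == 0 then u0 b k else v t b k.

Lemma coef_flow t b k : 0 <= t < T -> (0 < k)%N -> coef (flow t) b k = flow_coef t b k.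
Proof.
move=> /andP[t0 tT] k0; rewrite /flow /flow_coef.
have [t00|tn0] := eqVneq t 0; first exact: eq_coef.
have tI : 0 < t < T by rewrite tT lt_neqAle eq_sym tn0 t0.
by have [K hK] := fast_sum (v_fast tI); rewrite (coef_trig _ hK).
Qed.

Lemma flow_memL2 t : 0 <= t < T -> memL2 (flow t) /\ zero_mean (flow t).
Proof.
move=> /andP[t0 tT]; rewrite /flow; have [t00|tn0] := eqVneq t 0; first by [].
have tI : 0 < t < T by rewrite tT lt_neqAle eq_sym tn0 t0.
have [K hK] := fast_sum (v_fast tI); split.
  by apply: continuous_memL2; [exact: trig_continuous hK|exact: trig_periodic].
by apply: coef0_zero_mean; exact: coef_trig0 hK.
Qed.

Lemma coef0_flow t : 0 <= t < T -> coef (flow t) false 0 = 0.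
Proof. by move=> /flow_memL2[_ z]; exact: (zero_mean_coef z false). Qed.

(** The decay given by [barrier_uniform] to the Duhamel part; it is square summable because
    [al - 2 > 1 / 2]. *)
Definition tail k : R := k%:R `^ (- (al - 2)).

(** Independent of time: it dominates the squares of the coefficients, up to constants, in all
    limits in [t] taken below. *)
Definition majorant k : R := (`|u0 false k| + tail k) ^+ 2 + (`|u0 true k| + tail k) ^+ 2.

Lemma majorant_ge0 k : 0 <= majorant k.
Proof. by rewrite addr_ge0 ?sqr_ge0. Qed.

Lemma majorant_sum : exists K, asum_le majorant K.
Proof.
have [K hK] : exists K, asum_le (fun k => k%:R `^ (- (2 * (al - 2))) : R) K.
  by apply: asum_powR; move: (al2); lra.
have uK : asum_le (fun k => u0 false k ^+ 2 + u0 true k ^+ 2) (pi^-1 * Iper (fun x => B0 x ^+ 2)).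
  move=> n; rewrite ler_pdivlMl ?pi_gt0//; apply: le_trans (bessel n B0L).
  apply: ler_wpM2l; first exact: pi_ge0.
  by apply: le_psum => k _; rewrite ger0_norm// addr_ge0 ?sqr_ge0.
exists (`|2| * (pi^-1 * Iper (fun x => B0 x ^+ 2)) + `|4| * K).
apply: asum_leW (asum_leD (asum_leZ 2 uK) (asum_leZ 4 hK)) => k k0.
rewrite ger0_norm ?majorant_ge0// [leRHS]ger0_norm; last first.
  by apply: addr_ge0; rewrite mulr_ge0 ?powR_ge0// addr_ge0 ?sqr_ge0.
have -> : k%:R `^ (- (2 * (al - 2))) = tail k ^+ 2 :> R.
  by rewrite /tail -powR_mulrn ?powR_ge0// -powRrM; congr (_ `^ _); ring.
rewrite /majorant; move: (u0 false k) (u0 true k) (tail k) => p q w.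
have e z : (`|z| + w) ^+ 2 <= 2 * z ^+ 2 + 2 * w ^+ 2.
  rewrite -(real_normK (num_real z)); have := sqr_ge0 (`|z| - w).
  by move: (`|z|) => y; nra.
by have := e p; have := e q; lra.
Qed.

(** [weight_heat] bounds the heat part by the datum, and [barrier_uniform] bounds the difference to
    it by [tail]. *)
Lemma flow_decay : exists C, 0 <= C /\ forall t b k, 0 < t < T -> (0 < k)%N ->
  expR (la * t `^ al^-1 * k%:R) * `|v t b k| <= C * (`|u0 b k| + tail k).
Proof.
have [C1 [C10 hC1]] := weight_heat mu0 al2.
have [a0 r0 r1 _ _] := exponent_facts al2.
have [la0 _ _] := rate_facts mu0 al2.
have rp : 0 < 1 - 2 / al by move: r1; lra.
pose C2 := M * (2 / (1 - 2 / al) * (1 + 4 / mu)).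
have C20 : 0 <= C2.
  rewrite mulr_ge0 ?(ltW M0)// mulr_ge0// ?divr_ge0 ?(ltW rp)//.
  by have := divr_gt0 (ltr0n R 4) mu0; lra.
exists (C1 + C2); split; first by lra.
move=> t b k tT k0; have /andP[t0 _] := tT.
set e := expR _; have e0 : 0 <= e by exact: expR_ge0.
have h1 : e * `|heat mu al u0 t b k| <= C1 * `|u0 b k|.
  rewrite /heat normrM mulrA; apply: ler_wpM2r => //.
  rewrite [`|expR _|]ger0_norm ?expR_ge0//; apply: le_trans (hC1 t k t0 k0).
  apply: ler_wpM2r; first exact: expR_ge0.
  rewrite /weight -/la -/e ler_peMr// exprn_ege1// lerDl mulr_ge0 ?powR_ge0//.
have h2 : e * `|v t b k - heat mu al u0 t b k| <= C2 * tail k.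
  apply: le_trans (ler_wpM2l e0 (vB b tT k0)) _.
  rewrite mulrCA /C2 -mulrA; apply: ler_wpM2l; first exact: ltW.
  exact: (barrier_uniform la mu0 al2 k0 t0).
have -> : v t b k = heat mu al u0 t b k + (v t b k - heat mu al u0 t b k) by rewrite addrC subrK.
apply: le_trans (ler_wpM2l e0 (ler_normD _ _)) _; rewrite mulrDr.
have t1 : 0 <= tail k by exact: powR_ge0.
have n1 := normr_ge0 (u0 b k).
by have := mulr_ge0 C20 n1; have := mulr_ge0 (le_trans ler01 C10) t1; lra.
Qed.

Lemma flow_decay_sqr : exists C, 0 <= C /\
  (forall t k, 0 < t < T -> (0 < k)%N ->
    expR (2 * la * t `^ al^-1 * k%:R) * (v t false k ^+ 2 + v t true k ^+ 2) <= C * majorant k) /\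
  (forall t b k, 0 <= t < T -> (0 < k)%N -> flow_coef t b k ^+ 2 <= C * majorant k).
Proof.
have [la0 _ _] := rate_facts mu0 al2.
have [C [C0 hC]] := flow_decay.
have tl k : 0 <= tail k by exact: powR_ge0.
have key t k : 0 < t < T -> (0 < k)%N ->
    expR (2 * la * t `^ al^-1 * k%:R) * (v t false k ^+ 2 + v t true k ^+ 2) <= C ^+ 2 * majorant k.
  move=> tT k0; have -> : expR (2 * la * t `^ al^-1 * k%:R) = expR (la * t `^ al^-1 * k%:R) ^+ 2.
    by rewrite -expRM_natl; congr expR; ring.
  have sq b : expR (la * t `^ al^-1 * k%:R) ^+ 2 * v t b k ^+ 2 <= C ^+ 2 * (`|u0 b k| + tail k) ^+ 2.
    rewrite -[v t b k ^+ 2]real_normK ?num_real// -!exprMn ler_pXn2r ?nnegrE//; first exact: hC.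
    by apply: mulr_ge0 => //; exact: addr_ge0.
  by rewrite /majorant !mulrDr; apply: lerD.
exists (C ^+ 2 + 1); split; first by have := sqr_ge0 C; lra.
have mj k := majorant_ge0 k.
split=> [t k tT k0|t b k /andP[t0 tT] k0].
  by apply: le_trans (key t k tT k0) _; apply: ler_wpM2r => //; lra.
rewrite /flow_coef; have [_|tn0] := eqVneq t 0.
  have h : u0 b k ^+ 2 <= majorant k.
    have e c : u0 c k ^+ 2 <= (`|u0 c k| + tail k) ^+ 2.
      rewrite -(real_normK (num_real (u0 c k))) ler_pXn2r ?nnegrE ?lerDl//; exact: addr_ge0.
    by rewrite /majorant; case: b; [rewrite -[leLHS]add0r|rewrite -[leLHS]addr0]; apply: lerD => //; exact: sqr_ge0.
  by apply: le_trans h _; have := mulr_ge0 (sqr_ge0 C) (mj k); lra.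
have tI : 0 < t < T by rewrite tT lt_neqAle eq_sym tn0 t0.
have h : v t b k ^+ 2 <= C ^+ 2 * majorant k.
  apply: le_trans (key t k tI k0); set s := _ + _.
  have s1 : v t b k ^+ 2 <= s by rewrite /s; case: b; rewrite ?lerDl ?lerDr sqr_ge0.
  apply: le_trans s1 _; apply: ler_peMl; first by rewrite addr_ge0 ?sqr_ge0.
  rewrite -expR0 ler_expR; apply: mulr_ge0 => //; apply: mulr_ge0; last exact: powR_ge0.
  by apply: mulr_ge0 => //; exact: ltW.
by apply: le_trans h _; apply: ler_wpM2r => //; lra.
Qed.

(** Only [t0 = 0] is delicate: there the distance to the heat flow is squeezed by the barrier, which
    tends to 0 for each fixed [k]. *)
Lemma flow_coef_cvg t0 b k : t0 \in `[0, T[ -> (0 < k)%N ->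
  flow_coef t b k @[t --> within `[0, T[ (nbhs t0)] --> flow_coef t0 b k.
Proof.
have [la0 la1 la2'] := rate_facts mu0 al2; have [a0 r0 r1 _ _] := exponent_facts al2.
rewrite in_itv/= => /andP[t00 t0T] k0; move: t00; rewrite le_eqVlt => /predU1P[<-|t0p].
- have kp : 0 < k%:R :> R by rewrite ltr0n.
  have hc : heat mu al u0 t b k @[t --> 0^'+] --> u0 b k.
    have h0 : heat mu al u0 0 b k = u0 b k by rewrite /heat mulr0 oppr0 expR0 mul1r.
    rewrite -[X in _ --> X]h0; apply: cvg_at_right_filter.
    exact: (is_derive_continuous (heat_derive mu al u0 0 b k)).
  have bc : M * barrier mu al r la k%:R t @[t --> 0^'+] --> (0 : R).
    rewrite -[X in _ --> X](mulr0 M); apply: cvgMr.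
    apply: barrier_cvg0 => //; last exact: ltW.
      by move: (al2); lra.
    by apply/andP; split.
  have vc : v t b k @[t --> 0^'+] --> u0 b k.
    have dc : v t b k - heat mu al u0 t b k @[t --> 0^'+] --> (0 : R).
      apply/norm_cvg0P; apply: (squeeze_cvgr _ (cvg_cst (0 : R)) bc).
      near=> t; rewrite normr_ge0/=; apply: vB => //; apply/andP; split; first by near: t; exact: nbhs_right_gt.
      by near: t; exact: nbhs_right_lt.
    rewrite -[X in _ --> X](add0r (u0 b k)).
    rewrite (_ : (fun t => v t b k) = fun t => v t b k - heat mu al u0 t b k + heat mu al u0 t b k); last first.
      by apply/funext => t; rewrite subrK.
    exact: cvgD.
  apply/cvgrPdist_le => e e0; move/cvgrPdist_le : vc => /(_ _ e0) h.
  have h' : \forall t \near (0 : R), 0 < t -> `|u0 b k - v t b k| <= e by exact: h.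
  have h2 : \forall t \near (0 : R), `[0, T[%classic t -> `|flow_coef 0 b k - flow_coef t b k| <= e.
    near=> t => /=; rewrite in_itv/= => /andP[tg0 _]; rewrite /flow_coef eqxx.
    have [_|tn0] := eqVneq t 0; first by rewrite subrr normr0 ltW.
    have tp : 0 < t by rewrite lt_neqAle eq_sym tn0.
    by move: tp; near: t; exact: h'.
  exact: h2.
- apply: cvg_within_filter.
  have c : v t b k @[t --> t0] --> v t0 b k by have [_ vc] := vA; apply: vc => //; rewrite t0p.
  rewrite /flow_coef gt_eqF//; apply: cvg_trans c; apply: near_eq_cvg; near=> t.
  have tp : 0 < t by near: t; exact: lt_nbhsr.
  by rewrite gt_eqF.
Unshelve. all: by end_near. Qed.

Lemma flow_contL2 : contL2 T flow.
Proof.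
have [C [C0 [_ hC]]] := flow_decay_sqr; have [K hK] := majorant_sum.
apply: (coef_contL2 (g := fun k => C * majorant k) (K := `|C| * K)).
- by move=> t; rewrite in_itv; exact: flow_memL2.
- exact: asum_leZ.
- by move=> t b k; rewrite in_itv/= => tT k0; rewrite coef_flow//; exact: hC.
- move=> t0 b k t0T k0; have := @flow_coef_cvg t0 b k t0T k0.
  rewrite coef_flow//.
  apply: cvg_trans; apply: near_eq_cvg.
  have hw : \forall t \near within `[0, T[ (nbhs t0), t \in `[0, T[.
    by apply: withinT; exact: filter_filter.
  near=> t; rewrite coef_flow//.
  have : t \in `[0, T[ by near: t.
  by rewrite in_itv.
Unshelve. all: by end_near. Qed.

(* [(1 + k^2)^q <= 2^q k^(2q)] and [z^(2q) <= C exp(2 la z)] with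
   [z = t^(1/al) k]. *)
Lemma flow_hterm q : 0 <= q -> exists C, 0 <= C /\ forall t k, 0 < t < T -> (0 < k)%N ->
  t `^ (2 * (q / al)) * hterm q (coef (flow t)) k <= C * majorant k.
Proof.
move=> q0; have [la0 _ _] := rate_facts mu0 al2; have [a0 _ _ _ _] := exponent_facts al2.
have [C1 [C10 [hC1 _]]] := flow_decay_sqr.
have q2 : 0 <= 2 * q by lra.
have l2 : 0 < 2 * la by rewrite mulr_gt0.
have [C2 [C20 hC2]] := powR_le_expR q2 l2.
exists (2 `^ q * (C2 * C1)); split.
  by apply: mulr_ge0; [exact: powR_ge0|exact: mulr_ge0].
move=> t k tT k0; have /andP[t0 tT'] := tT.
have kp : 1 <= k%:R :> R by rewrite ler1n.
have k00 : 0 <= k%:R :> R by [].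
rewrite /hterm !coef_flow ?(ltW t0)// /flow_coef gt_eqF//.
set S := v t false k ^+ 2 + v t true k ^+ 2.
have S0 : 0 <= S by rewrite addr_ge0 ?sqr_ge0.
have p1 : (1 + k%:R ^+ 2) `^ q <= 2 `^ q * k%:R `^ (2 * q) :> R.
  rewrite powRrM (powR_mulrn 2 k00) -powRM ?exprn_ge0//; apply: ge0_ler_powR => //.
  - by rewrite nnegrE addr_ge0// sqr_ge0.
  - by rewrite nnegrE mulr_ge0// sqr_ge0.
  - by have := exprn_ege1 2 kp; lra.
have p2 : t `^ (2 * (q / al)) * k%:R `^ (2 * q) = (t `^ al^-1 * k%:R) `^ (2 * q).
  rewrite powRM ?powR_ge0// -powRrM; congr (t `^ _ * _); ring.
have p3 := hC2 (t `^ al^-1 * k%:R) (mulr_ge0 (powR_ge0 _ _) k00).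
have p4 := hC1 t k tT k0; rewrite -/S in p4.
have p2q : 0 <= 2 `^ q :> R := powR_ge0 _ _.
apply: (@le_trans _ _ (2 `^ q * ((t `^ al^-1 * k%:R) `^ (2 * q) * S))).
  rewrite -p2 [leRHS](_ : _ = t `^ (2 * (q / al)) * ((2 `^ q * k%:R `^ (2 * q)) * S)); last by ring.
  apply: ler_wpM2l; first exact: powR_ge0.
  apply: ler_pM => //; [by rewrite divr_ge0|by lra].
rewrite -mulrA; apply: ler_wpM2l => //.
apply: le_trans (ler_wpM2r S0 p3) _; rewrite -[leLHS]mulrA -[leRHS]mulrA; apply: ler_wpM2l => //.
by move: p4; rewrite !mulrA.
Qed.

Lemma flow_weighted_normH q t : 0 <= q -> 0 < t < T ->
  ((t `^ (q / al))%:E * normH q (flow t))%E =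
  (Num.sqrt (tsum (fun k => t `^ (2 * (q / al)) * hterm q (coef (flow t)) k)))%:E.
Proof.
move=> q0 tT; have /andP[t0 tT'] := tT.
have [C [C0 hC]] := flow_hterm q0; have [K hK] := majorant_sum.
have p0 : 0 < t `^ (2 * (q / al)) by exact: powR_gt0.
have hS : asum_le (fun k => t `^ (2 * (q / al)) * hterm q (coef (flow t)) k) (`|C| * K).
  apply: asum_leW (asum_leZ C hK) => k k0.
  rewrite ger0_norm; last by apply: mulr_ge0; [exact: powR_ge0|exact: hterm_ge0].
  by apply: le_trans (hC t k tT k0) _; exact: ler_norm.
have hS2 : asum_le (hterm q (coef (flow t))) (`|(t `^ (2 * (q / al)))^-1| * (`|C| * K)).
  apply: asum_leW (asum_leZ _ hS) => k k0.
  by rewrite mulrA mulVf ?mul1r// gt_eqF.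
rewrite (normH_fin _ hS2); last by rewrite coef0_flow// ltW.
rewrite -EFinM (tsumZ _ hS2) sqrtrM ?(ltW p0)//; congr (_ * _)%:E.
have -> : t `^ (2 * (q / al)) = (t `^ (q / al)) ^+ 2.
  by rewrite -powR_mulrn ?powR_ge0// -powRrM mulrC.
by rewrite sqrtr_sqr ger0_norm ?powR_ge0.
Qed.

Lemma flow_sup q : 0 <= q ->
  (ereal_sup [set (t `^ (q / al))%:E * normH q (flow t) | t in [set t : R | 0 < t < T]%R] < +oo)%E.
Proof.
move=> q0; have [C [C0 hC]] := flow_hterm q0; have [K hK] := majorant_sum.
apply: (@le_lt_trans _ _ (Num.sqrt (`|C| * K))%:E); last exact: ltry.
apply: ge_ereal_sup => _ [t /= tT <-]; rewrite flow_weighted_normH// lee_fin ler_sqrt; last first.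
  by rewrite mulr_ge0//; exact: asum_le_ge0 hK.
apply: le_trans (ler_norm _) _; apply: tsum_le; apply: asum_leW (asum_leZ C hK) => k k0.
rewrite ger0_norm; last by apply: mulr_ge0; [exact: powR_ge0|exact: hterm_ge0].
by apply: le_trans (hC t k tT k0) _; exact: ler_norm.
Qed.

(** For [q > 0] each single mode carries a positive power of [t] and tends to 0, while [flow_hterm]
    dominates uniformly in [t]. *)
Lemma flow_lim q : 0 < q ->
  ((t `^ (q / al))%:E * normH q (flow t))%E @[t --> 0^'+] --> 0%E.
Proof.
move=> q0; have [a0 _ _ _ _] := exponent_facts al2.
have [C [C0 hC]] := flow_hterm (ltW q0); have [K hK] := majorant_sum.
have [D [D0 [_ hD]]] := flow_decay_sqr.
have inT : \forall t \near (0 : R)^'+, 0 < t < T.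
  near=> t; apply/andP; split; near: t; [exact: nbhs_right_gt|exact: nbhs_right_lt].
have h : tsum (fun k => t `^ (2 * (q / al)) * hterm q (coef (flow t)) k) @[t --> 0^'+] --> tsum (fun=> 0 : R).
  apply: tannery (asum_leZ C hK) _ _ _.
  - by move=> k _; rewrite normr0; apply: mulr_ge0 => //; exact: majorant_ge0.
  - near=> t; move=> k k0; have tT : 0 < t < T by near: t.
    rewrite ger0_norm; last by apply: mulr_ge0; [exact: powR_ge0|exact: hterm_ge0].
    exact: hC.
  - move=> k k0; pose c := (1 + k%:R ^+ 2) `^ q * (D * majorant k).
    have pc : c * t `^ (2 * (q / al)) @[t --> 0^'+] --> (0 : R).
      rewrite -[X in _ --> X](mulr0 c); apply: cvgMr; apply: powR_cvg0.
      by rewrite mulr_gt0// divr_gt0.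
    apply: (squeeze_cvgr _ (cvg_cst (0 : R)) pc); near=> t.
    have tT : 0 < t < T by near: t.
    have /andP[tp tT'] := tT; have tT2 : 0 <= t < T by rewrite ltW.
    apply/andP; split; first by apply: mulr_ge0; [exact: powR_ge0|exact: hterm_ge0].
    rewrite mulrC; apply: ler_wpM2r; first exact: powR_ge0.
    rewrite /hterm /c !coef_flow//; apply: ler_wpM2l; first exact: powR_ge0.
    by have := hD t false k tT2 k0; have := hD t true k tT2 k0; lra.
rewrite tsum0 in h.
have h2 : Num.sqrt (tsum (fun k => t `^ (2 * (q / al)) * hterm q (coef (flow t)) k)) @[t --> 0^'+] --> (0 : R).
  rewrite -[X in _ --> X]sqrtr0; apply: continuous_cvg => //; exact: sqrt_continuous.
have h3 : (Num.sqrt (tsum (fun k => t `^ (2 * (q / al)) * hterm q (coef (flow t)) k)))%:E @[t --> 0^'+] --> 0%:E.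
  by apply: cvg_EFin; [exact: nearW|exact: h2].
apply: cvg_trans h3; apply: near_eq_cvg; near=> t.
have tT : 0 < t < T by near: t.
by rewrite flow_weighted_normH// ltW.
Unshelve. all: by end_near. Qed.

(** The heat part gives [mu k^al exp (- 2 mu k^al t)], the time derivative of a bounded function.
    For the rest [D], the weighted barrier gives [z^(al/2) |D| <= C3 t^gain k^(-decay_exp)] with
    [z = t^(1/al) k]; squaring and dividing by [t], since [z^al = t k^al], leaves [t^(2 gain - 1)],
    integrable at 0 because [gain > 0]. *)
Lemma flow_energy : exists E1 E2, [/\ 0 <= E1, 0 <= E2 & forall t k, 0 < t < T -> (0 < k)%N ->
  hterm (al / 2) (coef (flow t)) k <=
  E1 * (mu * k%:R `^ al * expR (- (2 * mu * k%:R `^ al * t)) * (u0 false k ^+ 2 + u0 true k ^+ 2)) +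
  E2 * (t `^ (- (1 - 2 * gain al)) * k%:R `^ (- (2 * decay_exp al)))].
Proof.
have [la0 la1 la2'] := rate_facts mu0 al2; have [a0 r0 r1 /andP[kp1 kp2] g0] := exponent_facts al2.
have a20 : 0 <= al / 2 by lra.
have [C2 [C20 hC2]] := powR_le_expR a20 la0.
have rp : 0 < 1 - 2 / al by move: r1; lra.
pose Cw := 2 / (1 - 2 / al) * (4 * (1 + 4 / mu)).
have Cw0 : 0 <= Cw.
  rewrite /Cw mulr_ge0 ?divr_ge0 ?(ltW rp)//.
  by have := divr_gt0 (ltr0n R 4) mu0; lra.
pose C3 := M * (C2 * Cw).
exists (2 `^ (al / 2) / mu), (2 `^ (al / 2) * (2 * C3 ^+ 2)); split.
- by apply: divr_ge0; [exact: powR_ge0|exact: ltW].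
- by apply: mulr_ge0; [exact: powR_ge0|rewrite mulr_ge0// sqr_ge0].
move=> t k tT k0; have /andP[t0 tT'] := tT; have tT2 : 0 <= t < T by rewrite ltW.
have kp : 1 <= k%:R :> R by rewrite ler1n.
have k00 : 0 <= k%:R :> R by [].
pose X : R := k%:R `^ al; have X0 : 0 <= X by exact: powR_ge0.
have p1 : (1 + k%:R ^+ 2) `^ (al / 2) <= 2 `^ (al / 2) * X :> R.
  have -> : X = (k%:R ^+ 2) `^ (al / 2) by rewrite -(powR_mulrn 2 k00) -powRrM; congr (_ `^ _); field.
  rewrite -powRM ?exprn_ge0//; apply: ge0_ler_powR => //.
  - by rewrite nnegrE addr_ge0// sqr_ge0.
  - by rewrite nnegrE mulr_ge0// sqr_ge0.
  - by have := exprn_ege1 2 kp; lra.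
pose D b := v t b k - heat mu al u0 t b k.
have hX b : X * heat mu al u0 t b k ^+ 2 = X * expR (- (2 * mu * X * t)) * u0 b k ^+ 2.
  have -> : expR (- (2 * mu * X * t)) = expR (- (mu * X * t)) ^+ 2.
    by rewrite -expRM_natl; congr expR; ring.
  by rewrite /heat -/X exprMn mulrA.
have hD b : X * D b ^+ 2 <= C3 ^+ 2 * (t `^ (- (1 - 2 * gain al)) * k%:R `^ (- (2 * decay_exp al))).
  have z0 : 0 <= t `^ al^-1 * k%:R by rewrite mulr_ge0 ?powR_ge0.
  pose W := weight la al t k.
  have zW : (t `^ al^-1 * k%:R) `^ (al / 2) <= C2 * W.
    apply: le_trans (hC2 _ z0) _; apply: ler_wpM2l => //.
    by rewrite /W /weight -/la mulrA ler_peMr ?expR_ge0// exprn_ege1// lerDl.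
  have hb : W * barrier mu al r la k%:R t <= Cw * (t `^ gain al * k%:R `^ (- decay_exp al)).
    by apply: barrier_weight => //; apply/andP; split; [lra|exact: ltW].
  have W0 : 0 <= W by apply: mulr_ge0; [exact: expR_ge0|exact: sqr_ge0].
  have h1 : (t `^ al^-1 * k%:R) `^ (al / 2) * `|D b| <= C3 * (t `^ gain al * k%:R `^ (- decay_exp al)).
    apply: le_trans (ler_wpM2r (normr_ge0 _) zW) _.
    have h2 := ler_wpM2l (mulr_ge0 C20 W0) (vB b tT k0).
    apply: le_trans h2 _.
    rewrite (_ : C2 * W * _ = M * C2 * (W * barrier mu al r la k%:R t)); last by ring.
    rewrite (_ : C3 * _ = M * C2 * (Cw * (t `^ gain al * k%:R `^ (- decay_exp al)))); last by rewrite /C3; ring.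
    by apply: ler_wpM2l => //; apply: mulr_ge0 => //; exact: ltW.
  have l0 : 0 <= (t `^ al^-1 * k%:R) `^ (al / 2) * `|D b| by apply: mulr_ge0 => //; exact: powR_ge0.
  have h3 : ((t `^ al^-1 * k%:R) `^ (al / 2) * `|D b|) ^+ 2 <= (C3 * (t `^ gain al * k%:R `^ (- decay_exp al))) ^+ 2.
    by rewrite ler_pXn2r ?nnegrE//; apply: le_trans l0 h1.
  have eL : ((t `^ al^-1 * k%:R) `^ (al / 2) * `|D b|) ^+ 2 = t * (X * D b ^+ 2).
    have e1 : ((t `^ al^-1 * k%:R) `^ (al / 2)) ^+ 2 = t * X.
      rewrite -powR_mulrn ?powR_ge0// -powRrM (_ : al / 2 * 2 = al); last by field.
      by rewrite powRM ?powR_ge0// -powRrM mulVf ?gt_eqF// powRr1 ?(ltW t0).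
    by rewrite exprMn real_normK ?num_real// e1 mulrA.
  have eR : (C3 * (t `^ gain al * k%:R `^ (- decay_exp al))) ^+ 2 =
      t * (C3 ^+ 2 * (t `^ (- (1 - 2 * gain al)) * k%:R `^ (- (2 * decay_exp al)))).
    have e1 : (t `^ gain al) ^+ 2 = t * t `^ (- (1 - 2 * gain al)).
      rewrite -powR_mulrn ?powR_ge0// -powRrM -{2}(powRr1 (ltW t0)) -powRD; last by rewrite (gt_eqF t0) implybT.
      by congr (t `^ _); ring.
    have e2 : (k%:R `^ (- decay_exp al)) ^+ 2 = k%:R `^ (- (2 * decay_exp al)) :> R.
      by rewrite -powR_mulrn ?powR_ge0// -powRrM; congr (_ `^ _); ring.
    by rewrite !exprMn e1 e2; ring.
  by move: h3; rewrite eL eR ler_pM2l.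
have hv b : X * v t b k ^+ 2 <= 2 * (X * heat mu al u0 t b k ^+ 2) + 2 * (X * D b ^+ 2).
  have -> : v t b k = heat mu al u0 t b k + D b by rewrite /D addrC subrK.
  move: (heat mu al u0 t b k) (D b) => y w.
  by have := mulr_ge0 X0 (sqr_ge0 (y - w)); lra.
rewrite /hterm !coef_flow// /flow_coef gt_eqF//.
have q0 : 0 <= 2 `^ (al / 2) :> R by exact: powR_ge0.
apply: le_trans (ler_wpM2r _ p1) _; first by rewrite divr_ge0// addr_ge0 ?sqr_ge0.
rewrite -[leLHS]mulrA.
rewrite [leRHS](_ : _ = 2 `^ (al / 2) * (X * expR (- (2 * mu * X * t)) * (u0 false k ^+ 2 + u0 true k ^+ 2) +
   2 * (C3 ^+ 2 * (t `^ (- (1 - 2 * gain al)) * k%:R `^ (- (2 * decay_exp al)))))); last first.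
  rewrite -/X; move: (expR _) (powR t _) (powR k%:R _) (powR 2 _) (C3 ^+ 2) => y1 y2 y3 y4 y5.
  by field; rewrite gt_eqF.
apply: ler_wpM2l => //.
have := hv false; have := hv true; rewrite !hX; have := hD false; have := hD true.
by lra.
Qed.

Lemma is_derive_psum (f : nat -> R -> R) (df : nat -> R) n s :
  (forall k, (0 < k)%N -> is_derive s (1 : R) (f k) (df k)) ->
  is_derive s (1 : R) (fun s => psum (fun k => f k s) n) (psum df n).
Proof.
move=> d; rewrite /psum; under eq_fun do rewrite big_add1; rewrite big_add1.
elim: n.-1 => [|m IH].
  rewrite big_geq// (_ : (fun _ => _) = cst 0); first exact: is_derive_cst.
  by apply/funext => z; rewrite big_geq.
rewrite big_nat_recr//= (_ : (fun _ => _) =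
    (fun z => \sum_(0 <= k < m) f k.+1 z) + f m.+1); last first.
  by apply/funext => z; rewrite big_nat_recr.
by apply: is_deriveD; exact: d.
Qed.

(** The bound [d] of [flow_energy] has the explicit primitive [P], in which the heat term
    contributes at most half the squared datum per mode; finite sums are integrated with it, and
    monotone convergence concludes. *)
Lemma flow_sqintH : sqintH T (al / 2) flow.
Proof.
have [a0 r0 r1 /andP[kp1 kp2] g0] := exponent_facts al2.
have [E1 [E2 [E10 E20 hE]]] := flow_energy.
pose U k := u0 false k ^+ 2 + u0 true k ^+ 2; have U0 k : 0 <= U k by rewrite addr_ge0 ?sqr_ge0.
pose kap k : R := k%:R `^ (- (2 * decay_exp al)).
have kap0 k : 0 <= kap k by exact: powR_ge0.
pose X k : R := k%:R `^ al; have X0 k : 0 <= X k by exact: powR_ge0.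
have [K2 hK2] : exists K, asum_le kap K by apply: asum_powR; lra.
have hU n : psum U n <= pi^-1 * Iper (fun x => B0 x ^+ 2).
  by rewrite ler_pdivlMl ?pi_gt0//; exact: bessel n B0L.
pose q : R := 1 - 2 * gain al; have q1 : q < 1 by rewrite /q; lra.
have q10 : 0 < 1 - q by lra.
have E11 k (s : R) : 0 <= s -> 0 <= expR (- (2 * mu * X k * s)) <= 1.
  move=> s0; rewrite expR_ge0/= -expR0 ler_expR oppr_le0.
  by apply: mulr_ge0 => //; apply: mulr_ge0 => //; apply: mulr_ge0 => //; exact: ltW.
pose d (k : nat) (s : R) := E1 * (mu * X k * expR (- (2 * mu * X k * s)) * U k) + E2 * (s `^ (- q) * kap k).
pose P (k : nat) (s : R) := E1 * ((1 - expR (- (2 * mu * X k * s))) / 2 * U k) +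
  E2 * ((1 - q)^-1 * s `^ (1 - q) * kap k).
have d0 k s : 0 <= d k s.
  apply: addr_ge0; apply: mulr_ge0 => //; apply: mulr_ge0 => //; last exact: powR_ge0.
  by apply: mulr_ge0; [apply: mulr_ge0 => //; exact: ltW|exact: expR_ge0].
have P0 k s : 0 < s -> 0 <= P k s.
  move=> s0; apply: addr_ge0; apply: mulr_ge0 => //; apply: mulr_ge0 => //.
    by have /andP[_ h] := E11 k s (ltW s0); lra.
  by apply: mulr_ge0; [rewrite invr_ge0 ltW|exact: powR_ge0].
have dP k s : 0 < s -> is_derive s (1 : R) (P k) (d k s).
  move=> s0.
  have d1 : is_derive s (1 : R) (fun z => expR (- (2 * mu * X k * z))) (- (2 * mu * X k) * expR (- (2 * mu * X k * s))).
    have := heat_derive (2 * mu) al (fun _ _ => 1) s false k.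
    by rewrite /heat -/(X k); under eq_fun do rewrite mulr1; rewrite mulr1.
  have d2 := powR_primitive q1 s0.
  rewrite /P (_ : (fun _ => _) = (fun z => (E1 / 2 * U k) - (E1 / 2 * U k) * expR (- (2 * mu * X k * z)) +
    (E2 * kap k) * ((1 - q)^-1 * z `^ (1 - q)))); last first.
    by apply/funext => z; ring.
  have d3 := is_deriveZ (E1 / 2 * U k) d1; have d4 := is_deriveZ (E2 * kap k) d2.
  have d5 : is_derive s (1 : R) (cst (E1 / 2 * U k)) (0 : R) by exact: is_derive_cst.
  apply: (is_derive_eq (is_deriveD (is_deriveB d5 d3) d4)).
  have alg (e e' y1 y2 y3 y4 y5 m : R) : 0 - e / 2 * y3 * (- (2 * m * y5) * y1) + e' * y4 * y2 =
    e * (m * y5 * y1 * y3) + e' * (y2 * y4) by field.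
  exact: alg.
have cd k s : 0 < s -> {for s, continuous (d k)}.
  move=> s0; apply: cvgD.
    apply: cvgMr; apply: cvgMl; apply: cvgMr.
    apply: continuous_comp; last exact: continuous_expR.
    by apply: cvgN; apply: cvgMr; exact: cvg_id.
  by apply: cvgMr; apply: cvgMl; exact: powR_continuous_pos.
pose D : set (measurableTypeR R) := [set` `[0, T[ : interval R].
have mD : measurable D by exact: measurable_itv.
pose g n t : \bar R := (psum (hterm (al / 2) (coef (flow t))) n)%:E.
have hc n : {within D, continuous (fun t => psum (hterm (al / 2) (coef (flow t))) n)}.
  apply/subspace_continuousP => t0 t0D; apply: cvg_psum => k k0.
  have c b : coef (flow t) b k @[t --> within D (nbhs t0)] --> coef (flow t0) b k.
    by have := @contL2_coef R T flow b k t0 flow_contL2 k0; apply; exact: t0D.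
  apply: cvgMr; apply: cvgMl; apply: cvgD; apply: cvgM; exact: c.
have mg n : measurable_fun D (g n).
  by apply/measurable_EFinP; apply: subspace_continuous_measurable_fun => //; exact: hc.
have ndg t : nondecreasing_seq (g ^~ t) by exact: psum_hterm_nd.
have g00 n t : (0 <= g n t)%E by rewrite lee_fin; apply: psum_ge0 => k _; exact: hterm_ge0.
have gE t : D t -> limn (g ^~ t) = (normH (al / 2) (flow t) ^+ 2)%E.
  move=> tD; have tT : 0 <= t < T by move: tD; rewrite /D/= in_itv.
  by rewrite normH_sqr ?coef0_flow.
have mg' : measurable_fun D (fun t => limn (g ^~ t)).
  by apply: (emeasurable_fun_cvg g) => // t _; apply: ereal_nondecreasing_is_cvgn; exact: ndg.
pose A := E1 * (2^-1 * (pi^-1 * Iper (fun x => B0 x ^+ 2))) + E2 * ((1 - q)^-1 * T `^ (1 - q) * K2).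
have gA n : (\int[lebesgue_measure]_(t in D) g n t <= A%:E)%E.
  pose O : set (measurableTypeR R) := [set` `]0, T[ : interval R].
  have mO : measurable O by exact: measurable_itv.
  pose O' : set (measurableTypeR R) := [set` `]0, T] : interval R].
  have mO' : measurable O' by exact: measurable_itv.
  have OD : O `<=` D by apply: subset_itvr; rewrite bnd_simp.
  have OO : O `<=` O' by apply: subset_itvl; rewrite bnd_simp.
  have md : measurable_fun O' (fun t => (psum (fun k => d k t) n)%:E).
    apply/measurable_EFinP; apply: ge0_measurable_on => s s0.
    by apply: cvg_psum => k _; exact: cd.
  (* The time 0 is removed from the domain, as the energy bound concerns positive times. *)
  rewrite -[leLHS](integral_itv_obnd_cbnd (r := 0) (b := BLeft T) (f := g n)); last exact: measurable_funS (mg n).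
  apply: (@le_trans _ _ (\int[lebesgue_measure]_(t in O) (psum (fun k => d k t) n)%:E)%E).
    apply: ge0_le_integral => //.
    - exact: measurable_funS (mg n).
    - exact: measurable_funS md.
    - move=> t; rewrite /O/= in_itv/= => tT; rewrite lee_fin; apply: le_psum => k k0.
      exact: hE.
  apply: (@le_trans _ _ (\int[lebesgue_measure]_(t in O') (psum (fun k => d k t) n)%:E)%E).
    apply: ge0_subset_integral => //.
    by move=> t _; rewrite lee_fin; apply: psum_ge0 => k _; exact: d0.
  have := @ge0_integral_le_primitive R (fun t => psum (fun k => d k t) n) (fun t => psum (fun k => P k t) n) T T0.
  move=> h; apply: le_trans (h _ _ _ _) _.
  - by move=> s s0; apply: cvg_psum => k _; exact: cd.
  - by move=> s _; apply: psum_ge0 => k _; exact: d0.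
  - by move=> s s0; apply: is_derive_psum => k _; exact: dP.
  - by move=> s s0; apply: psum_ge0 => k _; exact: P0.
  rewrite lee_fin /P psumD !psumZ; apply: lerD; apply: ler_wpM2l => //.
    apply: le_trans (ler_wpM2l _ (hU n)) => //; rewrite -psumZ; apply: le_psum => k _.
    by apply: ler_wpM2r => //; have /andP[h1 _] := E11 k T (ltW T0); lra.
  apply: ler_wpM2l; first by apply: mulr_ge0; [rewrite invr_ge0 ltW|exact: powR_ge0].
  by apply: le_trans (hK2 n); apply: le_psum => k _; exact: ler_norm.
rewrite /sqintH; apply: (@eq_integrable _ _ _ lebesgue_measure D mD (fun t => limn (g ^~ t))).
  by move=> t; rewrite inE => /gE.
apply/integrableP; split => //.
apply: (@le_lt_trans _ _ (\int[lebesgue_measure]_(t in D) limn (g ^~ t))%E).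
  rewrite le_eqVlt; apply/orP; left; apply/eqP; apply: eq_integral => t _.
  rewrite gee0_abs//; apply: lime_ge; first exact: ereal_nondecreasing_is_cvgn (ndg t).
  exact: nearW.
rewrite (@monotone_convergence _ _ _ lebesgue_measure D mD g)//.
apply: (@le_lt_trans _ _ A%:E); last exact: ltry.
apply: lime_le; last exact: nearW.
apply: ereal_nondecreasing_is_cvgn => i j ij; apply: ge0_le_integral => //.
by move=> t _; exact: ndg.
Qed.

End smoothing.

(** * The constructed solution satisfies the system pointwise *)

Section pointwise_equation.
Context {R : realType}.
#[local] Opaque ncoef duhamel.
Implicit Types (t s x : R) (b : bool) (k n : nat) (u w : bool -> nat -> R).

Lemma Iper_trig_orth u w K L : sumu u K -> sumu w L ->
  (forall k, (0 < k)%N -> u false k * w false k + u true k * w true k = 0) ->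
  Iper (fun x => trig u x * trig w x) = 0.
Proof.
move=> uK wL uw; have cu := trig_continuous uK; have cw := trig_continuous wL.
have h : Iper (fun x => trig u x * psum (trig_term w x) n) @[n --> \oo] --> Iper (fun x => trig u x * trig w x).
  apply: Iper_uniform.
  - by apply: nearW => n; apply: contM => //; exact: trigp_continuous.
  - exact: contM.
  move=> e e0; have K0 : 0 <= K := asum_le_ge0 (uK false).
  have s0 : 0 < 2 * K + 1 by lra.
  near=> n => x; rewrite -mulrBr normrM.
  have h1 := trig_bound x uK.
  have h2 : `|psum (trig_term w x) n - trig w x| <= e / (2 * K + 1).
    by move: (x); near: n; apply: trigp_unif wL _ _; rewrite divr_gt0.
  apply: le_trans (ler_pM _ _ h1 h2) _ => //.
  by rewrite mulrA ler_pdivrMr// mulrC; apply: ler_wpM2l; [exact: ltW|lra].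
have h0 : Iper (fun x => trig u x * psum (trig_term w x) n) @[n --> \oo] --> (0 : R).
  rewrite (_ : (fun n => _) = fun=> 0); first exact: cvg_cst.
  apply/funext => n; rewrite psum_sqr_trig; last exact: S1_integrable.
  rewrite (@eq_psum _ _ (fun=> 0)) => [|k k0]; last first.
    by rewrite !(coef_trig _ uK)// mulrC [w true k * _]mulrC uw.
  by rewrite /psum big1 ?mulr0.
by rewrite -(cvg_lim (@Rhausdorff R) h) (cvg_lim (@Rhausdorff R) h0).
Unshelve. all: by end_near. Qed.

(** The nonlinearity has zero mean: in both products the two factors are orthogonal mode by mode, as
    one is a multiplier applied to [u] and the other a multiplier applied to its derivative. Fourier
    inversion then needs no constant term. *)
Lemma nonlin_trig (ca cb : R) u K x : fast u -> sumu (ncoef ca cb u u) K ->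
  nonlin ca cb u u x = trig (ncoef ca cb u u) x.
Proof.
move=> uf hK; have kf := fast_kmul uf; have df := fast_dxu uf; have dkf := fast_dxu kf.
have [K1 h1] := fast_sum uf; have [K2 h2] := fast_sum kf.
have [K3 h3] := fast_sum df; have [K4 h4] := fast_sum dkf.
have c1 := trig_continuous h1; have c2 := trig_continuous h2.
have c3 := trig_continuous h3; have c4 := trig_continuous h4.
apply: fourier_inversion hK _; [exact: nonlin_continuous|exact: nonlin_periodic|].
rewrite coef_false0 /nonlin IperD; [|exact: contZ (contM c1 c4)|exact: contZ (contM c2 c3)].
rewrite !IperZ; [|exact: contM|exact: contM].
rewrite (Iper_trig_orth h1 h4) ?(Iper_trig_orth h2 h3) ?mulr0 ?addr0 ?mulr0// => k _; rewrite /dxu /kmul; ring.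
Qed.

Lemma Lambda_trig (s : R) u K x : sumu u K -> Lambda s (trig u) x = trig (Lau s u) x.
Proof.
move=> uK; rewrite /Lambda /trig /tsum; congr (limn _); apply/funext => n.
apply: eq_big_nat => k /andP[k0 _].
rewrite -[fcos _ _]/(coef (trig u) false k) -[fsin _ _]/(coef (trig u) true k) !(coef_trig _ uK)//.
by rewrite /trig_term /Lau mulrDr !mulrA.
Qed.

Variables (mu al ca cb T M : R) (B0 : R -> R) (v : R -> bool -> nat -> R).
Hypotheses (mu0 : 0 < mu) (al2 : 5 / 2 < al) (M0 : 0 < M).
Let la := rate mu al.
Hypothesis vA : admissible mu al T M v.
Hypothesis vD : forall t b k, 0 < t < T -> (0 < k)%N ->
  is_derive t (1 : R) (fun s => v s b k)
    (ncoef ca cb (v t) (v t) b k - mu * k%:R `^ al * v t b k).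

Let v_fast t : 0 < t < T -> fast (v t).
Proof. exact: admissible_fast (ltW M0) vA. Qed.

Lemma ncoef_decay t1 : 0 < t1 -> exists C, 0 <= C /\ forall s b k, t1 <= s < T -> (0 < k)%N ->
  `|ncoef ca cb (v s) (v s) b k| <= C * k%:R ^- 2.
Proof.
move=> t10; have [la0 _ _] := rate_facts mu0 al2; have [a0 r0 r1 _ _] := exponent_facts al2.
have [vE _] := vA.
pose L := la * t1 `^ al^-1; have L0 : 0 < L by rewrite mulr_gt0// powR_gt0.
pose A := nonlin_const ca cb * (M * M) * t1 `^ (- (2 / al)).
have CN0 : 0 < nonlin_const ca cb by exact: CN_gt0.
have A0 : 0 <= A by apply: mulr_ge0; [apply: mulr_ge0; [exact: ltW|rewrite mulr_ge0// ltW]|exact: powR_ge0].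
exists (4 / L ^+ 2 * A); split; first by rewrite mulr_ge0// divr_ge0// exprn_ge0// ltW.
move=> s b k /andP[s1 sT] k0; have s0 : 0 < s by exact: lt_le_trans t10 s1.
have sI : 0 < s < T by rewrite s0.
have kp : 0 < k%:R :> R by rewrite ltr0n.
have h := ncoef_bound ca cb mu0 al2 b k s0 M0 M0 (vE _ sI) (vE _ sI).
set N := `|ncoef _ _ _ _ _ _| in h *; have N0 : 0 <= N by exact: normr_ge0.
have h1 : (L * k%:R) ^+ 2 * N <= 4 * A.
  have e1 : (L * k%:R) ^+ 2 <= 4 * expR (rate mu al * s `^ al^-1 * k%:R).
    have Lk : 0 <= L * k%:R by rewrite mulr_ge0// ltW.
    have := exp_ge_pow Lk (isT : (0 < 2)%N); rewrite (_ : 2%:R ^+ 2 = 4 :> R); last by rewrite -natrX.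
    move=> h2; apply: le_trans h2 _; apply: ler_wpM2l => //; rewrite ler_expR.
    apply: ler_wpM2r; first exact: ltW.
    apply: ler_wpM2l; first exact: ltW.
    by apply: ge0_ler_powR; rewrite ?nnegrE ?invr_ge0 ?(ltW a0) ?(ltW t10) ?(ltW s0).
  apply: le_trans (ler_wpM2r N0 e1) _; rewrite -[leLHS]mulrA; apply: ler_wpM2l => //.
  apply: le_trans h _; rewrite /A; apply: ler_wpM2l.
    by rewrite mulr_ge0 ?(ltW CN0)// mulr_ge0 ?ltW.
  rewrite !powRN lef_pV2 ?posrE ?powR_gt0//.
  by apply: ge0_ler_powR; rewrite ?nnegrE ?(ltW t10) ?(ltW s0).
rewrite (_ : 4 / L ^+ 2 * A * k%:R ^- 2 = 4 * A / (L * k%:R) ^+ 2); last first.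
  by rewrite [(L * k%:R) ^+ 2]exprMn [(L ^+ 2 * _)^-1]invfM [RHS]mulrA; congr (_ * _); rewrite mulrAC.
have Lk2 : 0 < (L * k%:R) ^+ 2 by apply: exprn_gt0; exact: mulr_gt0.
by rewrite (ler_pdivlMr _ _ Lk2) [N * _]mulrC.
Qed.

Lemma ncoef_sum t : 0 < t < T -> exists K, sumu (ncoef ca cb (v t) (v t)) K.
Proof.
move=> /andP[t0 tT]; have [C [C0 hC]] := ncoef_decay t0; have [K hK] := @asum_pow2 R.
exists (`|C| * K) => b; apply: asum_leW (asum_leZ C hK) => k k0.
by apply: le_trans (hC t b k _ k0) (ler_norm _); rewrite lexx.
Qed.

Lemma Lau_decay t1 : 0 < t1 -> exists C, 0 <= C /\ forall s b k, t1 <= s < T -> (0 < k)%N ->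
  `|v s b k| <= C * k%:R ^- 2 /\ `|Lau al (v s) b k| <= C * k%:R ^- 2.
Proof.
move=> t10; have [la0 _ _] := rate_facts mu0 al2; have [a0 _ _ _ _] := exponent_facts al2.
have [vE _] := vA; pose n := (Num.trunc al).+1.
have aln : al <= n%:R by apply: ltW; exact: truncnS_gt.
have [C [C0 hC]] := @ebound_decay _ al la al2 (ltW la0) t1 M (n + 2) la0 t10 (ltW M0).
exists C; split=> // s b k /andP[s1 sT] k0.
have sI : 0 < s < T by rewrite (lt_le_trans t10 s1).
have kp : 1 <= k%:R :> R by rewrite ler1n.
have kp0 : 0 < k%:R :> R by rewrite ltr0n.
have h := hC s (v s) s1 (vE _ sI) b k k0.
have h1 : k%:R ^+ n * `|v s b k| <= C * k%:R ^- 2.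
  have := ler_wpM2l (exprn_ge0 n (ltW kp0)) h; rewrite exprD invfM.
  by rewrite [X in _ <= X]mulrCA mulVKf// expf_neq0// gt_eqF.
split; last first.
  rewrite /Lau normrM [`|k%:R `^ _|]ger0_norm ?powR_ge0//; apply: le_trans h1; apply: ler_wpM2r => //.
  by rewrite -powR_mulrn ?(ltW kp0)//; apply: ler_powR.
by apply: le_trans h1; rewrite ler_peMl// exprn_ege1.
Qed.

(** Termwise differentiation on []t / 2, T[], where the nonlinear and the dissipative terms both
    decay like [k^(-2)] uniformly in time. *)
Lemma flow_derive t x : 0 < t < T -> is_derive t (1 : R) (fun s => flow B0 v s x)
  (trig (ncoef ca cb (v t) (v t)) x - mu * trig (Lau al (v t)) x).
Proof.
move=> tT; have /andP[t0 tT'] := tT; have t20 : 0 < t / 2 by lra.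
have [C1 [C10 h1]] := ncoef_decay t20; have [C2 [C20 h2]] := Lau_decay t20.
have [K hK] := @asum_pow2 R.
pose dv s b k := ncoef ca cb (v s) (v s) b k - mu * Lau al (v s) b k.
have dvb s b k : t / 2 < s < T -> (0 < k)%N -> `|dv s b k| <= (C1 + mu * C2) * k%:R ^- 2.
  move=> /andP[s1 s2] k0; have sI : t / 2 <= s < T by rewrite s2 ltW.
  apply: le_trans (ler_normB _ _) _; rewrite mulrDl; apply: lerD; first exact: h1.
  rewrite normrM (gtr0_norm mu0) -[leRHS]mulrA; apply: ler_wpM2l; first exact: ltW.
  by have [_] := h2 s b k sI k0.
have d : is_derive t (1 : R) (fun s => tsum (trig_term (v s) x)) (tsum (trig_term (dv t) x)).
  apply: (@tsum_derive _ (fun s => trig_term (v s) x) (fun s => trig_term (dv s) x)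
    (fun k => 2 * ((C1 + mu * C2) * k%:R ^- 2)) t (t / 2) T (`|2| * (`|C1 + mu * C2| * K)) (`|C2| * K + `|C2| * K)).
  - by apply/andP; split; lra.
  - by apply: asum_leZ; exact: asum_leZ.
  - move=> s sI; apply: trig_asum => b; apply: asum_leW (asum_leZ C2 hK) => k k0.
    have sI' : t / 2 <= s < T by case/andP: sI => s1 ->; rewrite ltW.
    by have [h _] := h2 s b k sI' k0; apply: le_trans h (ler_norm _).
  - move=> s k /andP[s1 s2] k0; have sI : 0 < s < T by rewrite s2 andbT; lra.
    have dd b := vD b sI k0; rewrite /trig_term.
    have e1 := is_deriveZ (cos (k%:R * x)) (dd false); have e2 := is_deriveZ (sin (k%:R * x)) (dd true).
    rewrite (_ : (fun s => _) = (fun s => cos (k%:R * x) *: v s false k) + (fun s => sin (k%:R * x) *: v s true k)); last first.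
      by apply/funext => z; rewrite mulrC [v z true k * _]mulrC.
    apply: (is_derive_eq (is_deriveD e1 e2)); rewrite /dv /Lau !mulrA.
    by rewrite -[_ *: _]/(_ * _) -[sin _ *: _]/(_ * _) mulrC [sin _ * _]mulrC.
  - move=> s k sI k0; apply: le_trans (trig_term_le _ _ _) _.
    by have := dvb s false k sI k0; have := dvb s true k sI k0; lra.
have e : tsum (trig_term (dv t) x) = trig (ncoef ca cb (v t) (v t)) x - mu * trig (Lau al (v t)) x.
  have [K1 n1] := ncoef_sum tT.
  have l1 : sumu (Lau al (v t)) (`|C2| * K).
    move=> b; apply: asum_leW (asum_leZ C2 hK) => k k0.
    have tI : t / 2 <= t < T by rewrite tT' andbT; lra.
    by have [_ h] := h2 t b k tI k0; apply: le_trans h (ler_norm _).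
  by rewrite -(trigZ mu _ l1) -(trigB _ n1 (sumuZ mu l1)).
rewrite -e; apply: near_eq_is_derive d; near=> s.
have s0 : 0 < s by near: s; exact: lt_nbhsr.
by rewrite /flow gt_eqF.
Unshelve. all: by end_near. Qed.

Lemma flow_solves : solves mu ca cb al T (flow B0 v).
Proof.
move=> t x tT; have /andP[t0 tT'] := tT.
have vf := v_fast tT; have kf := fast_kmul vf; have df := fast_dxu vf; have dkf := fast_dxu kf.
have [K1 h1] := fast_sum vf; have [K2 h2] := fast_sum kf.
have [K3 h3] := fast_sum df; have [K4 h4] := fast_sum dkf; have [K5 h5] := fast_sum (fast_kmul kf).
have fE : flow B0 v t = trig (v t) by apply/funext => y; rewrite /flow gt_eqF.
pose J b k := -1 * kmul (v t) b k.
have JK : sumu J (`|-1| * K2) by exact: sumuZ.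
have dJE y : trig (dxu J) y = -1 * trig (dxu (kmul (v t))) y.
  rewrite -(trigZ (-1) y h4); apply: eq_trig => b k _; rewrite /dxu /J; case: b; ring.
have dJK : sumu (dxu J) (`|-1| * K4).
  move=> b; apply: asum_leW (sumuZ (-1) h4 b) => k _.
  have -> : dxu J b k = -1 * dxu (kmul (v t)) b k by rewrite /dxu /J; case: b; ring.
  exact: lexx.
have JE : current (flow B0 v) t = trig J.
  apply/funext => y; rewrite /current fE (Lambda_trig 1 y h1) (trigZ (-1) y h2) mulN1r; congr (- _).
  by apply: eq_trig => b k k0; rewrite /Lau powRr1.
have dt := flow_derive x tT.
have dx := trig_derive x h1 h3.
have dJ := trig_derive x JK dJK.
have e1 : derive1 (fun s => flow B0 v s x) t = trig (ncoef ca cb (v t) (v t)) x - mu * trig (Lau al (v t)) x.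
  by rewrite derive1E; case: dt.
have e2 : derive1 (flow B0 v t) x = trig (dxu (v t)) x by rewrite fE derive1E; case: dx.
have e3 : derive1 (current (flow B0 v) t) x = trig (dxu J) x by rewrite JE derive1E; case: dJ.
split.
- by case: dt.
- by rewrite fE; case: dx.
- by rewrite JE; case: dJ.
- rewrite e1 e2 e3 JE fE (Lambda_trig al x h1) dJE.
  have [K6 h6] := ncoef_sum tT; rewrite -(nonlin_trig x vf h6) /nonlin (trigZ (-1) x h2).
  by move: (trig (v t) x) (trig _ x) (trig _ x) (trig _ x) (trig _ x) => y1 y2 y3 y4 y5; ring.
(* On coefficients the relation reads [hilbu J = dxu (v t)], with [J = - k v]. *)
- rewrite e2 JE.
  have kJ : sumu (fun b k => k%:R * J b k) (`|-1| * K5).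
    by move=> b; apply: asum_leW (sumuZ (-1) h5 b) => k _; rewrite /J /kmul mulrCA.
  rewrite (hilbert_trig x JK kJ); apply: eq_trig => b k _; rewrite /dxu /hilbu /J /kmul; case: b; ring.
Qed.

End pointwise_equation.

(** * Every solution of the class satisfies the equations for the coefficients *)

Section regularity_of_solutions.
Context {R : realType}.
#[local] Opaque ncoef duhamel.
Implicit Types (t s x : R) (b : bool) (k n j : nat) (u w : bool -> nat -> R).

Lemma decay_sumu u (C : R) n : (forall b k, (0 < k)%N -> `|u b k| <= C * k%:R ^- (n + 2)) ->
  exists K, 0 <= K /\ forall w, (forall b k, (0 < k)%N -> exists b', `|w b k| <= k%:R ^+ n * `|u b' k|) ->
    sumu w (`|C| * K).
Proof.
move=> uC; have [K hK] := @asum_pow2 R; exists K; split; first exact: asum_le_ge0 hK.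
move=> w wu b; apply: asum_leW (asum_leZ C hK) => k k0.
have kp : 0 < k%:R :> R by rewrite ltr0n.
have [b' h] := wu b k k0; apply: le_trans h _; apply: le_trans (ler_norm _).
apply: le_trans (ler_wpM2l (exprn_ge0 n (ltW kp)) (uC b' k k0)) _.
by rewrite exprD invfM mulrCA mulVKf// expf_neq0// gt_eqF.
Qed.

Variables (mu ca cb al T : R) (B0 : R -> R) (B : R -> R -> R).
Hypotheses (mu0 : 0 < mu) (al2 : 5 / 2 < al).
Hypothesis sol : solution mu ca cb al T B0 B.
Let c t := coef (B t).

Lemma sol_memL2 t : 0 <= t < T -> memL2 (B t) /\ zero_mean (B t).
Proof. by move=> tT; have [[[h _] _] z _ _ _] := sol; split; [apply: h|apply: z]; rewrite in_itv. Qed.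

Lemma sol_coef0 t : 0 <= t < T -> coef (B t) false 0 = 0.
Proof. by move=> /sol_memL2[_ z]; exact: (zero_mean_coef z false). Qed.

(** Finiteness of the supremum, turned into a real bound on all partial sums, uniform in time. *)
Lemma sol_hterm q : 0 <= q -> exists A, 0 <= A /\ forall t n, 0 < t < T ->
  t `^ (2 * (q / al)) * psum (hterm q (c t)) n <= A ^+ 2.
Proof.
move=> q0; have [_ _ _ _ h] := sol; have [/(_ q q0) + _] := h.
set S := [set _ | _ in _] => hS.
exists `|fine (ereal_sup S)|; split=> // t n tT; have /andP[t0 tT'] := tT.
have p0 : 0 < t `^ (q / al) by exact: powR_gt0.
have hb : ((t `^ (q / al))%:E * normH q (B t) <= ereal_sup S)%E.
  by apply: ereal_sup_ubound; exists t.
have n0 : (0 <= normH q (B t))%E by exact: sqrte_ge0.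
have s0 : (0 <= ereal_sup S)%E by apply: le_trans hb; apply: mule_ge0 => //; rewrite lee_fin ltW.
have fs : ereal_sup S \is a fin_num by rewrite ge0_fin_numE.
rewrite ger0_norm ?fine_ge0//; set A := fine _.
have hn : (normH q (B t) <= ((t `^ (q / al))^-1 * A)%:E)%E.
  by rewrite EFinM lee_pdivlMl// /A fineK.
have A0 : 0 <= A by exact: fine_ge0.
have := psum_le_normH n (sol_coef0 (t := t) _) _ hn; rewrite (ltW t0) tT' => /(_ isT).
move=> /(_ ltac:(by rewrite mulr_ge0// invr_ge0 ltW)).
rewrite exprMn exprVn -ler_pdivrMl ?invr_gt0 ?exprn_gt0// invrK.
by rewrite -powR_mulrn ?powR_ge0// -powRrM [q / al * _]mulrC.
Qed.

(** The smoothing bound with [beta = j]. The inequality [y <= 1 + y^2] replaces a square root,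
    whence the shape of the constant. *)
Lemma sol_decay t1 j : 0 < t1 -> exists C, 0 <= C /\ forall t b k, t1 <= t < T -> (0 < k)%N ->
  `|c t b k| <= C * k%:R ^- j.
Proof.
move=> t10; have [A [A0 hA]] := @sol_hterm j%:R (ler0n R j).
have [a0 _ _ _ _] := exponent_facts al2.
set e := 2 * (j%:R / al) in hA.
have e0 : 0 <= e by rewrite /e mulr_ge0// divr_ge0// ltW.
have p0 : 0 < t1 `^ e by exact: powR_gt0.
exists (2 * (A ^+ 2 / t1 `^ e) + 1); split.
  by rewrite addr_ge0// mulr_ge0// divr_ge0 ?sqr_ge0// ltW.
move=> t b k /andP[tt1 tT] k0; have t0 : 0 < t by exact: lt_le_trans t10 tt1.
have tI : 0 < t < T by rewrite t0.
have kp : 0 < k%:R :> R by rewrite ltr0n.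
rewrite -ler_pdivrMr ?invr_gt0 ?exprn_gt0// invrK.
have h1 : hterm j%:R (c t) k <= A ^+ 2 / t1 `^ e.
  rewrite ler_pdivlMr// mulrC; apply: le_trans (hA t k.+1 tI).
  have h2 : hterm j%:R (c t) k <= psum (hterm j%:R (c t)) k.+1.
    by apply: psum_term => // i _; exact: hterm_ge0.
  apply: ler_pM => //; [exact: powR_ge0|exact: hterm_ge0|].
  by apply: ge0_ler_powR; rewrite ?nnegrE ?(ltW t10) ?(ltW t0).
have h3 : (`|c t b k| * k%:R ^+ j) ^+ 2 <= 2 * hterm j%:R (c t) k.
  have s1 : c t b k ^+ 2 <= c t false k ^+ 2 + c t true k ^+ 2.
    by case: b; rewrite ?lerDl ?lerDr sqr_ge0.
  rewrite /hterm powR_mulrn ?addr_ge0 ?sqr_ge0// exprMn real_normK ?num_real//.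
  rewrite (_ : 2 * _ = (1 + k%:R ^+ 2) ^+ j * (c t false k ^+ 2 + c t true k ^+ 2)); last by field.
  rewrite mulrC; apply: ler_pM => //; rewrite ?sqr_ge0//.
  rewrite -exprM mulnC exprM; apply: lerXn2r; rewrite ?nnegrE ?sqr_ge0 ?addr_ge0 ?sqr_ge0//.
  by rewrite lerDr.
have y0 : 0 <= `|c t b k| * k%:R ^+ j by rewrite mulr_ge0// exprn_ge0// ltW.
by have := sqr_ge0 (`|c t b k| * k%:R ^+ j - 1); move: (_ * _ ^+ j) y0 h3 => y y0 h3; nra.
Qed.

Lemma sol_fast t : 0 < t < T -> fast (c t).
Proof.
move=> /andP[t0 tT] j; have [C [C0 hC]] := @sol_decay t (j + 2) t0.
have tI : t <= t < T by rewrite lexx.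
have [K [K0 hK]] := decay_sumu (fun b k => hC t b k tI).
exists (`|C| * K); apply: hK => b k k0; exists b.
by rewrite normrM ger0_norm// exprn_ge0.
Qed.

(** The pointwise system makes [B t] differentiable in [x], hence continuous; with summable
    coefficients Fourier inversion applies. *)
Lemma sol_trig t : 0 < t < T -> B t = trig (c t).
Proof.
move=> tT; have /andP[t0 tT'] := tT; have tI : 0 <= t < T by rewrite ltW.
have [K hK] := fast_sum (sol_fast tT); have [[p _] _] := sol_memL2 tI.
have cB : continuous (B t).
  by move=> x; have [_ _ _ h _] := sol; have [_ /derivable1_diffP/differentiable_continuous] := h t x tT.
by apply/funext => x; apply: fourier_inversion hK x => //; exact: sol_coef0.
Qed.

Lemma sol_pde t x : 0 < t < T -> is_derive t (1 : R) (fun s => B s x)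
  (nonlin ca cb (c t) (c t) x - mu * trig (Lau al (c t)) x).
Proof.
move=> tT; have [_ _ _ h _] := sol; have [d1 _ _ pde _] := h t x tT.
have vf := sol_fast tT; have kf := fast_kmul vf; have df := fast_dxu vf; have dkf := fast_dxu kf.
have [K1 h1] := fast_sum vf; have [K2 h2] := fast_sum kf.
have [K3 h3] := fast_sum df; have [K4 h4] := fast_sum dkf.
have fE := sol_trig tT.
have JE : current B t = (fun y => - trig (kmul (c t)) y).
  apply/funext => y; rewrite /current fE (Lambda_trig 1 y h1); congr (- _).
  by apply: eq_trig => b k k0; rewrite /Lau powRr1.
have e2 : derive1 (B t) x = trig (dxu (c t)) x.
  by rewrite fE derive1E; case: (trig_derive x h1 h3).
have e3 : derive1 (current B t) x = - trig (dxu (kmul (c t))) x.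
  by rewrite JE derive1E; case: (is_deriveN (trig_derive x h2 h4)).
apply: DeriveDef => //; rewrite -derive1E.
move: pde; rewrite e2 e3 JE fE (Lambda_trig al x h1) /nonlin => /eqP.
move: (derive1 _ _) => y; rewrite -!addrA addr_eq0 => /eqP ->; ring.
Qed.

(** Uniformity in [x] and in [t >= t1] provides the domination for differentiating the coefficients
    under the integral. *)
Lemma sol_pde_bound t1 : 0 < t1 -> exists C, forall t x, t1 <= t < T ->
  `|nonlin ca cb (c t) (c t) x - mu * trig (Lau al (c t)) x| <= C.
Proof.
(* This [n] exceeds [al] and 2, the orders of differentiation that occur. *)
move=> t10; pose n := (Num.trunc al).+3.
have [C [C0 hC]] := @sol_decay t1 (n + 2) t10.
have [K0 hK0] := @asum_pow2 R; pose K : R := `|C| * K0; pose L := K + K.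
exists (`|ca| * (L * L) + `|cb| * (L * L) + mu * L) => t x tT.
have sK w : (forall b k, (0 < k)%N -> exists b', `|w b k| <= k%:R ^+ n * `|c t b' k|) -> `|trig w x| <= L.
  move=> hw; apply: trig_bound => b; apply: asum_leW (asum_leZ C hK0) => k k0.
  have kp : 0 < k%:R :> R by rewrite ltr0n.
  have [b' h] := hw b k k0; apply: le_trans h _; apply: le_trans (ler_norm _).
  apply: le_trans (ler_wpM2l (exprn_ge0 n (ltW kp)) (hC t b' k tT k0)) _.
  by rewrite exprD invfM mulrCA mulVKf// expf_neq0// gt_eqF.
have kn k m : (0 < k)%N -> (m <= n)%N -> k%:R ^+ m <= k%:R ^+ n :> R.
  by move=> k0 mn; apply: ler_weXn2l => //; rewrite ler1n.
have s0 : `|trig (c t) x| <= L.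
  by apply: sK => b k k0; exists b; rewrite -[leLHS]mul1r; apply: ler_wpM2r => //; exact: (kn k 0%N).
have s1 : `|trig (kmul (c t)) x| <= L.
  apply: sK => b k k0; exists b; rewrite /kmul normrM; apply: ler_wpM2r => //.
  by rewrite ger0_norm//; exact: (kn k 1%N).
have s2 : `|trig (dxu (c t)) x| <= L.
  apply: sK => b k k0; exists (~~ b).
  have -> : `|dxu (c t) b k| = k%:R * `|c t (~~ b) k| by rewrite /dxu; case: b; rewrite ?normrN normrM ger0_norm.
  by apply: ler_wpM2r => //; exact: (kn k 1%N).
have s3 : `|trig (dxu (kmul (c t))) x| <= L.
  apply: sK => b k k0; exists (~~ b).
  have -> : `|dxu (kmul (c t)) b k| = k%:R ^+ 2 * `|c t (~~ b) k|.
    by rewrite /dxu /kmul; case: b; rewrite ?normrN !normrM ger0_norm// mulrA.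
  by apply: ler_wpM2r => //; exact: (kn k 2%N).
have s4 : `|trig (Lau al (c t)) x| <= L.
  apply: sK => b k k0; exists b; rewrite /Lau normrM; apply: ler_wpM2r => //.
  rewrite ger0_norm ?powR_ge0// -powR_mulrn//; apply: ler_powR; first by rewrite ler1n.
  apply: (@le_trans _ _ (Num.trunc al).+1%:R); first by apply: ltW; exact: truncnS_gt.
  by rewrite ler_nat ltnW.
rewrite /nonlin; apply: le_trans (ler_normB _ _) _; apply: lerD; last first.
  by rewrite normrM (gtr0_norm mu0); apply: ler_wpM2l => //; exact: ltW.
apply: le_trans (ler_normD _ _) _; rewrite !normrM.
by apply: lerD; apply: ler_wpM2l => //; apply: ler_pM.
Qed.

(** The coefficient is an integral over the period and is differentiated under the integral sign on
    []t / 2, T[], the equation supplying the derivative. *)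
Lemma sol_ode t b k : 0 < t < T -> (0 < k)%N ->
  is_derive t (1 : R) (fun s => c s b k) (ncoef ca cb (c t) (c t) b k - mu * k%:R `^ al * c t b k).
Proof.
move=> tT k0; have /andP[t0 tT'] := tT; have t20 : 0 < t / 2 by lra.
have [C hC] := sol_pde_bound t20.
have [n0 hn] : exists K, sumu (Lau al (c t)) K.
  pose n := (Num.trunc al).+1; have [D [D0 hD]] := @sol_decay t (n + 2) t0.
  have tI : t <= t < T by rewrite lexx.
  have [K [K0 hK]] := decay_sumu (fun b k => hD t b k tI).
  exists (`|D| * K); apply: hK => b' k' k0'; exists b'.
  rewrite /Lau normrM; apply: ler_wpM2r => //.
  rewrite ger0_norm ?powR_ge0// -powR_mulrn//; apply: ler_powR; first by rewrite ler1n.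
  by apply: ltW; exact: truncnS_gt.
pose f (s : R) (x : measurableTypeR R) : R := B s x * ebas b k x.
pose G s x := nonlin ca cb (c s) (c s) x - mu * trig (Lau al (c s)) x.
have sI s : `]t / 2, T[%classic s -> 0 < s < T /\ t / 2 <= s < T.
  by rewrite /= in_itv/= => /andP[s1 ->]; rewrite !andbT (ltW s1); split => //; exact: lt_trans t20 s1.
have df s x : `]t / 2, T[%classic s -> is_derive s (1 : R) (f ^~ x) (G s x * ebas b k x).
  move=> /sI[s1 _]; have d := is_deriveZ (ebas b k x) (sol_pde x s1).
  rewrite (_ : f ^~ x = fun s => ebas b k x *: B s x); last by apply/funext => y; rewrite /f mulrC.
  by apply: (is_derive_eq d); exact: mulrC.
have d1 s x : `]t / 2, T[%classic s -> partial1of2 f s x = G s x * ebas b k x.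
  by move=> /(df s x)[_ e]; rewrite partial1of2E.
have It : `]t / 2, T[%classic t by rewrite /= in_itv/= tT' andbT; lra.
have mS := @measurable_S1 R.
have fi s : `]t / 2, T[%classic s -> (@lebesgue_measure R).-integrable (S1 R) (EFin \o f s).
  move=> /sI[s1 _]; have [K hK] := fast_sum (sol_fast s1).
  have cB : continuous (B s) by rewrite (sol_trig s1); exact: trig_continuous hK.
  by have := S1_integrable (contM cB (@ebas_continuous R b k)).
have derf s x : `]t / 2, T[%classic s -> S1 R x -> derivable (f ^~ x) s 1.
  by move=> /(df s x)[].
have intC : (@lebesgue_measure R).-integrable (S1 R) (EFin \o (fun=> `|C|)).
  by apply: S1_integrable => ?; exact: cst_continuous.
have ub s x : `]t / 2, T[%classic s -> S1 R x -> `|partial1of2 f s x| <= `|C|.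
  move=> hs _; rewrite d1// normrM; have [_ s2] := sI s hs.
  apply: (@le_trans _ _ (`|G s x| * 1)); first by apply: ler_wpM2l => //; exact: ebas_le1.
  by rewrite mulr1; apply: le_trans (hC s x s2) (ler_norm _).
have D1 := derivable_under_integral mS It fi derf (fun=> normr_ge0 C) intC ub.
have D2 := differentiation_under_integral mS It fi derf (fun=> normr_ge0 C) intC ub.
have dI : is_derive t (1 : R) (fun s => Iper (f s)) (Iper (fun x => G t x * ebas b k x)).
  apply: DeriveDef; first exact: D1.
  rewrite -derive1E; apply: etrans D2 _; apply: eq_Rintegral => x _; exact: d1.
have vf := sol_fast tT; have cn : continuous (nonlin ca cb (c t) (c t)) by exact: nonlin_continuous.
have cl := trig_continuous hn.
have -> : ncoef ca cb (c t) (c t) b k - mu * k%:R `^ al * c t b k = pi^-1 * Iper (fun x => G t x * ebas b k x).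
  have cz : continuous (fun x => mu * trig (Lau al (c t)) x) by exact: contZ.
  by rewrite -coefI (coefB b k cn cz) (coefZ mu b k cl) (coef_trig b hn k0) /Lau mulrA.
have dZ := is_deriveZ (pi^-1 : R) dI.
rewrite (_ : (fun s => c s b k) = fun s => pi^-1 *: Iper (f s)); first exact: dZ.
by apply/funext => s; rewrite /c coefI.
Qed.

(** With [z = t^(1/al) k] and [la = 0] the squared weight is at most [8 (1 + z^4)]; the bounds for
    [beta = 0] and [beta = 2] control the two terms. A clock [s <= t] gives a smaller weight, so the
    bound persists when time is counted from a later origin. *)
Lemma sol_ebound : exists M, 0 < M /\ forall t s, 0 < t < T -> 0 < s <= t -> ebound al 0 s (c t) M.
Proof.
have [a0 _ _ _ _] := exponent_facts al2.
have [A0 [A00 h0]] := @sol_hterm 0 (lexx 0); have [A2 [A20 h2]] := @sol_hterm 2 (ler0n R 2).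
exists (4 * (A0 + A2) + 1); split; first by lra.
move=> t s tT /andP[s0 st] n; have /andP[t0 _] := tT.
have key : psum (fun k => weight 0 al s k ^+ 2 * (c t false k ^+ 2 + c t true k ^+ 2)) n <=
    16 * psum (hterm 0 (c t)) n + 16 * (t `^ (2 * (2 / al)) * psum (hterm 2 (c t)) n).
  rewrite -!psumZ -psumD; apply: le_psum => k k0.
  rewrite /weight mul0r mul0r expR0 mul1r /hterm powRr0 mul1r powR_mulrn ?addr_ge0 ?sqr_ge0//.
  have S0 : 0 <= c t false k ^+ 2 + c t true k ^+ 2 by rewrite addr_ge0 ?sqr_ge0.
  move: (_ + c t true k ^+ 2) S0 => S S0.
  pose z := t `^ al^-1 * k%:R; have z0 : 0 <= z by rewrite mulr_ge0 ?powR_ge0.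
  have y0 : 0 <= s `^ al^-1 * k%:R by rewrite mulr_ge0 ?powR_ge0.
  have yz : s `^ al^-1 * k%:R <= z.
    apply: ler_wpM2r => //; apply: ge0_ler_powR; rewrite ?nnegrE ?invr_ge0 ?(ltW a0) ?(ltW s0) ?(ltW t0)//.
  have e : t `^ (2 * (2 / al)) * k%:R ^+ 4 = z ^+ 4.
    rewrite /z exprMn -[(t `^ _) ^+ 4]powR_mulrn ?powR_ge0// -powRrM; congr (t `^ _ * _).
    by rewrite mulrA -natrM mulrC.
  have p1 : ((1 + s `^ al^-1 * k%:R) ^+ 2) ^+ 2 <= 8 * (1 + z ^+ 4).
    apply: (@le_trans _ _ ((1 + z) ^+ 4)).
      by rewrite -exprM; apply: lerXn2r; rewrite ?nnegrE ?addr_ge0// lerD2l.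
    have q1 := sqr_ge0 (z - 1); have q2 := sqr_ge0 (z ^+ 2 - 1).
    have q3 : 0 <= z * (z - 1) ^+ 2 by rewrite mulr_ge0// sqr_ge0.
    have q4 : 0 <= z ^+ 2 * (z - 1) ^+ 2 by rewrite mulr_ge0 ?sqr_ge0.
    by nra.
  have p2 : t `^ (2 * (2 / al)) * k%:R ^+ 4 <= t `^ (2 * (2 / al)) * (1 + k%:R ^+ 2) ^+ 2.
    apply: ler_wpM2l; first exact: powR_ge0.
    have := sqr_ge0 (k%:R : R); move: (k%:R : R) => y ?; nra.
  rewrite e in p2.
  apply: le_trans (ler_wpM2r S0 p1) _.
  have := ler_wpM2r S0 p2; move: (powR t _) ((1 + k%:R ^+ 2) ^+ 2) => y1 y2 ?; lra.
have k0 := h0 t n tT; rewrite mul0r mulr0 powRr0 mul1r in k0.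
have k2 := h2 t n tT; apply: le_trans key _.
by nra.
Qed.

(** [B 0] agrees with [B0] almost everywhere, hence has the same coefficients; the limit is
    continuity in L2 at 0, restricted to positive times. *)
Lemma sol_init b k : memL2 B0 -> 0 < T -> (0 < k)%N -> c t b k @[t --> 0^'+] --> coef B0 b k.
Proof.
move=> B0L T0 k0; have [[cL _] _ B00 _ _] := sol.
have zI : (0 : R) \in `[0, T[ by rewrite in_itv/= lexx.
have h := @contL2_coef R T B b k 0 cL k0 zI.
have z0 : 0 <= (0 : R) < T by rewrite lexx.
have [L0 _] := sol_memL2 z0.
have mS := @measurable_S1 R.
have mf (f : R -> R) : memL2 f -> measurable_fun (S1 R) (fun x => (f x * ebas b k x)%:E).
  move=> fL; have := mulr_continuous_integrable (memL2_integrable fL) (@ebas_continuous R b k).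
  by case/integrableP.
have e : coef (B 0) b k = coef B0 b k.
  rewrite !coefI; congr (_ * _); rewrite /Iper /Rintegral; congr fine.
  apply: ae_eq_integral => //; [exact: mf|exact: mf|].
  move: B00; apply: filterS; first exact: (ae_filter_ringOfSetsType (@lebesgue_measure R)).
  by move=> x hx Sx; rewrite /= hx.
rewrite e in h; apply: cvg_trans h => P hP.
have h1 : \forall t \near (0 : R), `[0, T[%classic t -> P (c t b k) by exact: hP.
have h2 : \forall t \near (0 : R), 0 < t -> P (c t b k).
  near=> t => t0; have tT : t < T by near: t; exact: lt_nbhsl.
  have : `[0, T[%classic t -> P (c t b k) by near: t; exact: h1.
  by apply; rewrite /= in_itv/= ltW.
exact: h2.
Unshelve. all: by end_near. Qed.

End regularity_of_solutions.

(** * Uniqueness by steps of fixed length *)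

Section uniqueness.
Context {R : realType}.
#[local] Opaque ncoef duhamel.
Implicit Types (t s x : R) (b : bool) (k n j : nat) (u w : bool -> nat -> R).
Variables (mu ca cb al T : R) (B0 : R -> R) (B1 B2 : R -> R -> R).
Hypotheses (mu0 : 0 < mu) (al2 : 5 / 2 < al) (B0L : memL2 B0).
Hypotheses (sol1 : solution mu ca cb al T B0 B1) (sol2 : solution mu ca cb al T B0 B2).

Let c1 t : bool -> nat -> R := coef (B1 t).
Let c2 t : bool -> nat -> R := coef (B2 t).
Let diff t b k : R := c1 t b k - c2 t b k.

(** With the clock restarted at [t0], the difference solves linear equations whose source is
    bilinear in the difference and the solutions. The factor [s^gain] improves any bound [A] to
    [A / 2] before [tau], so the difference is 0. As [M] does not depend on [t0], neither does
    [tau]. *)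
Lemma sol_unique_local : exists tau, 0 < tau /\ forall t0, 0 <= t0 < T ->
  (forall b k, (0 < k)%N -> diff (t0 + s) b k @[s --> 0^'+] --> (0 : R)) ->
  forall s b k, 0 < s < tau -> t0 + s < T -> (0 < k)%N -> diff (t0 + s) b k = 0.
Proof.
have [a0 r0 r1 _ g0] := exponent_facts al2; have [la0 _ _] := rate_facts mu0 al2.
have [C [C0 gain_bound]] := linear_gain mu0 al2.
have [M1 [M10 hM1]] := sol_ebound al2 sol1; have [M2 [M20 hM2]] := sol_ebound al2 sol2.
pose M := M1 + M2; have M0 : 0 < M by rewrite addr_gt0.
have m1 : 0 <= M1 <= M by rewrite ltW//= lerDl ltW.
have m2 : 0 <= M2 <= M by rewrite ltW//= lerDr ltW.
pose N := nonlin_const ca cb; have N0 : 0 < N := CN_gt0 ca cb.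
(* Chosen so that [C K = (A / 2) D] for the source bound [K = N (2 A M)], whence
   [C K tau^gain = A / 2]. *)
pose D := 2 * (C * (N * (2 * M))).
have D0 : 0 < D.
  by apply: mulr_gt0 => //; apply: mulr_gt0 => //; apply: mulr_gt0 => //; exact: mulr_gt0.
pose tau := D^-1 `^ (gain al)^-1.
have tau0 : 0 < tau by apply: powR_gt0; rewrite invr_gt0.
exists tau; split=> // t0 /andP[t00 t0T] init.
pose T' := Num.min tau (T - t0).
have inT s : 0 < s < T' -> [/\ 0 < s, s < tau & 0 < t0 + s < T].
  move=> /andP[s0]; rewrite lt_min => /andP[st sT]; split=> //.
  by apply/andP; split; lra.
pose W s b k := diff (t0 + s) b k.
have E1 s : 0 < s < T' -> ebound al 0 s (c1 (t0 + s)) M.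
  move=> /inT[s0 _ sT]; apply: ebound_leA m1 _; apply: hM1 => //.
  by rewrite s0 lerDr.
have E2 s : 0 < s < T' -> ebound al 0 s (c2 (t0 + s)) M.
  move=> /inT[s0 _ sT]; apply: ebound_leA m2 _; apply: hM2 => //.
  by rewrite s0 lerDr.
have half A : 0 < A -> (forall s, 0 < s < T' -> ebound al 0 s (W s) A) ->
    forall s, 0 < s < T' -> ebound al 0 s (W s) (A / 2).
  move=> A0 hA; pose K := N * (2 * (A * M)).
  have K0 : 0 <= K.
    by rewrite /K; apply: mulr_ge0; [exact: ltW|apply: mulr_ge0 => //; apply: mulr_ge0; exact: ltW].
  pose dW s b k := (ncoef ca cb (c1 (t0 + s)) (c1 (t0 + s)) b k - mu * k%:R `^ al * c1 (t0 + s) b k) -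
    (ncoef ca cb (c2 (t0 + s)) (c2 (t0 + s)) b k - mu * k%:R `^ al * c2 (t0 + s) b k).
  have l0 : 0 <= (0 : R) <= rate mu al by rewrite lexx ltW.
  have dWd b k : (0 < k)%N -> forall s, 0 < s < T' -> is_derive s (1 : R) (fun s => W s b k) (dW s b k).
    move=> k0 s /inT[s0 _ sT].
    have ds : is_derive s (1 : R) (fun s => t0 + s) (1 : R).
      by apply: (is_derive_eq (is_deriveD (is_derive_cst t0 s (1 : R)) (is_derive_id s (1 : R)))); rewrite add0r.
    have e1 := @is_derive1_comp _ (fun t => c1 t b k) (fun s => t0 + s) s _ _ (sol_ode mu0 al2 sol1 b sT k0) ds.
    have e2 := @is_derive1_comp _ (fun t => c2 t b k) (fun s => t0 + s) s _ _ (sol_ode mu0 al2 sol2 b sT k0) ds.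
    by apply: (is_derive_eq (is_deriveB e1 e2)); rewrite !mulr1.
  have bnd b k : (0 < k)%N -> forall s, 0 < s < T' ->
      expR (0 * s `^ al^-1 * k%:R) * `|dW s b k + mu * k%:R `^ al * W s b k| <= K * s `^ (- (2 / al)).
    move=> k0 s sT'; have [s0 _ sT] := inT s sT'.
    have f1 := sol_fast al2 sol1 sT; have f2 := sol_fast al2 sol2 sT.
    have fW : fast (W s) by exact: fastB.
    have -> : dW s b k + mu * k%:R `^ al * W s b k =
        ncoef ca cb (W s) (c1 (t0 + s)) b k + ncoef ca cb (c2 (t0 + s)) (W s) b k.
      rewrite -(ncoefB ca cb b k f1 f2) /dW /W /diff.
      move: (ncoef _ _ _ _ _ _) (ncoef _ _ _ _ _ _) (c1 _ _ _) (c2 _ _ _) (mu * _) => y1 y2 y3 y4 y5; ring.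
    have b1 := @coef_nonlin R ca cb al 0 al2 (lexx 0) _ _ A M b k s s0 A0 M0 fW f1 (hA s sT') (E1 s sT').
    have b2 := @coef_nonlin R ca cb al 0 al2 (lexx 0) _ _ M A b k s s0 M0 A0 f2 fW (E2 s sT') (hA s sT').
    have e0 : expR (0 * s `^ al^-1 * k%:R) = 1 :> R by rewrite mul0r mul0r expR0.
    rewrite e0 mul1r in b1; rewrite e0 mul1r in b2; rewrite e0 mul1r.
    apply: le_trans (ler_normD _ _) _.
    have p0 : 0 <= s `^ (- (2 / al)) by exact: powR_ge0.
    have AM : 0 <= A * M * s `^ (- (2 / al)) by apply: mulr_ge0 => //; apply: mulr_ge0; exact: ltW.
    rewrite /K /N /nonlin_const.
    move: (`|ncoef _ _ _ _ _ _|) (`|ncoef _ _ _ _ _ _|) (powR _ _) p0 AM b1 b2 => y1 y2 p p0 AM b1 b2.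
    have -> : (3 * (`|ca| + `|cb|) + 1) * (2 * (A * M)) * p =
      3 * (`|ca| + `|cb|) * (A * M) * p + 3 * (`|ca| + `|cb|) * (M * A) * p + 2 * (A * M * p) by ring.
    by lra.
  move=> s sT'; have [s0 st sT] := inT s sT'.
  have [h _] := gain_bound 0 T' K W dW l0 K0 dWd init bnd s sT'.
  apply: ebound_leA h; apply/andP; split.
    by apply: mulr_ge0; [apply: mulr_ge0 => //; exact: ltW|exact: powR_ge0].
  have sg : s `^ gain al <= D^-1.
    have -> : D^-1 = tau `^ gain al by rewrite /tau -powRrM mulVf ?gt_eqF// powRr1// invr_ge0 ltW.
    by apply: ge0_ler_powR; rewrite ?nnegrE ?(ltW g0) ?(ltW s0) ?(ltW tau0) ?(ltW st).
  have CK : 0 <= C * K by apply: mulr_ge0 => //; exact: ltW.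
  apply: le_trans (ler_wpM2l CK sg) _.
  have alg (c n m a : R) : c * (n * (2 * (a * m))) = a / 2 * (2 * (c * (n * (2 * m)))) by field.
  by rewrite (ler_pdivrMr _ _ D0) /K /D (alg C N M A); exact: lexx.
(* The halving starts from [2 M], the sum of the bounds of the two solutions. *)
have iter n s : 0 < s < T' -> ebound al 0 s (W s) (2 * M / 2 ^+ n).
  elim: n s => [|n IH] s sT'.
    rewrite expr0 divr1 mulr_natl mulr2n.
    apply: (@eboundD R al 0 s (c1 (t0 + s)) (fun b k => - c2 (t0 + s) b k)) => //; first exact: E1.
    by apply: ebound_le (E2 s sT') => b k _; rewrite normrN.
  have -> : 2 * M / 2 ^+ n.+1 = 2 * M / 2 ^+ n / 2 by rewrite exprSr invfM mulrA.
  by apply: half => //; rewrite divr_gt0 ?exprn_gt0// mulr_gt0.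
move=> s b k /andP[s0 st] sT k0.
have sT' : 0 < s < T' by rewrite s0 /T' lt_min st; lra.
apply/eqP; rewrite -normr_le0; refine (cvgr_to_ge (geo_cvg0 M) _); apply: nearW => n.
have e0 : 0 <= 2 * M / 2 ^+ n by apply: divr_ge0; [rewrite mulr_ge0// ltW|exact: exprn_ge0].
apply: le_trans (ebound_term b e0 (iter n s sT') k0).
by rewrite ler_peMl//; apply: weight_ge1.
Qed.

(** Continuation from one restart to the next: the difference tends to 0 at the origin because the
    data agree, and at a later restart because it vanishes there by induction and is continuous. *)
Lemma sol_coef_unique t b k : 0 < t < T -> (0 < k)%N -> coef (B1 t) b k = coef (B2 t) b k.
Proof.
move=> tT k0; have [tau [tau0 loc]] := sol_unique_local.
(* Steps of length [tau / 2] keep the elapsed time strictly below [tau]. *)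
have h20 : 0 < tau / 2 by rewrite divr_gt0.
suff H j : forall t, 0 < t < T -> t <= j%:R * (tau / 2) -> forall b k, (0 < k)%N -> diff t b k = 0.
  apply/eqP; rewrite -subr_eq0; apply/eqP.
  apply: (H (Num.trunc (t / (tau / 2))).+1 t tT _ b k k0).
  by rewrite -ler_pdivrMr//; apply: ltW; exact: truncnS_gt.
elim: j => [|j IH] {t b k tT k0} t tT tj b k k0; first by move: tT tj; rewrite mul0r => /andP[? _]; lra.
have [|jt] := leP t (j%:R * (tau / 2)); first by move=> h; exact: IH.
have /andP[t0 tT'] := tT.
have j0 : 0 <= j%:R * (tau / 2) by rewrite mulr_ge0// ltW.
have jT : 0 <= j%:R * (tau / 2) < T by rewrite j0; exact: lt_trans jt tT'.
have et : t = j%:R * (tau / 2) + (t - j%:R * (tau / 2)) by rewrite addrC subrK.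
rewrite et; apply: loc => //; last by rewrite -et.
  move=> {b k k0} b k k0; have T0 : 0 < T by exact: lt_trans t0 tT'.
  move: j0; rewrite le_eqVlt => /predU1P[<-|jp].
    rewrite (_ : (fun s => diff (0 + s) b k) = fun s => c1 s b k - c2 s b k); last first.
      by apply/funext => s; rewrite add0r.
    have l : c1 s b k - c2 s b k @[s --> 0^'+] --> coef B0 b k - coef B0 b k.
      by apply: cvgB; [exact: (sol_init sol1 B0L T0 k0)|exact: (sol_init sol2 B0L T0 k0)].
    by rewrite subrr in l.
  have jI : 0 < j%:R * (tau / 2) < T by rewrite jp; exact: lt_trans jt tT'.
  have z : diff (j%:R * (tau / 2)) b k = 0 by apply: IH.
  have d := is_deriveB (sol_ode mu0 al2 sol1 b jI k0) (sol_ode mu0 al2 sol2 b jI k0).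
  have cd : {for j%:R * (tau / 2), continuous (fun t => diff t b k)} by exact: is_derive_continuous d.
  apply: cvg_at_right_filter; rewrite -[X in _ --> X]z.
  rewrite -{2}[j%:R * (tau / 2)]addr0.
  apply: (@continuous_comp _ _ _ (fun s => j%:R * (tau / 2) + s) (fun t => diff t b k)).
    by apply: cvgD; [exact: cvg_cst|exact: cvg_id].
  by rewrite /= addr0; exact: cd.
by move: tj; rewrite -natr1 mulrDl mul1r => tj; apply/andP; split; lra.
Qed.

(** At [t = 0] both solutions are tied to [B0] almost everywhere; at positive times both equal the
    series of the same coefficients. *)
Lemma sol_unique t : t \in `[0, T[ -> B1 t = B2 t %[ae lebesgue_measure in S1 R].
Proof.
rewrite in_itv/= => /andP[]; rewrite le_eqVlt => /predU1P[<- _|t0 tT].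
  have [_ _ h1 _ _] := sol1; have [_ _ h2 _ _] := sol2.
  exact: ae_eq_trans h1 (ae_eq_sym h2).
have tI : 0 < t < T by rewrite t0.
rewrite (sol_trig al2 sol1 tI) (sol_trig al2 sol2 tI).
rewrite (_ : trig (coef (B1 t)) = trig (coef (B2 t))); first exact: ae_eq_refl.
by apply/funext => x; apply: eq_trig => b k k0; exact: sol_coef_unique.
Qed.

End uniqueness.

(** * Well-posedness for square integrable data *)

Theorem theorem1p2 (R : realType) (mu a b alpha : R)
    (hmu : 0 < mu) (halpha : 5 / 2 < alpha) :
  exists T : R -> R,
  forall B0 : R -> R, memL2 B0 -> zero_mean B0 ->
  let T0 := T (fine (normL2 B0)) in
  0 < T0 /\
  exists B : R -> R -> R,
    solution mu a b alpha T0 B0 B /\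
    (forall B' : R -> R -> R, solution mu a b alpha T0 B0 B' ->
       forall t : R, t \in `[0, T0[ ->
         B' t = B t %[ae lebesgue_measure in S1 R]).
Proof.
have [Tm hTm] := mild_existence a b hmu halpha.
exists Tm => B0 B0L B0z T0.
have I0 : 0 <= Iper (fun x => B0 x ^+ 2) by apply: Rintegral_ge0 => x _; exact: sqr_ge0.
have mE : fine (normL2 B0) = Num.sqrt (Iper (fun x => B0 x ^+ 2)) by rewrite normL2E.
have m0 : 0 <= fine (normL2 B0) by rewrite mE sqrtr_ge0.
have [T00 ex] := hTm _ m0; split; first exact: T00.
(* Bessel's inequality bounds [pi] times the sum, and [pi >= 1]; so the L2 norm itself can be the
   argument of [Tm]. *)
have u0m n : psum (fun k => coef B0 false k ^+ 2 + coef B0 true k ^+ 2) n <= fine (normL2 B0) ^+ 2.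
  rewrite mE sqr_sqrtr//; apply: le_trans (bessel n B0L); apply: ler_peMl.
    by apply: psum_ge0 => k _; rewrite addr_ge0 ?sqr_ge0.
  by have := @pi_ge2 R; lra.
have [M [v [M0 vA vD vB]]] := ex _ u0m.
exists (flow B0 v).
have sol : solution mu a b alpha T0 B0 (flow B0 v).
  split.
  - split; first exact: (flow_contL2 hmu halpha T00 M0 B0L B0z vA vB).
    exact: (flow_sqintH hmu halpha T00 M0 B0L B0z vA vB).
  - move=> t; rewrite in_itv/= => tT.
    by have [] := flow_memL2 hmu halpha M0 B0L B0z vA tT.
  - rewrite (_ : flow B0 v 0 = B0); first exact: ae_eq_refl.
    by apply/funext => x; rewrite /flow eqxx.
  - exact: (flow_solves B0 hmu halpha M0 vA vD).
  - split=> q q0; first exact: (flow_sup hmu halpha M0 B0L B0z vA vB q0).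
    exact: (flow_lim hmu halpha T00 M0 B0L B0z vA vB q0).
split=> // B' sol' t tT.
exact: (sol_unique hmu halpha B0L sol' sol tT).
Qed.
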